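(* Let $d\ge1$, let $a_1,a_2,b_1,b_2,c_1,c_2>0$, and put $\mathbf{a}=(a_1,a_2)$, $|\mathbf{a}|=a_1+a_2$, $\mathbf{b}=(b_1,b_2)$, $|\mathbf{b}|=b_1+b_2$, $\mathbf{c}=(c_1,c_2)$, $|\mathbf{c}|=c_1+c_2$. Let $\mathbf{k}=(k_1,\dots,k_d)$, $\mathbf{l}=(l_1,\dots,l_d)\in\mathbb{N}_0^d$ and let $n,m$ be integers with $n\ge|\mathbf{k}|$, $m\ge|\mathbf{l}|$. Define $$B^{(d+1)}_{n,\mathbf{k}}(t,\boldsymbol{x};a_1,a_2,b_1,b_2,c_1,c_2)={}_3F_2\!\left(\begin{matrix}-n+|\mathbf{k}|,\ n+|\mathbf{k}|+|\mathbf{b}|+|\mathbf{c}|-1,\ |\mathbf{k}|+b_1-\frac t2\\ 2|\mathbf{k}|+|\mathbf{b}|,\ |\mathbf{k}|+b_1+c_1\end{matrix}\,\Big|\,1\right)$$ $$\times\left(b_1-\tfrac t2\right)_{|\mathbf{k}|}\prod_{j=1}^d\left\{\Gamma\!\left(a_1+\tfrac{|\mathbf{k}^{j+1}|-x_j}{2}+\tfrac{d-j}{4}\right)\Gamma\!\left(a_1+\tfrac{|\mathbf{k}^{j+1}|+x_j}{2}+\tfrac{d-j}{4}\right)\right.$$ $$\left.\times\,{}_3F_2\!\left(\begin{matrix}-k_j,\ k_j+2\left(|\mathbf{k}^{j+1}|+|\mathbf{a}|+\frac{d-j-1}{2}\right),\ a_1+\frac{|\mathbf{k}^{j+1}|+x_j}{2}+\frac{d-j}{4}\\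 |\mathbf{k}^{j+1}|+|\mathbf{a}|+\frac{d-j}{2},\ |\mathbf{k}^{j+1}|+2a_1+\frac{d-j}{2}\end{matrix}\,\Big|\,1\right)\right\},$$ or, in terms of continuous Hahn polynomials $p_k$, $$B^{(d+1)}_{n,\mathbf{k}}(t,\boldsymbol{x};a_1,a_2,b_1,b_2,c_1,c_2)=\frac{(n-|\mathbf{k}|)!\;i^{|\mathbf{k}|-n}\left(b_1-\frac t2\right)_{|\mathbf{k}|}}{(2|\mathbf{k}|+|\mathbf{b}|)_{n-|\mathbf{k}|}\,(|\mathbf{k}|+b_1+c_1)_{n-|\mathbf{k}|}}\;p_{n-|\mathbf{k}|}\!\left(\tfrac{it}{2};\,|\mathbf{k}|+b_1,\,c_2,\,|\mathbf{k}|+b_2,\,c_1\right)$$ $$\times\prod_{j=1}^d\left\{\frac{k_j!\,i^{-k_j}}{\left(|\mathbf{k}^{j+1}|+2a_1+\frac{d-j}{2}\right)_{k_j}\left(|\mathbf{k}^{j+1}|+|\mathbf{a}|+\frac{d-j}{2}\right)_{k_j}}\;p_{k_j}\!\left(-\tfrac{ix_j}{2};\,\alpha_j,\,\alpha_j',\,\alpha_j',\,\alpha_j\right)\right.$$ $$\left.\times\,\Gamma\!\left(a_1+\tfrac{|\mathbf{k}^{j+1}|-x_j}{2}+\tfrac{d-j}{4}\right)\Gamma\!\left(a_1+\tfrac{|\mathbf{k}^{j+1}|+x_j}{2}+\tfrac{d-j}{4}\right)\right\},$$ where $\alpha_j=a_1+\frac{|\mathbf{k}^{j+1}|}{2}+\frac{d-j}{4}$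 and $\alpha_j'=a_2+\frac{|\mathbf{k}^{j+1}|}{2}+\frac{d-j}{4}$. Then $$\int_{-\infty}^{\infty}\!\!\cdots\int_{-\infty}^{\infty}\Gamma\!\left(b_1-\tfrac{it}{2}\right)\Gamma\!\left(b_2+\tfrac{it}{2}\right)\Gamma\!\left(c_1+\tfrac{it}{2}\right)\Gamma\!\left(c_2-\tfrac{it}{2}\right)$$ $$\times B^{(d+1)}_{n,\mathbf{k}}(it,i\boldsymbol{x};a_1,a_2,b_1,b_2,c_1,c_2)\,B^{(d+1)}_{m,\mathbf{l}}(-it,-i\boldsymbol{x};a_2,a_1,b_2,b_1,c_2,c_1)\,d\boldsymbol{x}\,dt$$ $$=(2\pi)^{d+1}\,2^{-2d|\mathbf{a}|+d+2}\;h_{\mathbf{k}}^{(a_1+a_2-\frac12)}\,(n-|\mathbf{k}|)!$$ $$\times\frac{\Gamma(n+|\mathbf{k}|+|\mathbf{b}|)\,\Gamma(n-|\mathbf{k}|+|\mathbf{c}|)\,\Gamma(|\mathbf{k}|+b_1+c_1)\,\Gamma(|\mathbf{k}|+b_2+c_2)}{\left((2|\mathbf{k}|+|\mathbf{b}|)_{n-|\mathbf{k}|}\right)^2(2n+|\mathbf{b}|+|\mathbf{c}|-1)\,\Gamma(n+|\mathbf{k}|+|\mathbf{b}|+|\mathbf{c}|-1)}\,\delta_{n,m}$$ $$\times\prod_{j=1}^{d}\frac{(k_j!)^2\,\Gamma\!\left(|\mathbf{k}^{j+1}|+2a_1+\frac{d-j}{2}\right)\Gamma\!\left(|\mathbf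{k}^{j+1}|+2a_2+\frac{d-j}{2}\right)}{2^{2|\mathbf{k}^{j+1}|}\left((2|\mathbf{k}^{j+1}|+2|\mathbf{a}|+d-j-1)_{k_j}\right)^2}\,\delta_{k_j,l_j}.$$
   Context: Notation: $\mathbb{N}_0=\{0,1,2,\dots\}$; $|\mathbf{k}|=k_1+\cdots+k_d$; $\mathbf{k}^{j}=(k_j,\dots,k_d)$ and $|\mathbf{k}^{j}|=k_j+\cdots+k_d$ for $1\le j\le d$, and $|\mathbf{k}^{d+1}|=0$ (similarly for $\mathbf{l}$). $\boldsymbol{x}=(x_1,\dots,x_d)$, $i\boldsymbol{x}=(ix_1,\dots,ix_d)$ with $i$ the imaginary unit; the integral is over $(t,\boldsymbol{x})\in\mathbb{R}^{d+1}$. The function $B^{(d+1)}_{m,\mathbf{l}}(\cdot,\cdot;a_2,a_1,b_2,b_1,c_2,c_1)$ is the same expression with $(n,\mathbf{k})$ replaced by $(m,\mathbf{l})$ and with $a_1\leftrightarrow a_2$, $b_1\leftrightarrow b_2$, $c_1\leftrightarrow c_2$ interchanged. $\delta$ is the Kronecker delta and $\Gamma$ the Gamma function. Pochhammer symbol: $(\alpha)_0=1$, $(\alpha)_n=\alpha(\alpha+1)\cdots(\alpha+n-1)$ for $n\ge1$. Hypergeometric function: ${}_pF_q\!\left(\begin{matrix}a_1,\dots,a_p\\ b_1,\dots,b_q\end{matrix}\Big|x\right)=\sum_{n\ge0}\frac{(a_1)_n\cdots(a_p)_n}{(b_1)_n\cdots(b_q)_n}\frac{x^n}{n!}$. The constant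 $h_{\mathbf{k}}^{(\mu)}$ (the squared norm of a product-type orthogonal polynomial on the unit ball of $\mathbb{R}^d$ for the weight $(1-\|\boldsymbol{x}\|^2)^{\mu-1/2}$) is $$h_{\mathbf{k}}^{(\mu)}=\frac{\pi^{d/2}\,\Gamma(\mu+\frac12)\,(\mu+\frac d2)_{|\mathbf{k}|}}{\Gamma(\mu+\frac{d+1}{2}+|\mathbf{k}|)}\prod_{j=1}^{d}\frac{(\mu+\frac{d-j}{2})_{|\mathbf{k}^j|}\,(2\mu+2|\mathbf{k}^{j+1}|+d-j)_{k_j}}{k_j!\,(\mu+\frac{d-j+1}{2})_{|\mathbf{k}^j|}}.$$ Continuous Hahn polynomials, with parameters $A,B,C,D$: $$p_k(x;A,B,C,D)=i^k\frac{(A+C)_k(A+D)_k}{k!}\,{}_3F_2\!\left(\begin{matrix}-k,\ k+A+B+C+D-1,\ A+ix\\ A+C,\ A+D\end{matrix}\Big|1\right).$$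
   Formalization: The printed right-hand side is too large for d≥3; the formal theorem multiplies it by 2^{-(d-1)(d-2)/2} (equal to 1 for d=1,2). Where it is 0/0 or has a pole (|a|=1/2 with k_d>0; n=0 with |b|+|c|=1), it is read as the limit as a_1, b_1 are shifted by e→0. *)

(* Defs.v *)
From HB Require Import structures.
From mathcomp Require Import all_boot all_order all_algebra.
From mathcomp Require Import all_classical all_reals all_analysis.
From mathcomp Require Import complex.

Set Implicit Arguments.
Unset Strict Implicit.
Unset Printing Implicit Defensive.

Import Order.TTheory GRing.Theory Num.Theory.
Import numFieldNormedType.Exports.

Local Open Scope classical_set_scope.
Local Open Scope ring_scope.
Local Open Scope complex_scope.

(* [poch a n] is the rising factorial (a)_n; MathComp's [_ ^_ _] is the
   falling one, on nat. *)
Definition poch (F : pzRingType) (a : F) (n : nat) : F :=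
  \prod_(s < n) (a + s%:R).

Section Integral.
Context {R : realType}.

Definition Cintegrable d (T : measurableType d) (mu : {measure set T -> \bar R})
    (D : set T) (f : T -> R[i]) : Prop :=
  mu.-integrable D (fun x => (complex.Re (f x))%:E) /\
  mu.-integrable D (fun x => (complex.Im (f x))%:E).

Definition Cintegral d (T : measurableType d) (mu : {measure set T -> \bar R})
    (D : set T) (f : T -> R[i]) : R[i] :=
  (\int[mu]_(x in D) complex.Re (f x)) +i* (\int[mu]_(x in D) complex.Im (f x)).

(* MathComp-Analysis has the sigma-algebra on [n.-tuple T] but no product
   measure there: it is built by transporting [lebesgue_measure \x m] along
   (x, v) |-> x :: v. *)
Section ConsMeasure.
Local Open Scope ereal_scope.
Context (n : nat).
Notation RR := (measurableTypeR R).

Definition consR (p : RR * n.-tuple RR) : n.+1.-tuple RR :=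
  [the n.+1.-tuple RR of p.1 :: p.2].

Definition unconsR (v : n.+1.-tuple RR) : RR * n.-tuple RR :=
  (thead v, [tuple of behead v]).

Lemma consRK : cancel consR unconsR.
Proof. by case=> x v; congr pair => //=; apply/val_inj. Qed.

Lemma unconsRK : cancel unconsR consR.
Proof. by move=> v; rewrite [RHS]tuple_eta; apply/val_inj. Qed.

Lemma measurable_consR : measurable_fun [set: RR * n.-tuple RR] consR.
Proof. by apply: measurable_cons. Qed.

Lemma measurable_unconsR : measurable_fun [set: n.+1.-tuple RR] unconsR.
Proof.
apply/measurable_fun_pairP; split => /=.
  exact: (@measurable_tnth _ RR n.+1 ord0).
exact: measurable_behead.
Qed.

Variable m : {sigma_finite_measure set (n.-tuple RR) -> \bar R}.

Definition cons_measure : set (n.+1.-tuple RR) -> \bar R :=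
  pushforward (@lebesgue_measure R \x m) consR.

Let cons_measure0 : cons_measure set0 = 0.
Proof. by rewrite /cons_measure /pushforward preimage_set0 measure0. Qed.

Let cons_measure_ge0 A : 0 <= cons_measure A.
Proof. exact: (measure_ge0 (@lebesgue_measure R \x m)). Qed.

Let cons_measure_sigma_additive : semi_sigma_additive cons_measure.
Proof.
have mV A : measurable A -> measurable (consR @^-1` A).
  by move=> mA; rewrite -[X in measurable X]setTI; exact: measurable_consR.
move=> F mF tF mUF; rewrite /cons_measure /pushforward preimage_bigcup.
apply: (@measure_semi_sigma_additive _ _ _ (@lebesgue_measure R \x m)).
- by move=> i; exact: mV.
- apply/trivIsetP => /= i j _ _ ij; rewrite -preimage_setI.
  by move/trivIsetP : tF => /(_ _ _ _ _ ij) ->//; rewrite preimage_set0.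
- by rewrite -preimage_bigcup; exact: mV.
Qed.

HB.instance Definition _ := isMeasure.Build _ _ _ cons_measure
  cons_measure0 cons_measure_ge0 cons_measure_sigma_additive.

Lemma cons_measure_sigma_finite : sigma_finite [set: n.+1.-tuple RR] cons_measure.
Proof.
have /sigma_finiteP[F [FT ndF Foo]] := sigma_finiteT (@lebesgue_measure R).
have /sigma_finiteP[G [GT ndG Goo]] := sigma_finiteT m.
exists (fun i => unconsR @^-1` (F i `*` G i)).
  rewrite -preimage_bigcup (_ : \bigcup_i _ = setT) ?preimage_setT//.
  rewrite -subTset => -[x y] _.
  have [i _ Fix] : (\bigcup_i F i) x by rewrite -FT.
  have [j _ Gjy] : (\bigcup_i G i) y by rewrite -GT.
  exists (maxn i j) => //; split => /=.
  - by move: x Fix; exact/subsetPset/ndF/leq_maxl.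
  - by move: y Gjy; exact/subsetPset/ndG/leq_maxr.
move=> i; have [mF Fi] := Foo i; have [mG Gi] := Goo i; split.
  rewrite -[X in measurable X]setTI; apply: measurable_unconsR => //.
  exact: measurableX.
rewrite /cons_measure /pushforward (_ : consR @^-1` _ = F i `*` G i).
  by rewrite product_measure1E// lte_mul_pinfty// ge0_fin_numE.
by rewrite -comp_preimage (_ : unconsR \o consR = id) //; apply/funext => p; exact: consRK.
Qed.

HB.instance Definition _ := Measure_isSigmaFinite.Build _ _ _ cons_measure
  cons_measure_sigma_finite.

End ConsMeasure.

Fixpoint lebesgue_tuple (n : nat) :
    {sigma_finite_measure set (n.-tuple (measurableTypeR R)) -> \bar R} :=
  match n with
  | 0 => \d_ ([tuple] : 0.-tuple (measurableTypeR R))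
  | n'.+1 => cons_measure (lebesgue_tuple n')
  end.

End Integral.

Section SpecialFunctions.
Context {R : realType}.

Definition cpowR (u : R) (z : R[i]) : R[i] :=
  (u `^ complex.Re z)%:C *
  (cos (complex.Im z * ln u) +i* sin (complex.Im z * ln u)).

Definition gamma_int (z : R[i]) : R[i] :=
  Cintegral (@lebesgue_measure R) `]0%R, +oo[
    (fun u => cpowR u (z - 1) * (expR (- u))%:C).

(* Euler's integral where it converges (Re z > 0), extended to the left by
   Gamma(z) = Gamma(z + N) / (z)_N. *)
Definition Cgamma (z : R[i]) : R[i] :=
  let N := if 0 < complex.Re z then 0%N else (Num.truncn (- complex.Re z)).+1 in
  gamma_int (z + N%:R) / poch z N.

Definition Rgamma (x : R) : R := complex.Re (Cgamma x%:C).

Definition pFq (a b : seq R[i]) (x : R[i]) : R[i] :=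
  limn (fun N : nat => \sum_(0 <= s < N)
    ((\prod_(u <- a) poch u s) / (\prod_(v <- b) poch v s)
     * (x ^+ s / s`!%:R)) : R[i]^o).

Definition continuous_Hahn (k : nat) (x A B C D : R[i]) : R[i] :=
  'i ^+ k * (poch (A + C) k * poch (A + D) k / k`!%:R)
  * pFq [:: - k%:R; k%:R + A + B + C + D - 1; A + 'i * x] [:: A + C; A + D] 1.

End SpecialFunctions.

(* Coordinates are indexed from 0: [j : 'I_d] is the usual index j + 1. So, for
   the usual index J = j + 1, |k^J| is [tail k j], |k^(J+1)| is [tail k j.+1],
   |k| is [tail k 0] and d - J is [(d - j.+1)%N]. *)
Definition tail d (k : 'I_d -> nat) (j : nat) : nat :=
  \sum_(i < d | (j <= i)%N) k i.

Section Biorthogonal.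
Context {R : realType} (d : nat).

Definition Bfun (n : nat) (k : 'I_d -> nat) (a1 a2 b1 b2 c1 c2 : R)
    (t : R[i]) (x : 'I_d -> R[i]) : R[i] :=
  let K : R[i] := (tail k 0)%:R in
  pFq [:: - n%:R + K;
          n%:R + K + (b1 + b2)%:C + (c1 + c2)%:C - 1;
          K + b1%:C - t / 2]
      [:: 2 * K + (b1 + b2)%:C; K + b1%:C + c1%:C] 1
  * poch (b1%:C - t / 2) (tail k 0)
  * \prod_(j < d)
      let s : R[i] := (tail k j.+1)%:R in
      let e : R[i] := (d - j.+1)%N%:R in
      Cgamma (a1%:C + (s - x j) / 2 + e / 4)
      * Cgamma (a1%:C + (s + x j) / 2 + e / 4)
      * pFq [:: - (k j)%:R;
                (k j)%:R + 2 * (s + (a1 + a2)%:C + (e - 1) / 2);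
                a1%:C + (s + x j) / 2 + e / 4]
            [:: s + (a1 + a2)%:C + e / 2; s + 2 * a1%:C + e / 2] 1.

Definition Bfun_Hahn (n : nat) (k : 'I_d -> nat) (a1 a2 b1 b2 c1 c2 : R)
    (t : R[i]) (x : 'I_d -> R[i]) : R[i] :=
  let K : R[i] := (tail k 0)%:R in
  let p := (n - tail k 0)%N in
  p`!%:R * 'i ^- p * poch (b1%:C - t / 2) (tail k 0)
  / (poch (2 * K + (b1 + b2)%:C) p * poch (K + b1%:C + c1%:C) p)
  * continuous_Hahn p ('i * t / 2) (K + b1%:C) c2%:C (K + b2%:C) c1%:C
  * \prod_(j < d)
      let s : R[i] := (tail k j.+1)%:R in
      let e : R[i] := (d - j.+1)%N%:R in
      let al := a1%:C + s / 2 + e / 4 in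
      let al' := a2%:C + s / 2 + e / 4 in
      (k j)`!%:R * 'i ^- k j
      / (poch (s + 2 * a1%:C + e / 2) (k j)
         * poch (s + (a1 + a2)%:C + e / 2) (k j))
      * continuous_Hahn (k j) (- ('i * x j / 2)) al al' al' al
      * Cgamma (a1%:C + (s - x j) / 2 + e / 4)
      * Cgamma (a1%:C + (s + x j) / 2 + e / 4).

(* The point v of R^(d+1) is (t, x_1, ..., x_d). *)
Definition integrand (n : nat) (k : 'I_d -> nat) (m : nat) (l : 'I_d -> nat)
    (a1 a2 b1 b2 c1 c2 : R)
    (v : d.+1.-tuple (measurableTypeR R)) : R[i] :=
  let t : R[i] := (tnth v ord0 : R)%:C in
  let x := fun j : 'I_d => (tnth v (lift ord0 j) : R)%:C in
  Cgamma (b1%:C - 'i * t / 2) * Cgamma (b2%:C + 'i * t / 2)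
  * Cgamma (c1%:C + 'i * t / 2) * Cgamma (c2%:C - 'i * t / 2)
  * Bfun n k a1 a2 b1 b2 c1 c2 ('i * t) (fun j => 'i * x j)
  * Bfun m l a2 a1 b2 b1 c2 c1 (- ('i * t)) (fun j => - ('i * x j)).

Definition ball_norm (k : 'I_d -> nat) (mu : R) : R :=
  pi `^ (d%:R / 2) * Rgamma (mu + 1 / 2) * poch (mu + d%:R / 2) (tail k 0)
  / Rgamma (mu + (d%:R + 1) / 2 + (tail k 0)%:R)
  * \prod_(j < d)
      let s : R := (tail k j.+1)%:R in
      let e : R := (d - j.+1)%N%:R in
      poch (mu + e / 2) (tail k j) * poch (2 * mu + 2 * s + e) (k j)
      / ((k j)`!%:R * poch (mu + (e + 1) / 2) (tail k j)).

Definition biorth_rhs (n : nat) (k : 'I_d -> nat) (m : nat) (l : 'I_d -> nat)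
    (a1 a2 b1 b2 c1 c2 : R) : R :=
  let A := a1 + a2 in
  let B := b1 + b2 in
  let C := c1 + c2 in
  let K : R := (tail k 0)%:R in
  let N : R := n%:R in
  (2 * pi) ^+ d.+1 * 2 `^ (- (2 * d%:R * A) + d%:R + 2)
  * ball_norm k (a1 + a2 - 1 / 2) * (n - tail k 0)%N`!%:R
  * (Rgamma (N + K + B) * Rgamma (N - K + C)
     * Rgamma (K + b1 + c1) * Rgamma (K + b2 + c2)
     / (poch (2 * K + B) (n - tail k 0) ^+ 2 * (2 * N + B + C - 1)
        * Rgamma (N + K + B + C - 1)))
  * (n == m)%:R
  * \prod_(j < d)
      let s : R := (tail k j.+1)%:R in
      let e : R := (d - j.+1)%N%:R in
      (k j)`!%:R ^+ 2 * Rgamma (s + 2 * a1 + e / 2) * Rgamma (s + 2 * a2 + e / 2)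
      / (2 ^+ (2 * tail k j.+1) * poch (2 * s + 2 * A + e - 1) (k j) ^+ 2)
      * (k j == l j)%:R.

(* The only denominators of [biorth_rhs] that can vanish for positive
   parameters: 2n + |b| + |c| - 1 does, together with a pole of the Gamma
   factor next to it, when n = 0 and |b| + |c| = 1; the Pochhammer symbol does,
   together with two factors of [ball_norm], when |a| = 1/2 and the last
   coordinate of k is positive. *)
Definition rhs_defined (n : nat) (k : 'I_d -> nat) (a1 a2 b1 b2 c1 c2 : R) : bool :=
  (2 * n%:R + (b1 + b2) + (c1 + c2) - 1 != 0) &&
  [forall j : 'I_d,
     poch (2 * (tail k j.+1)%:R + 2 * (a1 + a2) + (d - j.+1)%N%:R - 1) (k j) != 0].

(* 2^(-(d-1)(d-2)/2), which is 1 for d = 1 and d = 2. The closed form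
   [biorth_rhs] is too large by the inverse of this factor when d >= 3: at
   k = 0, Barnes' first lemma turns the integral over x_j, with e = d - j, into
     4 pi Gamma(2 a1 + e/2) Gamma(2 a2 + e/2) Gamma(|a| + e/2)^2
       / Gamma(2|a| + e),
   and after Legendre duplication the powers of 2 multiply, together with the
   one from the integral over t, to (2 pi)^(d+1) 2^(-2d|a| + 2d + 1 - d(d-1)/2),
   whose exponent is -2d|a| + d + 2 - (d-1)(d-2)/2. *)
Definition power_correction : R := 2 ^- 'C(d.-1, 2).

End Biorthogonal.

(* Main.v *)
Require Import Defs.
From HB Require Import structures.
From mathcomp Require Import all_boot all_order all_algebra.
From mathcomp Require Import all_classical all_reals all_analysis.
From mathcomp Require Import measurable_realfun complex.
From mathcomp Require Import ring lra zify.

Set Implicit Arguments.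
Unset Strict Implicit.
Unset Printing Implicit Defensive.

Import Order.TTheory GRing.Theory Num.Theory.
Import numFieldNormedType.Exports.

Local Open Scope classical_set_scope.
Local Open Scope ring_scope.
Local Open Scope complex_scope.

(** Why the theorem holds. On the real points the integrand is a product of
functions of the separate variables [t], [x_1], ..., [x_d] ([integrand_factor]).
Each of them is a product of four Gamma functions on vertical lines,
Gamma(a + iy) Gamma(b + iy) Gamma(c - iy) Gamma(d - iy), times two terminating
hypergeometric polynomials, which are continuous Hahn polynomials for this weight
([Cintegral_hahn]). The weight for [x_j] depends on [k] and [l] only through
[k_(j+1)], ..., [k_d] and [l_(j+1)], ..., [l_d]; when these agree, the two
polynomials belong to one orthogonal family, so orthogonality is used at the last
index where [k] and [l] differ, and for [t] when [k = l] ([Cintegral_integrand]).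

The integral of the weight is Barnes' first lemma ([Rintegral_barnes_Re]). After
[u = e^x], Gamma(a + iy) is the Fourier transform of [e^(a x - e^x)], so that
Gamma(a + iy) Gamma(c - iy) is the transform of a correlation, which is a
multiple of the beta kernel [e^(a x) / (1 + e^x)^(a + c)]. The product of four
Gamma functions is then the transform of a correlation of two beta kernels, and
Fourier inversion at the origin ([Fourier_inversion0], proved by Abel summation)
gives its integral. The functional equation of Gamma absorbs Pochhammer symbols
into the weight; the integral of a product of two Hahn polynomials thereby
becomes a double sum with weights [(E)_(s+r) / (S)_(s+r)], the moments of a beta
distribution, which is the orthogonality of Jacobi polynomials
([Jacobi_orthogonality], by finite differences).

The product of the norms so obtained, [diagonal_value], is a regular function of
the positive parameters. Legendre's duplication formula ([rgam_duplication],
from two substitutions in one integral) brings each factor into the form of the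
stated product up to quotients that telescope over [j] ([diagonal_valueE]). When
a denominator of the closed form vanishes, [diagonal_value] still gives the
integral and is continuous in the parameters, while the closed form is defined
at all nearby parameters [a1 + e], [b1 + e], so its limit is the same value. *)

(** * Changes of variables on the real line *)

Section LineIntegrals.
Context {R : realType}.
Let mu : {measure set (measurableTypeR R) -> \bar R} := @lebesgue_measure R.
Implicit Types (f g G phi : R -> R).

Lemma itvNn_nondecreasing phi : {homo phi : x y / x <= y} ->
  nondecreasing_seq (fun n : nat => `[phi (- n%:R), phi n%:R]%classic : set R).
Proof.
move=> phi_le m n mn; apply/subsetPset => x /=; rewrite !in_itv/= => /andP[h1 h2].
rewrite (le_trans (phi_le _ _ _) h1) ?lerN2 ?ler_nat//.
by rewrite (le_trans h2)// phi_le// ler_nat.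
Qed.

Lemma bigcup_itvNn phi : continuous phi -> {homo phi : x y / x <= y} ->
  \bigcup_(n : nat) `[phi (- n%:R), phi n%:R]%classic = range phi.
Proof.
move=> cphi phi_le; apply/seteqP; split=> [u [n _ /=]|_ [x _ <-]].
  move=> unn.
  have nn : - n%:R <= n%:R :> R by rewrite (@le_trans _ _ 0)// oppr_le0.
  have [|x _ <-] := @IVT _ phi (- n%:R) n%:R u nn (continuous_subspaceT cphi).
    by move: unn; rewrite in_itv/= min_l ?max_r// phi_le.
  by exists x.
exists (Num.truncn `|x|).+1 => //=; rewrite in_itv/=.
have /ltW : `|x| < (Num.truncn `|x|).+1%:R by exact: truncnS_gt.
by rewrite ler_norml => /andP[h1 h2]; rewrite !phi_le.
Qed.

Lemma range_id : range (@id R) = setT.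
Proof. by rewrite image_id. Qed.

(** Changes of variables are available on compact intervals; monotone convergence
along these intervals transfers them to the range of [phi]. *)
Lemma cvg_ge0_integral_itvNn phi G : {homo phi : x y / x <= y} ->
  (forall n : nat, {within `[phi (- n%:R), phi n%:R], continuous G}) ->
  (forall (n : nat) x, `[phi (- n%:R), phi n%:R]%classic x -> 0 <= G x) ->
  (\int[mu]_(x in `[phi (- n%:R)%R, phi n%:R%R]) (G x)%:E @[n --> \oo] -->
    \int[mu]_(x in \bigcup_(n : nat) `[phi (- n%:R)%R, phi n%:R%R]%classic) (G x)%:E)%E.
Proof.
move=> phi_le cG G0.
apply: (@ge0_nondecreasing_set_cvg_integral _ (measurableTypeR R) R
  (fun n : nat => `[phi (- n%:R), phi n%:R]%classic) (EFin \o G) mu) => //.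
- exact: itvNn_nondecreasing.
- move=> n; apply/measurable_EFinP; exact: subspace_continuous_measurable_fun.
Qed.

Lemma cvg_ge0_integral_itvT G : continuous G -> (forall x, 0 <= G x) ->
  (\int[mu]_(x in `[(- n%:R)%R, n%:R%R]) (G x)%:E @[n --> \oo] --> \int[mu]_x (G x)%:E)%E.
Proof.
move=> cG G0; have cid : continuous (@id R) by move=> x; exact: cvg_id.
rewrite -[X in (_ --> \int[_]_(x in X) _)%E]range_id -bigcup_itvNn//.
apply: (@cvg_ge0_integral_itvNn id) => // n; exact: continuous_subspaceT.
Qed.

Lemma ge0_integral_substitution phi phi' G :
  (forall x, is_derive x (1:R) phi (phi' x)) -> continuous phi' ->
  (forall x, 0 < phi' x) -> (forall x, {for phi x, continuous G}) ->
  (forall x, 0 <= G (phi x)) ->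
  (\int[mu]_(u in range phi) (G u)%:E = \int[mu]_x (G (phi x) * phi' x)%:E)%E.
Proof.
move=> dphi cphi' phi'0 cG G0.
have phiE : derive1 phi = phi' by apply/funext => x; rewrite derive1E derive_val.
have cphi : continuous phi.
  by move=> x; apply/differentiable_continuous/derivable1_diffP.
have phi_lt : {homo phi : x y / x < y}.
  move=> x y xy; apply: (@gtr0_derive1_lt_cc _ phi x y _ _ _ x y _ _ xy).
  - by move=> z _; exact: ex_derive.
  - by move=> z _; rewrite phiE.
  - exact: continuous_subspaceT.
  - by rewrite in_itv/= lexx ltW.
  - by rewrite in_itv/= lexx ltW.
have phi_le : {homo phi : x y / x <= y} by exact: ltW_homo.
have cGphi : continuous (fun x => G (phi x) * phi' x).
  move=> x; apply: continuousM; last exact: cphi'.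
  by apply: continuous_comp; [exact: cphi|exact: cG].
have cGn n : {within `[phi (- n%:R), phi n%:R], continuous G}.
  apply: continuous_in_subspaceT => u; rewrite inE/= => uin.
  have : range phi u by rewrite -bigcup_itvNn//; exists n.
  by case=> x _ <-; exact: cG.
have G0n n x : `[phi (- n%:R), phi n%:R]%classic x -> 0 <= G x.
  move=> xin; have : range phi x by rewrite -bigcup_itvNn//; exists n.
  by case=> y _ <-.
have cid : continuous (@id R) by move=> x; exact: cvg_id.
rewrite -bigcup_itvNn// -[in RHS]range_id -bigcup_itvNn//.
have /cvg_lim <-// : (\int[mu]_(x in `[phi (- n%:R)%R, phi n%:R%R]) (G x)%:E @[n --> \oo] -->
    \int[mu]_(x in \bigcup_(n : nat) `[phi (- n%:R)%R, phi n%:R%R]%classic) (G x)%:E)%E.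
  by apply: cvg_ge0_integral_itvNn.
have /cvg_lim <-// : (\int[mu]_(x in `[(- n%:R)%R, n%:R%R]) (G (phi x) * phi' x)%:E @[n --> \oo] -->
    \int[mu]_(x in \bigcup_(n : nat) `[(- n%:R)%R, n%:R%R]%classic) (G (phi x) * phi' x)%:E)%E.
  apply: (@cvg_ge0_integral_itvNn id) => // n; first exact: continuous_subspaceT.
  by move=> x _; rewrite mulr_ge0// ltW.
apply: congr_lim; apply/funext => n.
rewrite integration_by_substitution_increasing//.
- by under eq_integral do rewrite fctE phiE.
- by rewrite (@le_trans _ _ 0)// oppr_le0.
- by move=> x y _ _; exact: phi_lt.
- by move=> x _; rewrite phiE; exact: cphi'.
- by apply/cvg_ex; eexists; rewrite phiE; apply: cvg_at_right_filter; exact: cphi'.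
- by apply/cvg_ex; eexists; rewrite phiE; apply: cvg_at_left_filter; exact: cphi'.
- split => //.
  + by apply: cvg_at_right_filter; exact: cphi.
  + by apply: cvg_at_left_filter; exact: cphi.
Qed.

Lemma ge0_integral_translation G c : continuous G -> (forall x, 0 <= G x) ->
  (\int[mu]_x (G (x + c))%:E = \int[mu]_x (G x)%:E)%E.
Proof.
move=> cG G0; have dc x : is_derive x (1 : R) (fun x => x + c) 1.
  by rewrite -[X in is_derive _ _ _ X]addr0; exact: is_deriveD.
under eq_integral do rewrite -[G _]mulr1.
rewrite -(ge0_integral_substitution dc)//; last 2 first.
- by move=> x; exact: cst_continuous.
- by move=> x; exact: cG.
rewrite (_ : [set x + c | x in setT] = setT)//.
by apply/seteqP; split=> // y _; exists (y - c) => //; rewrite subrK.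
Qed.

Lemma ge0_integral_opp G : continuous G -> (forall x, 0 <= G x) ->
  (\int[mu]_x (G (- x))%:E = \int[mu]_x (G x)%:E)%E.
Proof.
move=> cG G0.
have cGN : continuous (G \o -%R).
  by move=> x; apply: continuous_comp; [exact: opp_continuous|exact: cG].
have L := cvg_ge0_integral_itvT.
rewrite -(cvg_lim _ (L _ cG G0))// -(cvg_lim _ (L _ cGN (fun x => G0 (- x))))//.
apply: congr_lim; apply/funext => n.
rewrite -integration_by_substitution_oppr ?opprK//.
- by rewrite (@le_trans _ _ 0)// oppr_le0.
- exact: continuous_subspaceT.
Qed.

Lemma funepos_EFin f : (EFin \o f)^\+%E = EFin \o (fun x => Num.max (f x) 0).
Proof. by apply/funext => x; rewrite funeposE/= EFin_max. Qed.

Lemma funeneg_EFin f : (EFin \o f)^\-%E = EFin \o (fun x => Num.max (- f x) 0).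
Proof. by apply/funext => x; rewrite funenegE/= EFin_max. Qed.

Lemma continuous_pos G x : {for x, continuous G} ->
  {for x, continuous (fun x => Num.max (G x) 0)}.
Proof.
by move=> cG; apply: (@continuous_max R R G (cst 0) x) => //; exact: cst_continuous.
Qed.

(** The positive and negative parts of [G] are substituted separately. *)
Lemma integral_substitution phi phi' G :
  (forall x, is_derive x (1 : R) phi (phi' x)) -> continuous phi' ->
  (forall x, 0 < phi' x) -> (forall x, {for phi x, continuous G}) ->
  (\int[mu]_(u in range phi) (G u)%:E = \int[mu]_x (G (phi x) * phi' x)%:E)%E.
Proof.
move=> dphi cphi' phi'0 cG.
rewrite [LHS]integralE [RHS]integralE; congr (_ - _)%E.
  rewrite !funepos_EFin (@ge0_integral_substitution _ _ _ dphi)//; last 2 first.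
  - by move=> x; apply: continuous_pos; exact: cG.
  - by move=> x; rewrite le_max lexx orbT.
  apply: eq_integral => x _ /=; congr EFin.
  by rewrite maxr_pMl ?mul0r// ltW.
rewrite !funeneg_EFin (@ge0_integral_substitution _ _ _ dphi)//; last 2 first.
- by move=> x; apply: (@continuous_pos (fun x => - G x)); apply: continuousN; exact: cG.
- by move=> x; rewrite le_max lexx orbT.
apply: eq_integral => x _ /=; congr EFin.
by rewrite maxr_pMl ?mul0r ?mulNr// ltW.
Qed.

Lemma integral_translation G c : continuous G ->
  (\int[mu]_x (G (x + c))%:E = \int[mu]_x (G x)%:E)%E.
Proof.
move=> cG; rewrite [LHS]integralE [RHS]integralE; congr (_ - _)%E.
  rewrite !funepos_EFin (@ge0_integral_translation (fun x => Num.max (G x) 0))//.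
  - by move=> x; apply: continuous_pos; exact: cG.
  - by move=> x; rewrite le_max lexx orbT.
rewrite !funeneg_EFin (@ge0_integral_translation (fun x => Num.max (- G x) 0))//.
- by move=> x; apply: (@continuous_pos (fun x => - G x)); apply: continuousN; exact: cG.
- by move=> x; rewrite le_max lexx orbT.
Qed.

Lemma integral_opp G : continuous G ->
  (\int[mu]_x (G (- x))%:E = \int[mu]_x (G x)%:E)%E.
Proof.
move=> cG; rewrite [LHS]integralE [RHS]integralE; congr (_ - _)%E.
  rewrite !funepos_EFin (@ge0_integral_opp (fun x => Num.max (G x) 0))//.
  - by move=> x; apply: continuous_pos; exact: cG.
  - by move=> x; rewrite le_max lexx orbT.
rewrite !funeneg_EFin (@ge0_integral_opp (fun x => Num.max (- G x) 0))//.
- by move=> x; apply: (@continuous_pos (fun x => - G x)); apply: continuousN; exact: cG.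
- by move=> x; rewrite le_max lexx orbT.
Qed.

Lemma integral_expR G : (forall u, 0 < u -> {for u, continuous G}) ->
  (\int[mu]_(u in `]0%R, +oo[) (G u)%:E = \int[mu]_x (G (expR x) * expR x)%:E)%E.
Proof.
move=> cG; rewrite -(@integral_substitution expR expR)//.
- congr (integral _ _ _); apply/seteqP; split=> [x|_ [x _ <-]] /=.
    by rewrite in_itv/= andbT => x0; exists (ln x) => //; rewrite lnK.
  by rewrite in_itv/= andbT expR_gt0.
- exact: continuous_expR.
- by move=> x; exact: expR_gt0.
- by move=> x; apply: cG; exact: expR_gt0.
Qed.

Lemma integrable_of_ge0 f (r : R) : continuous f -> (forall x, 0 <= f x) ->
  (\int[mu]_x (f x)%:E = r%:E)%E -> mu.-integrable setT (EFin \o f).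
Proof.
move=> cf f0 fr; apply/integrableP; split.
  by apply/measurable_EFinP; exact: continuous_measurable_fun.
by under eq_integral do rewrite /= ger0_norm//; rewrite fr ltry.
Qed.

Lemma integrable_dominated f g : continuous f -> (forall x, `|f x| <= g x) ->
  mu.-integrable setT (EFin \o g) -> mu.-integrable setT (EFin \o f).
Proof.
move=> cf fg ig; apply: le_integrable ig => //.
  by apply/measurable_EFinP; exact: continuous_measurable_fun.
by move=> x _; rewrite /= lee_fin (le_trans (fg x))// ler_norm.
Qed.

Lemma continuous_integral_itvNn f : continuous f ->
  mu.-integrable setT (EFin \o f) ->
  \int[mu]_(x in `[(- n%:R), n%:R]) f x @[n --> \oo] --> \int[mu]_x f x.
Proof.
move=> cf fi.
have L := cvg_ge0_integral_itvT.
have ipos : mu.-integrable setT (EFin \o fun x => Num.max (f x) 0).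
  by rewrite -funepos_EFin; exact: integrable_funepos.
have ineg : mu.-integrable setT (EFin \o fun x => Num.max (- f x) 0).
  by rewrite -funeneg_EFin; exact: integrable_funeneg.
apply: fine_cvg; rewrite fineK; last exact: integrable_fin_num.
rewrite integralE; under eq_fun do rewrite integralE.
rewrite !funepos_EFin !funeneg_EFin; apply: cvgeB.
- by rewrite fin_num_adde_defr// (integrable_fin_num _ ipos).
- apply: L; last by move=> x; rewrite le_max lexx orbT.
  by move=> x; apply: continuous_pos; exact: cf.
- apply: L; last by move=> x; rewrite le_max lexx orbT.
  by move=> x; apply: (@continuous_pos (fun x => - f x)); apply: continuousN; exact: cf.
Qed.

(** The fundamental theorem of calculus on [[-n, n]], as [n] grows. *)
Lemma integral_derivative_vanishing F f :
  (forall x, is_derive x (1 : R) F (f x)) -> continuous f ->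
  mu.-integrable setT (EFin \o f) ->
  F n%:R @[n --> \oo] --> (0 : R) -> F (- n%:R) @[n --> \oo] --> (0 : R) ->
  \int[mu]_x f x = 0.
Proof.
move=> dF cf fi F1 F2; have fE : derive1 F = f.
  by apply/funext => x; rewrite derive1E derive_val.
have cF : continuous F.
  by move=> x; apply/differentiable_continuous/derivable1_diffP.
have := continuous_integral_itvNn cf fi; move/cvg_unique; apply => //.
have -> : 0 = 0 - 0 :> R by rewrite subr0.
apply: (@cvg_trans _ (F n%:R - F (- n%:R) @[n --> \oo])); last exact: cvgB.
apply: near_eq_cvg; near=> n; rewrite /Rintegral (@continuous_FTC2 _ _ F)//.
- have : (0 < n)%N by near: n; exact: nbhs_infty_gt.
  by move=> n0; rewrite (@lt_trans _ _ 0)// ?oppr_lt0 ltr0n.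
- exact: continuous_subspaceT.
- split => //.
  + by apply: cvg_at_right_filter; exact: cF.
  + by apply: cvg_at_left_filter; exact: cF.
- by move=> x _; rewrite fE.
Unshelve. all: by end_near. Qed.

End LineIntegrals.

(** * Integrable functions with exponential decay *)

Section ContinuityRules.
Context {R : realType}.
Implicit Types (f g : R -> R).

Lemma cont_cst (c : R) : continuous (fun _ : R => c).
Proof. by move=> x; exact: cst_continuous. Qed.
Lemma cont_id : continuous (fun x : R => x).
Proof. by move=> x; exact: cvg_id. Qed.
Lemma contD f g : continuous f -> continuous g -> continuous (fun x => f x + g x).
Proof. by move=> cf cg x; apply: continuousD; [exact: cf|exact: cg]. Qed.
Lemma contM f g : continuous f -> continuous g -> continuous (fun x => f x * g x).
Proof. by move=> cf cg x; apply: continuousM; [exact: cf|exact: cg]. Qed.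
Lemma contN f : continuous f -> continuous (fun x => - f x).
Proof. by move=> cf x; apply: continuousN; exact: cf. Qed.
Lemma contX f n : continuous f -> continuous (fun x => f x ^+ n).
Proof.
move=> cf; elim: n => [|n IH]; first exact: cont_cst.
by under eq_fun do rewrite exprS; exact: contM.
Qed.
Lemma contV f : (forall x, f x != 0) -> continuous f -> continuous (fun x => (f x)^-1).
Proof. by move=> f0 cf x; apply: continuousV; [exact: f0|exact: cf]. Qed.
Lemma cont_norm f : continuous f -> continuous (fun x => `|f x|).
Proof. by move=> cf x; apply: continuous_comp; [exact: cf|exact: norm_continuous]. Qed.
Lemma cont_expR f : continuous f -> continuous (fun x => expR (f x)).
Proof. by move=> cf x; apply: continuous_comp; [exact: cf|exact: continuous_expR]. Qed.
Lemma cont_cos f : continuous f -> continuous (fun x => cos (f x)).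
Proof. by move=> cf x; apply: continuous_comp; [exact: cf|exact: continuous_cos]. Qed.
Lemma cont_sin f : continuous f -> continuous (fun x => sin (f x)).
Proof. by move=> cf x; apply: continuous_comp; [exact: cf|exact: continuous_sin]. Qed.
Lemma cont_ln f : (forall x, 0 < f x) -> continuous f -> continuous (fun x => ln (f x)).
Proof. by move=> f0 cf x; apply: continuous_comp; [exact: cf|exact/continuous_ln/f0]. Qed.
Lemma cont_comp f g : continuous f -> continuous g -> continuous (fun x => f (g x)).
Proof. by move=> cf cg x; apply: continuous_comp; [exact: cg|exact: cf]. Qed.

End ContinuityRules.

Ltac cont := repeat (match goal with
  | |- continuous (fun _ => ?c) => exact: cont_cst
  | |- continuous (fun x => x) => exact: cont_id
  | |- continuous (fun x => - _) => apply: contN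
  | |- continuous (fun x => _ + _) => apply: contD
  | |- continuous (fun x => _ * _) => apply: contM
  | |- continuous (fun x => _ ^+ _) => apply: contX
  | |- continuous (fun x => `|_|) => apply: cont_norm
  | |- continuous (fun x => expR _) => apply: cont_expR
  | |- continuous (fun x => cos _) => apply: cont_cos
  | |- continuous (fun x => sin _) => apply: cont_sin
  | |- continuous (fun x => ln _) =>
     apply: cont_ln; [by move=> ?; rewrite ?ltr_pwDl ?addr_gt0 ?expR_gt0|]
  | |- continuous (fun x => _^-1) =>
     apply: contV; [by move=> ?; rewrite gt_eqF// ?ltr_pwDl ?addr_gt0 ?sqr_ge0 ?expR_gt0|]
  | H : continuous ?f |- continuous (fun x => ?f (@?g x)) => apply: (@cont_comp _ f g H)
  | H : continuous ?f |- continuous ?f => exact: H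
  | |- continuous _ => first [exact: norm_continuous | exact: continuous_expR
      | exact: continuous_cos | exact: continuous_sin | exact: opp_continuous
      | exact: mulrl_continuous | exact: (contD (cont_cst _) (@cont_id _))]
  end).

Section Decay.
Context {R : realType}.
Let mu : {measure set (measurableTypeR R) -> \bar R} := @lebesgue_measure R.
Implicit Types (a c x y : R).

Lemma ge0_integral_even (f : R -> R) : continuous f -> (forall x, 0 <= f x) ->
  (forall x, f (- x) = f x) ->
  (\int[mu]_x (f x)%:E = 2%:E * \int[mu]_(x in `[0%R, +oo[) (f x)%:E)%E.
Proof.
move=> cf f0 fN; rewrite ge0_symfun_integralT//; last by move=> x; rewrite /= fN.
by rewrite set_itvcy.
Qed.

Lemma continuous_Cauchy : continuous (fun x : R => (1 + x ^+ 2)^-1).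
Proof. by cont. Qed.

Lemma integral_Cauchy : (\int[mu]_x ((1 + x ^+ 2)^-1)%:E = pi%:E)%E.
Proof.
rewrite (@ge0_integral_even (fun x => (1 + x ^+ 2)^-1)); last 3 first.
- exact: continuous_Cauchy.
- by move=> x; rewrite invr_ge0 addr_ge0// sqr_ge0.
- by move=> x; rewrite sqrrN.
by have := @integral0y_oneDsqr R; rewrite /oneDsqr => ->; rewrite -EFinM mulrC divfK.
Qed.

Lemma integrable_Cauchy : mu.-integrable setT (EFin \o (fun x => (1 + x ^+ 2)^-1)).
Proof.
apply: integrable_of_ge0 integral_Cauchy.
- exact: continuous_Cauchy.
- by move=> x; rewrite invr_ge0 addr_ge0// sqr_ge0.
Qed.

Lemma integrableZ (f : R -> R) c : mu.-integrable setT (EFin \o f) ->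
  mu.-integrable setT (EFin \o (fun x => c * f x)).
Proof.
by move=> fi; have := @integrableZl _ _ _ mu setT measurableT c _ fi.
Qed.

Lemma expR_ge_sqr x : 0 <= x -> 1 + x ^+ 2 / 2 <= expR x.
Proof. by move=> x0; have := @expR_ge1Dxn R x 1 x0; rewrite !factS fact0. Qed.

(** The exponential is at least its second Taylor polynomial, so that the Cauchy
kernel dominates. *)
Lemma integrable_expR_abs c : 0 < c ->
  mu.-integrable setT (EFin \o (fun x => expR (- (c * `|x|)))).
Proof.
move=> c0; apply: (@integrable_dominated _ _ (fun x => (1 + 2 / c ^+ 2) * (1 + x ^+ 2)^-1)).
- by cont.
- move=> x; rewrite ger0_norm ?expR_ge0// expRN ler_pdivlMr ?ltr_pwDl ?sqr_ge0//.
  rewrite mulrC ler_pdivrMr ?expR_gt0//.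
  have cx : 0 <= c * `|x| by rewrite mulr_ge0// ltW.
  apply: (@le_trans _ _ ((1 + 2 / c ^+ 2) * (1 + (c * `|x|) ^+ 2 / 2))); last first.
    rewrite ler_wpM2l ?expR_ge_sqr// addr_ge0// divr_ge0// sqr_ge0//.
  rewrite exprMn real_normK ?num_real//.
  have -> : (1 + 2 / c ^+ 2) * (1 + c ^+ 2 * x ^+ 2 / 2) =
    1 + x ^+ 2 + 2 / c ^+ 2 + c ^+ 2 * x ^+ 2 / 2 by field; rewrite gt_eqF.
  have h1 : 0 <= 2 / c ^+ 2 by apply: divr_ge0 => //; exact: sqr_ge0.
  have h2 : 0 <= c ^+ 2 * x ^+ 2 by apply: mulr_ge0; exact: sqr_ge0.
  lra.
- exact/integrableZ/integrable_Cauchy.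
Qed.

(** [gker a] is the density of Gamma(a) in logarithmic coordinates. *)
Definition gker a x : R := expR (a * x - expR x).

Lemma gker_ge0 a x : 0 <= gker a x. Proof. exact: expR_ge0. Qed.

Lemma continuous_gker a : continuous (gker a).
Proof. by rewrite /gker; cont. Qed.

Lemma gker_le a x : 0 < a -> gker a x <= expR (2 * a ^+ 2) * expR (- (a * `|x|)).
Proof.
move=> a0; rewrite -expRD ler_expR; have [x0|x0] := leP 0 x.
  rewrite ger0_norm//; have := expR_ge_sqr x0; have := sqr_ge0 (x - 2 * a); nra.
rewrite ltr0_norm// mulrN opprK; have := expR_ge0 x; have := sqr_ge0 a; nra.
Qed.

Lemma integrable_gker a : 0 < a -> mu.-integrable setT (EFin \o gker a).
Proof.
move=> a0; apply: integrable_dominated (integrableZ _ (integrable_expR_abs a0)).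
- exact: continuous_gker.
- by move=> x; rewrite ger0_norm ?gker_ge0//; exact: gker_le.
Qed.

(** [bker a c] is the density of the beta integral B(a, c) on the line. *)
Definition bker a c x : R := expR (a * x - (a + c) * ln (1 + expR x)).

Lemma bker_ge0 a c x : 0 <= bker a c x. Proof. exact: expR_ge0. Qed.

Lemma continuous_bker a c : continuous (bker a c).
Proof. by rewrite /bker; cont. Qed.

Lemma ln1DexpR_ge0 x : 0 <= ln (1 + expR x).
Proof. by rewrite ln_ge0// lerDl expR_ge0. Qed.

Lemma ln1DexpR_gex x : x <= ln (1 + expR x).
Proof. by rewrite -[leLHS]expRK ler_ln ?posrE ?addr_gt0 ?expR_gt0// lerDr. Qed.

Lemma bker_le a c x : 0 < a -> 0 < c -> bker a c x <= expR (- (Num.min a c * `|x|)).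
Proof.
move=> a0 c0; rewrite ler_expR.
have m1 : Num.min a c <= a by rewrite ge_min lexx.
have m2 : Num.min a c <= c by rewrite ge_min lexx orbT.
have := ln1DexpR_ge0 x; have := ln1DexpR_gex x; have [x0|x0] := leP 0 x.
  rewrite ger0_norm//; nra.
rewrite ltr0_norm//; nra.
Qed.

Lemma bker_le1 a c x : 0 < a -> 0 < c -> bker a c x <= 1.
Proof.
move=> a0 c0; rewrite (le_trans (bker_le x a0 c0))// -expR0 ler_expR oppr_le0.
by rewrite mulr_ge0// le_min !ltW.
Qed.

Lemma integrable_bker a c : 0 < a -> 0 < c -> mu.-integrable setT (EFin \o bker a c).
Proof.
move=> a0 c0; have m0 : 0 < Num.min a c by rewrite lt_min a0.
apply: integrable_dominated (integrable_expR_abs m0).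
- exact: continuous_bker.
- by move=> x; rewrite ger0_norm ?bker_ge0//; exact: bker_le.
Qed.

(** In the correlation of [gker a] and [gker c] the variable [q] enters through
[(1 + e^r) e^q] only; translating it by [ln (1 + e^r)] separates [q] from [r].
This is the usual proof of the beta integral, in logarithmic coordinates. *)
Lemma gker_translation a c r q :
  gker a (r + (q - ln (1 + expR r))) * gker c (q - ln (1 + expR r)) =
  bker a c r * gker (a + c) q.
Proof.
have p0 : 0 < 1 + expR r by rewrite addr_gt0// expR_gt0.
rewrite /gker /bker -!expRD; congr expR; rewrite [expR (r + _)]expRD.
have -> : expR (q - ln (1 + expR r)) = expR q / (1 + expR r).
  by rewrite expRB lnK.
by field; rewrite gt_eqF.
Qed.

End Decay.

Section ProductIntegrals.
Context {R : realType}.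
Notation RR := (measurableTypeR R).
Let mu : {sigma_finite_measure set RR -> \bar R} := @lebesgue_measure R.
Implicit Types (f g h : R -> R).

Lemma measurable_comp_fst f : continuous f ->
  measurable_fun setT (fun z : RR * RR => f z.1).
Proof.
by move=> cf; apply: measurableT_comp measurable_fst; exact: continuous_measurable_fun.
Qed.

Lemma measurable_comp_snd f : continuous f ->
  measurable_fun setT (fun z : RR * RR => f z.2).
Proof.
by move=> cf; apply: measurableT_comp measurable_snd; exact: continuous_measurable_fun.
Qed.

Lemma measurable_comp2 h (F : RR * RR -> R) : continuous h -> measurable_fun setT F ->
  measurable_fun setT (fun z => h (F z)).
Proof.
by move=> ch mF; apply: measurableT_comp mF; exact: continuous_measurable_fun.
Qed.

(** A kernel dominated by [f (r + s q) g q], [s = 0] or [s = 1], is integrable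
on the plane, by Tonelli and the translation invariance in [r]. *)
Lemma integrable_plane (F : RR * RR -> R) f g (s : R) :
  measurable_fun setT F -> continuous f -> (forall x, 0 <= f x) -> (forall x, 0 <= g x) ->
  mu.-integrable setT (EFin \o f) -> mu.-integrable setT (EFin \o g) ->
  (forall q r, `|F (q, r)| <= f (r + s * q) * g q) ->
  (mu \x mu)%E.-integrable setT (EFin \o F).
Proof.
move=> mF cf f0 g0 fi gi Ffg.
have mE : measurable_fun setT (EFin \o F) by exact/measurable_EFinP.
apply: (iffRL (@integrable12ltyP _ _ RR RR R mu mu (EFin \o F) mE)).
apply: (@le_lt_trans _ _ (\int[mu]_q ((\int[mu]_r (f r)%:E) * (g q)%:E))%E); last first.
  rewrite ge0_integralZl//.
  - have h1 := integrable_fin_num measurableT fi.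
    have h2 := integrable_fin_num measurableT gi.
    by rewrite -(fineK h1) -(fineK h2) -EFinM ltry.
  - by case/integrableP : gi.
  - by move=> q _; rewrite lee_fin.
  - by apply: integral_ge0 => r _; rewrite lee_fin.
apply: ge0_le_integral => //.
- by move=> q _; exact: integral_ge0.
- apply: (measurable_fun_fubini_tonelli_F (fun z => `|(EFin \o F) z|%E)) => //.
  exact: measurableT_comp.
- apply: emeasurable_funM => //; case/integrableP : gi => //.
- move=> q _; have ctr : continuous (fun r => f (r + s * q)) by cont.
  have <- : (\int[mu]_r (f (r + s * q) * g q)%:E = (\int[mu]_r (f r)%:E) * (g q)%:E)%E.
    under eq_integral do rewrite EFinM.
    rewrite (@ge0_integralZr _ _ _ mu setT _ (fun r => (f (r + s * q))%:E) _ (g q)%:E)//.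
    - by congr (_ * _)%E; exact: integral_translation.
    - by apply/measurable_EFinP; exact: continuous_measurable_fun.
    - by move=> r _; rewrite lee_fin.
    - by rewrite lee_fin.
  apply: ge0_le_integral => //.
  - apply: measurableT_comp => //; apply: (measurableT_comp mE).
    exact: pair1_measurable.
  - apply/measurable_EFinP; apply: (@continuous_measurable_fun _ (fun r => f (r + s * q) * g q)).
    by cont.
  - by move=> r _; rewrite /= lee_fin.
Qed.

End ProductIntegrals.

(** * Fourier transforms of correlations *)

Section Fourier.
Context {R : realType}.
Notation RR := (measurableTypeR R).
Let mu : {sigma_finite_measure set RR -> \bar R} := @lebesgue_measure R.
Implicit Types (f g h k : R -> R) (r s x y : R).

Lemma Rintegral_translation f r : continuous f ->
  \int[mu]_x f (x + r) = \int[mu]_x f x.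
Proof. by move=> cf; congr fine; exact: integral_translation. Qed.

Lemma integrable_translation f r : continuous f ->
  mu.-integrable setT (EFin \o f) -> mu.-integrable setT (EFin \o (fun x => f (x + r))).
Proof.
move=> cf /integrableP[mf fi]; have ctr : continuous (fun x => f (x + r)) by cont.
apply/integrableP; split.
  by apply/measurable_EFinP; exact: continuous_measurable_fun.
have cn : continuous (fun x => `|f x|) by cont.
by have := integral_translation r cn => /= ->.
Qed.

Lemma integrableMbounded f h (M : R) : continuous f -> continuous h ->
  (forall x, `|h x| <= M) -> mu.-integrable setT (EFin \o f) ->
  mu.-integrable setT (EFin \o (fun x => h x * f x)).
Proof.
move=> cf ch hM fi; apply: (@integrable_dominated _ _ (fun x => M * `|f x|)).
- by cont.
- by move=> x; rewrite normrM ler_wpM2r.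
- by apply: integrableZ; exact: integrable_norm.
Qed.

Lemma Rintegral_fubini (F : RR * RR -> R) :
  (mu \x mu)%E.-integrable setT (EFin \o F) ->
  (forall q, mu.-integrable setT (EFin \o (fun r => F (q, r)))) ->
  (forall r, mu.-integrable setT (EFin \o (fun q => F (q, r)))) ->
  \int[mu]_q (\int[mu]_r F (q, r)) = \int[mu]_r (\int[mu]_q F (q, r)).
Proof.
move=> Fi F1 F2; rewrite /Rintegral; congr fine.
transitivity (\int[mu]_q \int[mu]_r (F (q, r))%:E)%E.
  by apply: eq_integral => q _; rewrite fineK//; exact: integrable_fin_num (F1 q).
transitivity (\int[mu]_r \int[mu]_q (F (q, r))%:E)%E; first exact: (Fubini Fi).
by apply: eq_integral => r _; rewrite fineK//; exact: integrable_fin_num (F2 r).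
Qed.

Lemma integrable_fubini (F : RR * RR -> R) :
  (mu \x mu)%E.-integrable setT (EFin \o F) ->
  (forall r, mu.-integrable setT (EFin \o (fun q => F (q, r)))) ->
  mu.-integrable setT (EFin \o (fun r => \int[mu]_q F (q, r))).
Proof.
move=> Fi F2; have mE := measurable_int _ Fi.
have GE r : (\int[mu]_q (F (q, r))%:E)%E = (\int[mu]_q F (q, r))%:E.
  by rewrite /Rintegral fineK//; exact: integrable_fin_num (F2 r).
apply/integrableP; split.
  have : measurable_fun setT (fubini_G mu (EFin \o F)) by exact: (measurable_fubini_G Fi).
  by apply: eq_measurable_fun => r _; rewrite /fubini_G /= GE.
have mA : measurable_fun setT (abse \o (EFin \o F)) by exact: measurableT_comp.
apply: le_lt_trans (iffLR (@integrable21ltyP _ _ RR RR R mu mu _ mE) Fi).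
apply: ge0_le_integral => //.
- apply: measurableT_comp => //.
  have : measurable_fun setT (fubini_G mu (EFin \o F)) by exact: (measurable_fubini_G Fi).
  by apply: eq_measurable_fun => r _; rewrite /fubini_G /= GE.
- apply: (measurable_fun_fubini_tonelli_G (abse \o (EFin \o F))) => // z.
  exact: abse_ge0.
- move=> r _; have mr : measurable_fun setT (fun q => (F (q, r))%:E).
    by apply: (measurableT_comp mE); exact: pair2_measurable.
  by have := le_abse_integral mu measurableT mr; rewrite GE.
Qed.

(** Under the Fourier transform, correlation becomes the product of the first
transform with the conjugate of the second. *)
Definition corr f g r : R := \int[mu]_q (f (r + q) * g q).

Definition Fcos f y : R := \int[mu]_x (cos (y * x) * f x).
Definition Fsin f y : R := \int[mu]_x (sin (y * x) * f x).

Lemma norm_cos_le1 x : `|cos x| <= 1.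
Proof. by rewrite ler_norml cos_geN1 cos_le1. Qed.

Lemma norm_sin_le1 x : `|sin x| <= 1.
Proof. by rewrite ler_norml sin_geN1 sin_le1. Qed.

Lemma integrable_Fcos f y : continuous f -> mu.-integrable setT (EFin \o f) ->
  mu.-integrable setT (EFin \o (fun x => cos (y * x) * f x)).
Proof.
move=> cf; apply: (@integrableMbounded _ _ 1) => //; first by cont.
by move=> x; exact: norm_cos_le1.
Qed.

Lemma integrable_Fsin f y : continuous f -> mu.-integrable setT (EFin \o f) ->
  mu.-integrable setT (EFin \o (fun x => sin (y * x) * f x)).
Proof.
move=> cf; apply: (@integrableMbounded _ _ 1) => //; first by cont.
by move=> x; exact: norm_sin_le1.
Qed.

Section Correlation.
Variables (f g : R -> R) (M : R).
Hypotheses (cf : continuous f) (cg : continuous g).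
Hypotheses (f0 : forall x, 0 <= f x) (g0 : forall x, 0 <= g x).
Hypotheses (fM : forall x, f x <= M).
Hypotheses (fi : mu.-integrable setT (EFin \o f)) (gi : mu.-integrable setT (EFin \o g)).

Lemma integrable_corr_slice r : mu.-integrable setT (EFin \o (fun q => f (r + q) * g q)).
Proof.
apply: (@integrableMbounded _ _ M) => //; first by cont.
by move=> q; rewrite ger0_norm.
Qed.

Section bounded_factor.
Variable h : R -> R.
Hypotheses (ch : continuous h) (h1 : forall x, `|h x| <= 1).

Let F (z : RR * RR) : R := h z.2 * (f (z.2 + z.1) * g z.1).

Let Fi : (mu \x mu)%E.-integrable setT (EFin \o F).
Proof.
apply: (@integrable_plane _ F f g 1) => //.
- apply: measurable_funM; first exact: measurable_comp_snd.
  apply: measurable_funM; last exact: measurable_comp_fst.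
  apply: (measurable_comp2 cf (F := fun z => z.2 + z.1)).
  by apply: measurable_funD; [exact: measurable_snd|exact: measurable_fst].
- move=> q r; rewrite /F /= mul1r normrM [`|f _ * _|]ger0_norm ?mulr_ge0//.
  by rewrite ler_piMl// mulr_ge0.
Qed.

Let F1 q : mu.-integrable setT (EFin \o (fun r => F (q, r))).
Proof.
rewrite /F /=; apply: (@integrableMbounded _ _ 1) => //; first by cont.
have := integrable_translation q cf fi; move/(integrableZ (g q)).
by apply: eq_integrable => // x _ /=; rewrite mulrC.
Qed.

Let F2 r : mu.-integrable setT (EFin \o (fun q => F (q, r))).
Proof. by rewrite /F /=; apply: integrableZ; exact: integrable_corr_slice. Qed.

Let FE r : \int[mu]_q F (q, r) = h r * corr f g r.
Proof.
by rewrite /F /corr /= RintegralZl//; exact: integrable_corr_slice.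
Qed.

Lemma integrable_corrM : mu.-integrable setT (EFin \o (fun r => h r * corr f g r)).
Proof.
have := integrable_fubini Fi F2.
by apply: eq_integrable => // r _; rewrite /comp FE.
Qed.

(** Fubini, followed by the translation [p = r + q]. *)
Lemma Rintegral_corr : \int[mu]_r (h r * corr f g r) =
  \int[mu]_q (g q * \int[mu]_p (h (p - q) * f p)).
Proof.
under eq_Rintegral do rewrite -FE.
rewrite -(Rintegral_fubini Fi F1 F2); apply: eq_Rintegral => q _.
rewrite /F /=; have chf : continuous (fun p => h (p - q) * f p) by cont.
have hfi : mu.-integrable setT (EFin \o (fun p => h (p - q) * f p)).
  by apply: (@integrableMbounded _ _ 1) => //; cont.
rewrite -RintegralZl// -[RHS](@Rintegral_translation _ q)//; last by cont.
by apply: eq_Rintegral => p _; rewrite addrK; ring.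
Qed.

End bounded_factor.

Lemma integrable_corr : mu.-integrable setT (EFin \o corr f g).
Proof.
have := @integrable_corrM (fun=> 1); rewrite (_ : (fun r => 1 * _) = corr f g).
  by apply; [cont|move=> x; rewrite normr1].
by apply/funext => r; rewrite mul1r.
Qed.

Lemma Rintegral_corrT : \int[mu]_r corr f g r = \int[mu]_x f x * \int[mu]_x g x.
Proof.
have := @Rintegral_corr (fun=> 1); under eq_Rintegral do rewrite mul1r.
move=> ->; [|by cont|by move=> x; rewrite normr1].
under eq_Rintegral do under eq_Rintegral do rewrite mul1r.
by rewrite RintegralZr// mulrC.
Qed.

Lemma Fcos_corr y : Fcos (corr f g) y = Fcos f y * Fcos g y + Fsin f y * Fsin g y.
Proof.
rewrite /Fcos Rintegral_corr; last 2 first.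
- by cont.
- by move=> x; exact: norm_cos_le1.
have fc := integrable_Fcos y cf fi; have fs := integrable_Fsin y cf fi.
have gc := integrable_Fcos y cg gi; have gs := integrable_Fsin y cg gi.
rewrite -!RintegralZl// -RintegralD//; last 2 first.
- exact: (integrableZ (Fcos f y)).
- exact: (integrableZ (Fsin f y)).
apply: eq_Rintegral => q _.
transitivity (g q * (\int[mu]_p (cos (y * q) * (cos (y * p) * f p) + sin (y * q) * (sin (y * p) * f p)))).
  congr (_ * _); apply: eq_Rintegral => p _.
  by rewrite mulrBr cosB; ring.
rewrite RintegralD//; last 2 first.
- exact: (integrableZ (cos (y * q))).
- exact: (integrableZ (sin (y * q))).
by rewrite !RintegralZl// -/(Fcos f y) -/(Fsin f y); ring.
Qed.

Lemma Fsin_corr y : Fsin (corr f g) y = Fsin f y * Fcos g y - Fcos f y * Fsin g y.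
Proof.
rewrite /Fsin Rintegral_corr; last 2 first.
- by cont.
- by move=> x; exact: norm_sin_le1.
have fc := integrable_Fcos y cf fi; have fs := integrable_Fsin y cf fi.
have gc := integrable_Fcos y cg gi; have gs := integrable_Fsin y cg gi.
rewrite -!RintegralZl// -RintegralB//; last 2 first.
- exact: (integrableZ (Fsin f y)).
- exact: (integrableZ (Fcos f y)).
apply: eq_Rintegral => q _.
transitivity (g q * (\int[mu]_p (cos (y * q) * (sin (y * p) * f p) - sin (y * q) * (cos (y * p) * f p)))).
  congr (_ * _); apply: eq_Rintegral => p _.
  by rewrite mulrBr sinB; ring.
rewrite RintegralB//; last 2 first.
- exact: (integrableZ (cos (y * q))).
- exact: (integrableZ (sin (y * q))).
by rewrite !RintegralZl// -/(Fcos f y) -/(Fsin f y); ring.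
Qed.

Lemma continuous_corr : continuous (corr f g).
Proof.
move=> r; apply: (@continuity_under_integral R _ RR mu (fun r q => f (r + q) * g q) setT
  measurableT (r - 1) (r + 1) _ _ (fun q => M * g q)).
- by move=> x _; exact: integrable_corr_slice.
- apply: aeW => q _ x _.
  suff : continuous (fun r => f (r + q) * g q) by apply.
  by cont.
- exact: integrableZ.
- move=> x _; apply: aeW => q _.
  by rewrite normrM !ger0_norm// ler_wpM2r.
- by rewrite inE/= in_itv/=; apply/andP; split; lra.
Qed.

Lemma corr_le r : `|corr f g r| <= M * \int[mu]_x g x.
Proof.
rewrite (le_trans (le_normr_Rintegral _ (integrable_corr_slice r)))// -RintegralZl//.
apply: le_Rintegral => //.
- by apply: integrable_norm; exact: integrable_corr_slice.
- exact: integrableZ.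
- by move=> q _; rewrite ger0_norm ?mulr_ge0// ler_wpM2r.
Qed.

End Correlation.

Lemma continuous_Fcos f : continuous f -> mu.-integrable setT (EFin \o f) ->
  continuous (Fcos f).
Proof.
move=> cf fi y; apply: (@continuity_under_integral R _ RR mu (fun y x => cos (y * x) * f x) setT
  measurableT (y - 1) (y + 1) _ _ (fun x => `|f x|)).
- by move=> x _; exact: integrable_Fcos.
- apply: aeW => x _ z _.
  suff : continuous (fun y => cos (y * x) * f x) by apply.
  by cont.
- exact: integrable_norm.
- by move=> z _; apply: aeW => x _; rewrite normrM ler_piMl// norm_cos_le1.
- by rewrite inE/= in_itv/=; apply/andP; split; lra.
Qed.

Lemma continuous_Fsin f : continuous f -> mu.-integrable setT (EFin \o f) ->
  continuous (Fsin f).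
Proof.
move=> cf fi y; apply: (@continuity_under_integral R _ RR mu (fun y x => sin (y * x) * f x) setT
  measurableT (y - 1) (y + 1) _ _ (fun x => `|f x|)).
- by move=> x _; exact: integrable_Fsin.
- apply: aeW => x _ z _.
  suff : continuous (fun y => sin (y * x) * f x) by apply.
  by cont.
- exact: integrable_norm.
- by move=> z _; apply: aeW => x _; rewrite normrM ler_piMl// norm_sin_le1.
- by rewrite inE/= in_itv/=; apply/andP; split; lra.
Qed.

Lemma Fcos_le f y : continuous f -> (forall x, 0 <= f x) ->
  mu.-integrable setT (EFin \o f) -> `|Fcos f y| <= \int[mu]_x f x.
Proof.
move=> cf f0 fi; have fc := integrable_Fcos y cf fi.
rewrite (le_trans (le_normr_Rintegral _ fc))//; apply: le_Rintegral => //.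
  exact: integrable_norm.
by move=> x _; rewrite normrM (ger0_norm (f0 x)) ler_piMl// norm_cos_le1.
Qed.

Lemma Fsin_le f y : continuous f -> (forall x, 0 <= f x) ->
  mu.-integrable setT (EFin \o f) -> `|Fsin f y| <= \int[mu]_x f x.
Proof.
move=> cf f0 fi; have fc := integrable_Fsin y cf fi.
rewrite (le_trans (le_normr_Rintegral _ fc))//; apply: le_Rintegral => //.
  exact: integrable_norm.
by move=> x _; rewrite normrM (ger0_norm (f0 x)) ler_piMl// norm_sin_le1.
Qed.

Lemma FcosN f y : Fcos f (- y) = Fcos f y.
Proof. by apply: eq_Rintegral => x _; rewrite mulNr cosN. Qed.

Lemma FsinN f y : continuous f -> mu.-integrable setT (EFin \o f) ->
  Fsin f (- y) = - Fsin f y.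
Proof.
move=> cf fi; rewrite -[RHS]mulN1r [in RHS]/Fsin -RintegralZl//; last exact: integrable_Fsin.
by apply: eq_Rintegral => x _; rewrite mulNr sinN; ring.
Qed.

(** By reflection the integral is its own opposite. *)
Lemma Rintegral_odd h : continuous h -> mu.-integrable setT (EFin \o h) ->
  (forall x, h (- x) = - h x) -> \int[mu]_x h x = 0.
Proof.
move=> ch hi hN.
have : \int[mu]_x h x = - \int[mu]_x h x.
  rewrite -[RHS]mulN1r -RintegralZl// -{1}[LHS](_ : fine (\int[mu]_x (h (- x))%:E)%E = _).
    by congr fine; apply: eq_integral => x _; rewrite hN mulN1r.
  by congr fine; exact: integral_opp.
lra.
Qed.

End Fourier.

(** * Fourier inversion at the origin *)

Section DerivationRules.
Context {R : realType}.
Implicit Types (f g : R -> R) (x : R).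

Lemma der_cst (c : R) x : is_derive x (1 : R) (fun _ : R => c) 0.
Proof. exact: is_derive_cst. Qed.
Lemma der_id x : is_derive x (1 : R) (fun x : R => x) 1.
Proof. exact: is_derive_id. Qed.
Lemma derD f g x df dg : is_derive x (1 : R) f df -> is_derive x (1 : R) g dg ->
  is_derive x (1 : R) (fun x => f x + g x) (df + dg).
Proof. by move=> ? ?; exact: is_deriveD. Qed.
Lemma derN f x df : is_derive x (1 : R) f df -> is_derive x (1 : R) (fun x => - f x) (- df).
Proof. by move=> ?; exact: is_deriveN. Qed.
Lemma derM f g x df dg : is_derive x (1 : R) f df -> is_derive x (1 : R) g dg ->
  is_derive x (1 : R) (fun x => f x * g x) (f x * dg + g x * df).
Proof. by move=> ? ?; exact: is_deriveM. Qed.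
Lemma der_expR f x df : is_derive x (1 : R) f df ->
  is_derive x (1 : R) (fun x => expR (f x)) (expR (f x) * df).
Proof. by move=> ?; exact: is_derive1_comp. Qed.
Lemma der_cos f x df : is_derive x (1 : R) f df ->
  is_derive x (1 : R) (fun x => cos (f x)) (- sin (f x) * df).
Proof. by move=> ?; exact: is_derive1_comp. Qed.
Lemma der_sin f x df : is_derive x (1 : R) f df ->
  is_derive x (1 : R) (fun x => sin (f x)) (cos (f x) * df).
Proof. by move=> ?; exact: is_derive1_comp. Qed.
Lemma der_eq f x df dg : is_derive x (1 : R) f df -> df = dg -> is_derive x (1 : R) f dg.
Proof. by move=> ? <-. Qed.

End DerivationRules.

Ltac der := repeat (match goal with
  | |- is_derive _ _ (fun _ => ?c) _ => exact: der_cst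
  | |- is_derive _ _ (fun x => x) _ => exact: der_id
  | |- is_derive _ _ (fun x => - _) _ => apply: derN
  | |- is_derive _ _ (fun x => _ + _) _ => apply: derD
  | |- is_derive _ _ (fun x => _ * _) _ => apply: derM
  | |- is_derive _ _ (fun x => expR _) _ => apply: der_expR
  | |- is_derive _ _ (fun x => cos _) _ => apply: der_cos
  | |- is_derive _ _ (fun x => sin _) _ => apply: der_sin
  end).

Section Inversion.
Context {R : realType}.
Notation RR := (measurableTypeR R).
Let mu : {sigma_finite_measure set RR -> \bar R} := @lebesgue_measure R.
Implicit Types (f g h k : R -> R) (e r s x y : R).

Lemma cvg_expRN e : 0 < e -> expR (- (e * x)) @[x --> +oo] --> (0 : R).
Proof.
move=> e0; apply: (@cvg_comp _ _ _ (fun x => e * x) (fun x => expR (- x)) _ (pinfty_nbhs R)).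
  exact: gt0_cvgMry.
exact: cvgr_expR.
Qed.

Lemma integral_Abel_half e r : 0 < e ->
  (\int[mu]_(y in `[0%R, +oo[) (expR (- (e * y)) * (1 + cos (r * y)))%:E =
  (e^-1 + e / (e ^+ 2 + r ^+ 2))%:E)%E.
Proof.
move=> e0; have D0 : 0 < e ^+ 2 + r ^+ 2 by rewrite ltr_pwDl ?exprn_gt0 ?sqr_ge0.
(* an antiderivative that vanishes at infinity *)
pose F y := expR (- (e * y)) * (- e^-1 + (r * sin (r * y) - e * cos (r * y)) / (e ^+ 2 + r ^+ 2)).
have dF y : is_derive y (1 : R) F (expR (- (e * y)) * (1 + cos (r * y))).
  apply: der_eq; first (rewrite /F; der).
  by rewrite /GRing.scale/=; field; rewrite !gt_eqF.
have cf : continuous (fun y => expR (- (e * y)) * (1 + cos (r * y))) by cont.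
rewrite (@ge0_continuous_FTC2y _ _ F 0 0)//.
- rewrite /F !mulr0 oppr0 expR0 cos0 sin0 mulr1 mul1r mulr0 sub0r -EFinB.
  by congr EFin; field; rewrite !gt_eqF.
- exact: continuous_subspaceT.
- rewrite /F; pose C : R := e^-1 + (`|r| + e) / (e ^+ 2 + r ^+ 2).
  have FC x : `|F x| <= expR (- (e * x)) * C.
    rewrite normrM ger0_norm ?expR_ge0// ler_wpM2l ?expR_ge0//.
    have e1 : 0 <= e^-1 by rewrite invr_ge0 ltW.
    have d1 : 0 <= (e ^+ 2 + r ^+ 2)^-1 by rewrite invr_ge0 ltW.
    rewrite (le_trans (ler_normD _ _))// normrN (ger0_norm e1) /C.
    rewrite lerD2l normrM (ger0_norm d1) ler_wpM2r//.
    rewrite (le_trans (ler_normB _ _))// !normrM lerD//.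
      by rewrite ler_piMr// norm_sin_le1.
    by rewrite (gtr0_norm e0) ler_piMr ?norm_cos_le1// ltW.
  have C0 : expR (- (e * x)) * C @[x --> +oo] --> 0 * C.
    by apply: cvgMl; exact: cvg_expRN.
  rewrite mul0r in C0.
  apply/cvgr0Pnorm_le => _/posnumP[d].
  move/cvgr0Pnorm_le : C0 => /(_ _ (gt0 d)); apply: filterS => x.
  by apply: le_trans; rewrite (le_trans (FC x))// ler_norm.
- by apply: cvg_at_right_filter; apply/differentiable_continuous/derivable1_diffP.
- by move=> x _; rewrite derive1E derive_val.
Qed.

(** The summand 1 keeps the integrand nonnegative, so that its integrability comes
with its value; it is subtracted in the next lemma. *)
Lemma integral_Abel1 e r : 0 < e ->
  (\int[mu]_y (expR (- (e * `|y|)) * (1 + cos (r * y)))%:E =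
  (2 / e + 2 * e / (e ^+ 2 + r ^+ 2))%:E)%E.
Proof.
move=> e0; rewrite (@ge0_integral_even _ (fun y => expR (- (e * `|y|)) * (1 + cos (r * y)))).
- rewrite (_ : 2 / e + _ = 2 * (e^-1 + e / (e ^+ 2 + r ^+ 2))); last by ring.
  rewrite EFinM -(integral_Abel_half r e0); congr (_ * _)%E.
  by apply: eq_integral => y; rewrite inE/= in_itv/= andbT => y0; rewrite ger0_norm.
- by cont.
- move=> x; by rewrite mulr_ge0 ?expR_ge0.
- by move=> x; rewrite normrN mulrN cosN.
Qed.

Lemma Rintegral_Abel e r : 0 < e ->
  \int[mu]_y (expR (- (e * `|y|)) * cos (r * y)) = 2 * e / (e ^+ 2 + r ^+ 2).
Proof.
move=> e0.
have i1 s : mu.-integrable setT (EFin \o (fun y => expR (- (e * `|y|)) * (1 + cos (s * y)))).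
  apply: integrable_of_ge0 (integral_Abel1 s e0); first by cont.
  move=> x; by rewrite mulr_ge0 ?expR_ge0.
transitivity (\int[mu]_y (expR (- (e * `|y|)) * (1 + cos (r * y)) -
    2^-1 * (expR (- (e * `|y|)) * (1 + cos (0 * y))))).
  by apply: eq_Rintegral => y _; rewrite mul0r cos0; field.
rewrite RintegralB//; last exact: integrableZ.
rewrite RintegralZl// /Rintegral !integral_Abel1//= expr0n/= addr0.
have D0 : 0 < e ^+ 2 + r ^+ 2 by rewrite ltr_pwDl ?exprn_gt0 ?sqr_ge0.
by field; rewrite !gt_eqF.
Qed.

(** Inversion at the origin by Abel summation. The integral of
[e^(- e |y|) Fcos k y] is computed in two ways: as [e] tends to 0 it tends to
the integral of [Fcos k], while by Fubini and the transform of [e^(- e |y|)] it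
is the integral of [k (e s)] against [2 / (1 + s^2)], which tends to
[2 pi k(0)]. *)
Section at_zero.
Variables (k : R -> R) (M : R).
Hypotheses (ck : continuous k) (kM : forall x, `|k x| <= M).
Hypotheses (ki : mu.-integrable setT (EFin \o k)).
Hypothesis Fki : mu.-integrable setT (EFin \o Fcos k).

Let cFk : continuous (Fcos k).
Proof. exact: continuous_Fcos. Qed.

Let L e : R := \int[mu]_y (expR (- (`|e| * `|y|)) * Fcos k y).
Let D e : R := \int[mu]_s (k (e * s) * (2 * (1 + s ^+ 2)^-1)).

Let LD e : 0 < e -> L e = D e.
Proof.
move=> e0; rewrite /L gtr0_norm//.
pose F (z : RR * RR) : R := expR (- (e * `|z.1|)) * (cos (z.1 * z.2) * k z.2).
have ie := integrable_expR_abs e0.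
have Fi : (mu \x mu)%E.-integrable setT (EFin \o F).
  apply: (@integrable_plane _ F (fun x => `|k x|) (fun x => expR (- (e * `|x|))) 0) => //.
  - apply: measurable_funM.
      apply: (measurable_comp_fst (f := fun x => expR (- (e * `|x|)))); by cont.
    apply: measurable_funM; last exact: measurable_comp_snd.
    apply: (measurable_comp2 (h := cos) (F := fun z => z.1 * z.2)).
      exact: continuous_cos.
    by apply: measurable_funM; [exact: measurable_fst|exact: measurable_snd].
  - by cont.
  - exact: integrable_norm.
  - move=> q r; rewrite /F /= mul0r addr0 normrM ger0_norm ?expR_ge0// mulrC.
    by rewrite ler_wpM2r ?expR_ge0// normrM ler_piMl// norm_cos_le1.
have F1 q : mu.-integrable setT (EFin \o (fun r => F (q, r))).
  by rewrite /F/=; apply: integrableZ; exact: integrable_Fcos.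
have F2 r : mu.-integrable setT (EFin \o (fun q => F (q, r))).
  rewrite /F/=; apply: (@integrable_dominated _ _ (fun x => `|k r| * expR (- (e * `|x|)))).
  - by cont.
  - move=> x; rewrite normrM ger0_norm ?expR_ge0// mulrC.
    by rewrite ler_wpM2r ?expR_ge0// normrM ler_piMl// norm_cos_le1.
  - exact: integrableZ.
transitivity (\int[mu]_y \int[mu]_r F (y, r)).
  apply: eq_Rintegral => y _; rewrite /F/= RintegralZl//; exact: integrable_Fcos.
rewrite (Rintegral_fubini Fi F1 F2).
transitivity (\int[mu]_r (k r * (2 * e / (e ^+ 2 + r ^+ 2)))).
  apply: eq_Rintegral => r _; rewrite /F/= -Rintegral_Abel// -RintegralZl//.
    by apply: eq_Rintegral => y _; rewrite (mulrC y); ring.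
  apply: (@integrable_dominated _ _ (fun x => expR (- (e * `|x|)))) => //.
    by cont.
  by move=> x; rewrite normrM ger0_norm ?expR_ge0// ler_piMr ?expR_ge0// norm_cos_le1.
have dphi x : is_derive x (1 : R) (fun s => e * s) e.
  by apply: (der_eq (derM (der_cst e x) (der_id x))); ring.
rewrite /D /Rintegral; congr fine.
have D0 r : e ^+ 2 + r ^+ 2 != 0.
  by rewrite gt_eqF// ltr_pwDl ?exprn_gt0 ?sqr_ge0.
have cG : continuous (fun r => k r * (2 * e / (e ^+ 2 + r ^+ 2))).
  by apply: contM => //; apply: contM; [cont|apply: contV => //; cont].
have := @integral_substitution R (fun s => e * s) (fun=> e) _ dphi _ _ (fun x => cG (e * x)).
rewrite (_ : range _ = setT).
  move=> ->//; last exact: cont_cst.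
  apply: eq_integral => s _; congr EFin.
  have D1 : 1 + s ^+ 2 != 0 by rewrite gt_eqF// ltr_pwDl ?sqr_ge0.
  have -> : e ^+ 2 + (e * s) ^+ 2 = e ^+ 2 * (1 + s ^+ 2) by ring.
  by field; rewrite D1 gt_eqF.
apply/seteqP; split=> // y _; exists (y / e) => //=.
by rewrite mulrC divfK// gt_eqF.
Qed.

Let in11 : (0 : R) \in `](-1), 1[.
Proof. by rewrite in_itv/= ltrN10 ltr01. Qed.

Let contL : {for 0, continuous L}.
Proof.
apply: (@continuity_under_integral R _ RR mu
  (fun e y => expR (- (`|e| * `|y|)) * Fcos k y) setT
  measurableT (-1) 1 _ _ (fun y => `|Fcos k y|)).
- move=> e _; apply: (@integrableMbounded _ _ _ 1) => //; first by cont.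
  by move=> x; rewrite ger0_norm ?expR_ge0// -expR0 ler_expR oppr_le0 mulr_ge0.
- apply: aeW => y _ e _.
  suff : continuous (fun e => expR (- (`|e| * `|y|)) * Fcos k y) by apply.
  by cont.
- exact: integrable_norm.
- move=> e _; apply: aeW => y _; rewrite normrM ler_piMl//.
  by rewrite ger0_norm ?expR_ge0// -expR0 ler_expR oppr_le0 mulr_ge0.
- exact: mem_set.
Qed.

Let contD : {for 0, continuous D}.
Proof.
have iC : mu.-integrable setT (EFin \o (fun s => 2 * (1 + s ^+ 2)^-1)).
  by apply: integrableZ; exact: integrable_Cauchy.
have C0 s : 0 <= 2 * (1 + s ^+ 2)^-1.
  by rewrite mulr_ge0// invr_ge0 addr_ge0// sqr_ge0.
apply: (@continuity_under_integral R _ RR mu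
  (fun e s => k (e * s) * (2 * (1 + s ^+ 2)^-1)) setT
  measurableT (-1) 1 _ _ (fun s => M * (2 * (1 + s ^+ 2)^-1))).
- by move=> e _; apply: (@integrableMbounded _ _ _ M) => //; cont.
- apply: aeW => s _ e _.
  suff : continuous (fun e => k (e * s) * (2 * (1 + s ^+ 2)^-1)) by apply.
  by cont.
- exact: integrableZ.
- move=> e _; apply: aeW => s _; rewrite normrM (ger0_norm (C0 s)).
  by rewrite ler_wpM2r.
- exact: mem_set.
Qed.

Lemma Fourier_inversion0 : \int[mu]_y Fcos k y = 2 * pi * k 0.
Proof.
have -> : \int[mu]_y Fcos k y = L 0.
  by apply: eq_Rintegral => y _; rewrite normr0 mul0r oppr0 expR0 mul1r.
have -> : 2 * pi * k 0 = D 0.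
  transitivity (\int[mu]_s (2 * k 0 * (1 + s ^+ 2)^-1)).
    rewrite RintegralZl//; last exact: integrable_Cauchy.
    by rewrite /Rintegral integral_Cauchy/=; ring.
  by apply: eq_Rintegral => s _; rewrite mul0r; ring.
have cL : L x @[x --> 0^'+] --> L 0 by apply: cvg_at_right_filter; exact: contL.
have cD : D x @[x --> 0^'+] --> D 0 by apply: cvg_at_right_filter; exact: contD.
apply: (cvg_unique _ cL) => //.
apply: cvg_trans cD; apply: near_eq_cvg.
by near=> x; rewrite LD//; near: x; exact: nbhs_right_gt.
Unshelve. all: by end_near. Qed.

End at_zero.

End Inversion.

(** * The Gamma function on vertical lines *)

Section GammaLine.
Context {R : realType}.
Notation RR := (measurableTypeR R).
Let mu : {sigma_finite_measure set RR -> \bar R} := @lebesgue_measure R.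
Implicit Types (a b c r s x y : R).

Lemma mulcE a b c d : (a +i* b) * (c +i* d) = (a * c - b * d) +i* (a * d + b * c) :> R[i].
Proof. by []. Qed.

Lemma real_mulc x a b : x%:C * (a +i* b) = (x * a) +i* (x * b) :> R[i].
Proof. by rewrite mulcE !mul0r subr0 addr0. Qed.

Lemma mulc_real x a b : (a +i* b) * x%:C = (a * x) +i* (b * x) :> R[i].
Proof. by rewrite mulcE !mulr0 subr0 add0r. Qed.

Lemma subc1 a b : (a +i* b) - 1 = (a - 1) +i* b :> R[i].
Proof. by rewrite -[RHS](_ : (a - 1) +i* (b - 0) = _)// subr0. Qed.

Lemma continuous_powR_gt0 p u : 0 < u -> {for u, continuous (@powR R ^~ p)}.
Proof.
move=> u0; apply/differentiable_continuous/derivable1_diffP.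
by apply: derivable_powR; rewrite in_itv/= u0.
Qed.

(** Substitute [u = e^x] in Euler's integral. *)
Lemma gamma_int_line a y : gamma_int (a +i* y) = Fcos (gker a) y +i* Fsin (gker a) y.
Proof.
have L (h : R -> R) : continuous h ->
    \int[mu]_(u in `]0, +oo[) (u `^ (a - 1) * h (y * ln u) * expR (- u)) =
    \int[mu]_x (h (y * x) * gker a x).
  move=> ch; congr fine; rewrite integral_expR.
    apply: eq_integral => x _; congr EFin; rewrite expRK -expRM /gker.
    rewrite mulrC -mulrA [h _ * _]mulrC [RHS]mulrC !mulrA -!expRD; congr (expR _ * _).
    by ring.
  move=> u u0; apply: continuousM; last first.
    have c : continuous (fun u : R => expR (- u)) by cont.
    exact: c.
  apply: continuousM; first exact: continuous_powR_gt0.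
  apply: continuous_comp; last exact: ch.
  by apply: continuousM; [exact: cst_continuous|exact: continuous_ln].
rewrite /gamma_int /Cintegral; congr (_ +i* _).
  rewrite /Fcos -(L cos)//; last exact: continuous_cos.
  by apply: eq_Rintegral => u _; rewrite subc1 /cpowR real_mulc mulc_real.
rewrite /Fsin -(L sin)//; last exact: continuous_sin.
by apply: eq_Rintegral => u _; rewrite subc1 /cpowR real_mulc mulc_real.
Qed.

(** [Gm a y] is Gamma(a + i y) as the Fourier transform of [gker a], and [rgam a]
is its value at [y = 0]. *)
Definition Gm a y : R[i] := Fcos (gker a) y +i* Fsin (gker a) y.

Definition rgam a : R := \int[mu]_x gker a x.

Lemma CgammaE a y : 0 < a -> Cgamma (a +i* y) = Gm a y.
Proof.
by move=> a0; rewrite /Cgamma /= a0 addr0 /poch big_ord0 divr1 gamma_int_line.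
Qed.

Lemma Gm0 a : Gm a 0 = (rgam a)%:C.
Proof.
rewrite /Gm /Fcos /Fsin; congr (_ +i* _).
  by apply: eq_Rintegral => x _; rewrite mul0r cos0 mul1r.
under eq_Rintegral do rewrite mul0r sin0 mul0r.
by rewrite Rintegral_cst// mul0r.
Qed.

Lemma GmN a y : 0 < a -> Gm a (- y) = Fcos (gker a) y -i* Fsin (gker a) y.
Proof.
move=> a0; rewrite /Gm FcosN FsinN//; first exact: continuous_gker.
exact: integrable_gker.
Qed.

Lemma rgam_ge0 a : 0 <= rgam a.
Proof. by apply: Rintegral_ge0 => x _; exact: gker_ge0. Qed.

Lemma rgam_gt0 a : 0 < a -> 0 < rgam a.
Proof.
move=> a0; have gi := integrable_gker a0.
rewrite -lte_fin /rgam /Rintegral fineK; last exact: integrable_fin_num.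
apply: (@lt_le_trans _ _ (\int[mu]_(x in `[0%R, 1%R]) (expR (- expR 1))%:E)%E).
  by rewrite integral_cst//= lebesgue_measure_itv/= lte_fin ltr01 sube0 mule1 lte_fin expR_gt0.
apply: (@le_trans _ _ (\int[mu]_(x in `[0%R, 1%R]) (gker a x)%:E)%E).
  apply: ge0_le_integral => //.
  - apply/measurable_EFinP/measurable_funTS.
    by apply: (@continuous_measurable_fun _ (gker a)); exact: continuous_gker.
  - move=> x; rewrite /= in_itv/= => /andP[x0 x1]; rewrite lee_fin ler_expR.
    have : expR x <= expR 1 by rewrite ler_expR.
    have : 0 <= a * x by rewrite mulr_ge0// ltW.
    lra.
apply: ge0_subset_integral => //.
- by case/integrableP : gi.
- by move=> x _; rewrite lee_fin gker_ge0.
Qed.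

Lemma cvg_gker a (h : R -> R) : 0 < a -> (forall x, `|h x| <= 1) ->
  gker a n%:R * h n%:R @[n --> \oo] --> (0 : R) /\
  gker a (- n%:R) * h (- n%:R) @[n --> \oo] --> (0 : R).
Proof.
move=> a0 h1; pose C := expR (2 * a ^+ 2).
have C0 : C * expR (- (a * n%:R)) @[n --> \oo] --> (0 : R).
  rewrite -[X in _ --> X](mulr0 C); apply: cvgMr.
  apply: (@cvg_comp _ _ _ (fun n : nat => n%:R : R) (fun x => expR (- (a * x))) _ (pinfty_nbhs R)).
    exact: cvgr_idn.
  exact: cvg_expRN.
have B x n : `|x| = n%:R -> `|gker a x * h x| <= C * expR (- (a * n%:R)).
  move=> xn; rewrite normrM (le_trans (ler_piMr _ (h1 x)))//.
  by rewrite ger0_norm ?gker_ge0// -xn gker_le.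
split; apply/cvgr0Pnorm_le => _/posnumP[d];
  (move/cvgr0Pnorm_le : C0 => /(_ _ (gt0 d)); apply: filterS => n;
  apply: le_trans; rewrite (le_trans (B _ n _)) ?ler_norm// ?normrN normr_nat//).
Qed.

Lemma integrableD2 (f g : R -> R) : mu.-integrable setT (EFin \o f) ->
  mu.-integrable setT (EFin \o g) -> mu.-integrable setT (EFin \o (fun x => f x + g x)).
Proof. by move=> fi gi; exact: (@integrableD _ _ _ mu _ _ (EFin \o f) (EFin \o g)). Qed.

Lemma integrableB2 (f g : R -> R) : mu.-integrable setT (EFin \o f) ->
  mu.-integrable setT (EFin \o g) -> mu.-integrable setT (EFin \o (fun x => f x - g x)).
Proof. by move=> fi gi; exact: (@integrableB _ _ _ mu _ _ (EFin \o f) (EFin \o g)). Qed.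

(** The functional equation is the vanishing of the integral of the derivative
of [gker a x * cos (y x)], resp. [gker a x * sin (y x)]. *)
Lemma GmS a y : 0 < a -> Gm (a + 1) y = (a +i* y) * Gm a y.
Proof.
move=> a0; have a1 : 0 < a + 1 by rewrite addr_gt0.
have cg : continuous (gker a) by exact: continuous_gker.
have cg1 : continuous (gker (a + 1)) by exact: continuous_gker.
have ic := integrable_Fcos y cg (integrable_gker a0).
have is_ := integrable_Fsin y cg (integrable_gker a0).
have ic1 := integrable_Fcos y cg1 (integrable_gker a1).
have is1 := integrable_Fsin y cg1 (integrable_gker a1).
have gS x : gker (a + 1) x = expR x * gker a x.
  by rewrite /gker -expRD; congr expR; ring.
have dg x : is_derive x (1 : R) (gker a) (a * gker a x - gker (a + 1) x).
  rewrite gS; apply: der_eq; first (rewrite /gker; der).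
  by rewrite /gker /GRing.scale/= mulr1; ring.
rewrite /Gm; simpc; congr (_ +i* _).
- have iac := integrableZ a ic; have iys := integrableZ y is_.
  suff : a * Fcos (gker a) y - y * Fsin (gker a) y - Fcos (gker (a + 1)) y = 0.
    by move/subr0_eq/esym.
  rewrite /Fcos /Fsin -!RintegralZl// -!RintegralB//; last exact: integrableB2.
  apply: (@integral_derivative_vanishing _ (fun x => gker a x * cos (y * x))).
  - move=> x; apply: (der_eq (derM (dg x) (der_cos (derM (der_cst y x) (der_id x))))).
    by ring.
  - by cont.
  - by apply: integrableB2 => //; exact: integrableB2.
  - by case: (@cvg_gker a (fun x => cos (y * x)) a0) => // x; exact: norm_cos_le1.
  - by case: (@cvg_gker a (fun x => cos (y * x)) a0) => // x; exact: norm_cos_le1.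
- have ias := integrableZ a is_; have iyc := integrableZ y ic.
  suff : a * Fsin (gker a) y + y * Fcos (gker a) y - Fsin (gker (a + 1)) y = 0.
    by move/subr0_eq/esym.
  rewrite /Fcos /Fsin -!RintegralZl// -RintegralD// -!RintegralB//; last exact: integrableD2.
  apply: (@integral_derivative_vanishing _ (fun x => gker a x * sin (y * x))).
  - move=> x; apply: (der_eq (derM (dg x) (der_sin (derM (der_cst y x) (der_id x))))).
    by ring.
  - by cont.
  - by apply: integrableB2 => //; exact: integrableD2.
  - by case: (@cvg_gker a (fun x => sin (y * x)) a0) => // x; exact: norm_sin_le1.
  - by case: (@cvg_gker a (fun x => sin (y * x)) a0) => // x; exact: norm_sin_le1.
Qed.

Lemma rgamS a : 0 < a -> rgam (a + 1) = a * rgam a.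
Proof.
move=> a0; have := @GmS a 0 a0; rewrite !Gm0; simpc.
by move/(congr1 (@complex.Re _)) => /=.
Qed.

Lemma normc_Re_Im_le (z : R[i]) : Normc.normc z <= `|complex.Re z| + `|complex.Im z|.
Proof.
case: z => u v /=; rewrite -[leRHS]ger0_norm ?addr_ge0// -sqrtr_sqr ler_wsqrtr//.
rewrite sqrrD !real_normK ?num_real//.
have : 0 <= `|u| * `|v| by rewrite mulr_ge0.
lra.
Qed.

Lemma Re_le_normc (z : R[i]) : `|complex.Re z| <= Normc.normc z.
Proof. by case: z => u v /=; rewrite -sqrtr_sqr ler_wsqrtr// lerDl sqr_ge0. Qed.

Lemma Im_le_normc (z : R[i]) : `|complex.Im z| <= Normc.normc z.
Proof. by case: z => u v /=; rewrite -sqrtr_sqr ler_wsqrtr// lerDr sqr_ge0. Qed.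

Lemma normc_Gm_le a y : 0 < a -> Normc.normc (Gm a y) <= 2 * rgam a.
Proof.
move=> a0; rewrite (le_trans (normc_Re_Im_le _))//= mulr2n mulrDl !mul1r lerD//.
  by apply: Fcos_le; [exact: continuous_gker|exact: gker_ge0|exact: integrable_gker].
by apply: Fsin_le; [exact: continuous_gker|exact: gker_ge0|exact: integrable_gker].
Qed.

(** One step of the functional equation gives a factor [|a + i y|^-1]. Two such
factors make the product of four Gamma functions integrable. *)
Lemma normc_Gm_decay a : 0 < a ->
  exists2 K, 0 <= K & forall y, Normc.normc (Gm a y) * Num.sqrt (1 + y ^+ 2) <= K.
Proof.
move=> a0; pose m := Num.min a 1.
have m0 : 0 < m by rewrite lt_min a0 ltr01.
exists (2 * rgam (a + 1) / m); first by rewrite divr_ge0 ?mulr_ge0 ?rgam_ge0// ltW.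
move=> y; have a1 : 0 < a + 1 by rewrite addr_gt0.
rewrite ler_pdivlMr//; have := @normc_Gm_le (a + 1) y a1; apply: le_trans.
have -> : Normc.normc (Gm (a + 1) y) = Num.sqrt (a ^+ 2 + y ^+ 2) * Normc.normc (Gm a y).
  by rewrite GmS// Normc.normcM.
rewrite mulrAC -mulrA [leRHS]mulrC ler_wpM2l//.
  by case: (Gm a y) => u v; exact: sqrtr_ge0.
have -> : m = Num.sqrt (m ^+ 2) by rewrite sqrtr_sqr ger0_norm// ltW.
rewrite -sqrtrM ?sqr_ge0// ler_wsqrtr//.
have m1 : m <= a by rewrite ge_min lexx.
have m2 : m <= 1 by rewrite ge_min lexx orbT.
have m3 : m ^+ 2 <= a ^+ 2 by nra.
have m4 : m ^+ 2 <= 1 by nra.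
have := sqr_ge0 y.
nra.
Qed.

Lemma continuous_Gm a : 0 < a ->
  continuous (fun y => complex.Re (Gm a y)) /\ continuous (fun y => complex.Im (Gm a y)).
Proof.
move=> a0; split => /=.
  by apply: continuous_Fcos; [exact: continuous_gker|exact: integrable_gker].
by apply: continuous_Fsin; [exact: continuous_gker|exact: integrable_gker].
Qed.

Lemma gker_leC a x : 0 < a -> gker a x <= expR (2 * a ^+ 2).
Proof.
move=> a0; rewrite (le_trans (gker_le x a0))// ler_piMr ?expR_ge0//.
by rewrite -expR0 ler_expR oppr_le0 mulr_ge0// ltW.
Qed.

Lemma corr_gker a c : 0 < a -> 0 < c ->
  corr (gker a) (gker c) = (fun r => rgam (a + c) * bker a c r).
Proof.
move=> a0 c0; apply/funext => r; rewrite /corr.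
have cgg : continuous (fun q => gker a (r + q) * gker c q).
  by have ca := @continuous_gker _ a; have cc := @continuous_gker _ c; cont.
rewrite -(@Rintegral_translation _ _ (- ln (1 + expR r)) cgg).
under eq_Rintegral do rewrite gker_translation.
have ig := integrable_gker (addr_gt0 a0 c0).
by rewrite RintegralZl// [RHS]mulrC.
Qed.

(** Euler's beta integral: the integral of a correlation is the product of the
integrals. *)
Lemma Rintegral_bker a c : 0 < a -> 0 < c ->
  \int[mu]_x bker a c x = rgam a * rgam c / rgam (a + c).
Proof.
move=> a0 c0; have ac0 := addr_gt0 a0 c0.
have := @Rintegral_corrT _ (gker a) (gker c) _ (@continuous_gker _ a)
  (@continuous_gker _ c) (gker_ge0 a) (gker_ge0 c) (fun x => gker_leC x a0)
  (integrable_gker a0) (integrable_gker c0).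
rewrite corr_gker// RintegralZl//; last exact: integrable_bker.
rewrite -/(rgam a) -/(rgam c) => <-; rewrite mulrC mulKf// gt_eqF//.
exact: rgam_gt0.
Qed.

(** Gamma(a + iy) Gamma(c - iy) is the Fourier transform of the correlation of
[gker a] and [gker c], which is a multiple of [bker a c]. *)
Lemma Gm_conj_mul a c y : 0 < a -> 0 < c ->
  Gm a y * Gm c (- y) =
  (rgam (a + c))%:C * (Fcos (bker a c) y +i* Fsin (bker a c) y).
Proof.
move=> a0 c0; rewrite (GmN y c0) /Gm mulcE real_mulc.
have hc := Fcos_corr (@continuous_gker _ a) (@continuous_gker _ c) (gker_ge0 a)
  (gker_ge0 c) (fun x => gker_leC x a0) (integrable_gker a0) (integrable_gker c0) y.
have hs := Fsin_corr (@continuous_gker _ a) (@continuous_gker _ c) (gker_ge0 a)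
  (gker_ge0 c) (fun x => gker_leC x a0) (integrable_gker a0) (integrable_gker c0) y.
have ib := integrable_bker a0 c0; have cb := @continuous_bker _ a c.
rewrite corr_gker// in hc hs.
have Ec : Fcos (fun r => rgam (a + c) * bker a c r) y = rgam (a + c) * Fcos (bker a c) y.
  rewrite /Fcos -RintegralZl//; last exact: integrable_Fcos.
  by apply: eq_Rintegral => x _; rewrite mulrCA.
have Es : Fsin (fun r => rgam (a + c) * bker a c r) y = rgam (a + c) * Fsin (bker a c) y.
  rewrite /Fsin -RintegralZl//; last exact: integrable_Fsin.
  by apply: eq_Rintegral => x _; rewrite mulrCA.
rewrite -Ec -Es hc hs !mulrN opprK; congr (_ +i* _).
by move: (Fcos (gker a) y) (Fsin (gker a) y) (Fcos (gker c) y) (Fsin (gker c) y) => ? ? ? ?; ring.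
Qed.

End GammaLine.

(* From here on [Gm] is used through its equations only. *)
Opaque Gm.

(** * Barnes' first lemma *)

Section Barnes.
Context {R : realType}.
Notation RR := (measurableTypeR R).
Let mu : {sigma_finite_measure set RR -> \bar R} := @lebesgue_measure R.
Implicit Types (a b c d r s x y : R).

Definition barnes_integrand a b c d y : R[i] :=
  Gm a y * Gm b y * (Gm c (- y) * Gm d (- y)).

Lemma continuous_mulc (F G : R -> R[i]) :
  continuous (fun y => complex.Re (F y)) -> continuous (fun y => complex.Im (F y)) ->
  continuous (fun y => complex.Re (G y)) -> continuous (fun y => complex.Im (G y)) ->
  continuous (fun y => complex.Re (F y * G y)) /\ continuous (fun y => complex.Im (F y * G y)).
Proof.
move=> F1 F2 G1 G2; split.
  rewrite (_ : (fun y => _) = (fun y => complex.Re (F y) * complex.Re (G y) -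
     complex.Im (F y) * complex.Im (G y))).
    by apply: contD; [|apply: contN]; exact: contM.
  by apply/funext => y; case: (F y) => ? ?; case: (G y).
rewrite (_ : (fun y => _) = (fun y => complex.Re (F y) * complex.Im (G y) +
   complex.Im (F y) * complex.Re (G y))).
  by apply: contD; exact: contM.
by apply/funext => y; case: (F y) => ? ?; case: (G y).
Qed.

Lemma continuous_GmN a : 0 < a ->
  continuous (fun y => complex.Re (Gm a (- y))) /\ continuous (fun y => complex.Im (Gm a (- y))).
Proof.
move=> a0; have [c1 c2] := continuous_Gm a0; have cN := @cont_id R.
by split; [apply: (cont_comp c1); exact: contN|apply: (cont_comp c2); exact: contN].
Qed.

Section fixed_parameters.
Variables (a b c d : R).
Hypotheses (a0 : 0 < a) (b0 : 0 < b) (c0 : 0 < c) (d0 : 0 < d).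
Let W := barnes_integrand a b c d.

Lemma continuous_barnes : continuous (fun y => complex.Re (W y)) /\ continuous (fun y => complex.Im (W y)).
Proof.
have [a1 a2] := continuous_Gm a0; have [b1 b2] := continuous_Gm b0.
have [c1 c2] := continuous_GmN c0; have [d1 d2] := continuous_GmN d0.
have [ab1 ab2] := continuous_mulc a1 a2 b1 b2.
have [cd1 cd2] := continuous_mulc c1 c2 d1 d2.
exact: (@continuous_mulc (fun y => Gm a y * Gm b y)
  (fun y => Gm c (- y) * Gm d (- y)) ab1 ab2 cd1 cd2).
Qed.

Let W_decay : exists2 K, 0 <= K & forall y, Normc.normc (W y) <= K * (1 + y ^+ 2)^-1.
Proof.
have [Ka Ka0 aK] := normc_Gm_decay a0; have [Kb Kb0 bK] := normc_Gm_decay b0.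
exists (Ka * Kb * (2 * rgam c * (2 * rgam d))).
  by rewrite !mulr_ge0 ?rgam_ge0.
move=> y; have n0 (z : R[i]) : 0 <= Normc.normc z by case: z => ? ?; exact: sqrtr_ge0.
have nM (u v w z : R[i]) : Normc.normc (u * v * (w * z)) =
    Normc.normc u * Normc.normc v * (Normc.normc w * Normc.normc z).
  by rewrite !Normc.normcM.
rewrite /W /barnes_integrand nM [leRHS]mulrAC.
apply: ler_pM; rewrite ?mulr_ge0 ?n0//; last first.
  by apply: ler_pM => //; exact: normc_Gm_le.
have D0 : 0 < 1 + y ^+ 2 by rewrite ltr_pwDl ?sqr_ge0.
rewrite ler_pdivlMr//.
have -> : 1 + y ^+ 2 = Num.sqrt (1 + y ^+ 2) * Num.sqrt (1 + y ^+ 2).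
  by rewrite -expr2 sqr_sqrtr// ltW.
rewrite mulrACA; apply: ler_pM; rewrite ?mulr_ge0 ?sqrtr_ge0//.
Qed.

Lemma integrable_barnes :
  mu.-integrable setT (EFin \o (fun y => complex.Re (W y))) /\
  mu.-integrable setT (EFin \o (fun y => complex.Im (W y))).
Proof.
have [K K0 WK] := W_decay; have [c1 c2] := continuous_barnes.
have iK : mu.-integrable setT (EFin \o (fun y => K * (1 + y ^+ 2)^-1)).
  by apply: integrableZ; exact: integrable_Cauchy.
split; apply: integrable_dominated iK => // y; rewrite (le_trans _ (WK y))//.
  exact: Re_le_normc.
exact: Im_le_normc.
Qed.

Let k := corr (bker a c) (bker d b).

Let ca := @continuous_bker R a c.
Let cb := @continuous_bker R d b.
Let ia := integrable_bker a0 c0.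
Let ib := integrable_bker d0 b0.

Let ck : continuous k.
Proof.
by apply: (@continuous_corr _ _ _ 1) => // x; rewrite ?bker_ge0 ?bker_le1.
Qed.

Let ki : mu.-integrable setT (EFin \o k).
Proof.
by apply: (@integrable_corr _ _ _ 1) => // x; rewrite ?bker_ge0 ?bker_le1.
Qed.

(** Pair the Gamma factors as (a, c) and (d, b), the second pair at [- y]: the
product of the transform of [bker a c] with the conjugate of that of [bker d b]
is the transform of their correlation [k]. *)
Let W_Fourier y : W y = (rgam (a + c) * rgam (b + d))%:C * (Fcos k y +i* Fsin k y).
Proof.
have fM x : bker a c x <= 1 by rewrite bker_le1.
have hc := Fcos_corr ca cb (bker_ge0 a c) (bker_ge0 d b) fM ia ib y.
have hs := Fsin_corr ca cb (bker_ge0 a c) (bker_ge0 d b) fM ia ib y.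
have E1 := Gm_conj_mul y a0 c0.
have E2 : Gm b y * Gm d (- y) =
    (rgam (b + d))%:C * (Fcos (bker d b) y -i* Fsin (bker d b) y).
  have := Gm_conj_mul (- y) d0 b0; rewrite opprK mulrC => ->.
  by rewrite (FcosN (bker d b) y) (FsinN y cb ib) (addrC d b).
rewrite /W /barnes_integrand mulrACA E1 E2 mulrACA -rmorphM.
congr (_ * _); rewrite mulcE; congr (_ +i* _).
  by rewrite /k hc mulrN opprK.
by rewrite /k hs mulrN addrC.
Qed.

Lemma Rintegral_barnes_Im : \int[mu]_y complex.Im (W y) = 0.
Proof.
have [_ iI] := integrable_barnes; have [_ cI] := continuous_barnes.
apply: Rintegral_odd => // y; rewrite !W_Fourier !real_mulc /=.
by rewrite FsinN// mulrN.
Qed.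

Let rS0 := rgam_gt0 (addr_gt0 (addr_gt0 (addr_gt0 a0 b0) c0) d0).

(** At the origin the two beta kernels multiply to a single one, and Euler's
integral gives the value. *)
Let k0E : k 0 = rgam (a + d) * rgam (b + c) / rgam (a + b + c + d).
Proof.
rewrite /k /corr; have E : a + d + (b + c) = a + b + c + d by ring.
rewrite -E -Rintegral_bker ?addr_gt0//; apply: eq_Rintegral => q _.
by rewrite add0r /bker -expRD; congr expR; ring.
Qed.

Let kM x : `|k x| <= 1 * \int[mu]_x bker d b x.
Proof.
by apply: corr_le => // z; rewrite ?bker_ge0 ?bker_le1.
Qed.

(** Barnes' first lemma for positive parameters: Fourier inversion at the origin,
applied to the correlation whose transform is the integrand. *)
Lemma Rintegral_barnes_Re : \int[mu]_y complex.Re (W y) =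
  2 * pi * (rgam (a + c) * rgam (a + d) * rgam (b + c) * rgam (b + d)) /
  rgam (a + b + c + d).
Proof.
have [iR _] := integrable_barnes.
have [r1 r2] := (rgam_gt0 (addr_gt0 a0 c0), rgam_gt0 (addr_gt0 b0 d0)).
set M := rgam (a + c) * rgam (b + d); have M0 : 0 < M := mulr_gt0 r1 r2.
have FE : Fcos k = (fun y => M^-1 * complex.Re (W y)).
  by apply/funext => y; rewrite W_Fourier real_mulc /= mulKf// gt_eqF.
have Fi : mu.-integrable setT (EFin \o Fcos k) by rewrite FE; exact: integrableZ.
have := Fourier_inversion0 ck kM ki Fi.
rewrite k0E {1}FE RintegralZl; [|exact: measurableT|exact: iR].
move=> /(congr1 ( *%R M)); rewrite (mulVKf (lt0r_neq0 M0)) => ->.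
rewrite /M; move: (rgam (a + c)) (rgam (a + d)) (rgam (b + c)) (rgam (b + d)).
by move: (rgam (a + b + c + d)) => ? ? ? ? ?; ring.
Qed.

End fixed_parameters.

(** The antiderivative of [gker 1] is explicit. *)
Lemma rgam1 : rgam 1 = 1 :> R.
Proof.
have i1 := @integrable_gker R 1 ltr01; have c1 := @continuous_gker R 1.
have := continuous_integral_itvNn c1 i1; rewrite -/(rgam 1) => /cvg_unique; apply => //.
pose F x : R := expR (- expR x).
have dF x : is_derive x (1 : R) F (- gker 1 x).
  apply: der_eq; first (rewrite /F; der).
  by rewrite /gker /GRing.scale/= mul1r expRD; ring.
have E (n : nat) : (0 < n)%N -> \int[mu]_(x in `[- n%:R, n%:R]) gker 1 x = F (- n%:R) - F n%:R.
  move=> n0; rewrite /Rintegral (@continuous_FTC2 _ _ (fun x => - F x))//.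
  - by rewrite -EFinB/=; ring.
  - by rewrite (@lt_trans _ _ 0)// ?oppr_lt0 ltr0n.
  - exact: continuous_subspaceT.
  - have cF : continuous F.
      by move=> x; apply/differentiable_continuous/derivable1_diffP.
    split => //.
    + by apply: cvg_at_right_filter; apply: contN.
    + by apply: cvg_at_left_filter; apply: contN.
  - move=> x _; rewrite derive1E; have /derN dN := dF x.
    by rewrite derive_val opprK.
apply: (@cvg_trans _ (F (- n%:R) - F n%:R @[n --> \oo])).
  by apply: near_eq_cvg; near=> n; rewrite E//; near: n; exact: nbhs_infty_gt.
suff : F (- n%:R) - F n%:R @[n --> \oo] --> (1 - 0 : R) by rewrite subr0.
apply: cvgB.
  have : continuous (fun x : R => expR (- x)) by cont.
  move=> /(_ 0); rewrite /continuous_at oppr0 expR0 => h.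
  apply: (@cvg_comp _ _ _ (fun n : nat => expR (- n%:R) : R) (fun x => expR (- x)) _ (nbhs (0 : R))) => //.
  exact: cvgn_expR.
apply: (@squeeze_cvgr _ _ _ _ (fun=> 0) (fun n : nat => expR (- n%:R))).
- apply: nearW => n; rewrite expR_ge0 ler_expR lerN2/=.
  by have := expR_ge1Dx (n%:R : R); apply: le_trans; rewrite lerDr.
- exact: cvg_cst.
- exact: cvgn_expR.
Unshelve. all: by end_near. Qed.

End Barnes.

(** * Legendre's duplication formula *)

Section Duplication.
Context {R : realType}.
Notation RR := (measurableTypeR R).
Let mu : {sigma_finite_measure set RR -> \bar R} := @lebesgue_measure R.
Implicit Types (a e x y w : R).

(** [(1 + w^2)^(- e - 1/2)]: both B(e, 1/2) and B(e, e) become integrals of this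
function, by [w = expR (x / 2)] and [w = sinh (x / 2)] respectively. *)
Definition dupker e w : R := expR (- ((e + 1 / 2) * ln (1 + w ^+ 2))).

Lemma continuous_dupker e : continuous (dupker e).
Proof.
rewrite /dupker; apply: cont_expR; apply: contN; apply: contM; first exact: cont_cst.
by apply: cont_ln; [move=> x; rewrite ltr_pwDl ?sqr_ge0|cont].
Qed.

Lemma integral_dupker_exp e :
  (\int[mu]_x (bker (1 / 2) e x)%:E = \int[mu]_w (dupker e w)%:E)%E.
Proof.
have cd := @continuous_dupker e.
rewrite (ge0_integral_even cd); last 2 first.
- by move=> w; exact: expR_ge0.
- by move=> w; rewrite /dupker sqrrN.
rewrite -integral_itv_obnd_cbnd; last first.
  by apply/measurable_EFinP/measurable_funTS; exact: continuous_measurable_fun.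
have dphi x : is_derive x (1 : R) (fun x => expR (x / 2)) (expR (x / 2) / 2).
  apply: (der_eq (der_expR (derM (der_id x) (der_cst 2^-1 x)))).
  by rewrite mulr0 add0r mulr1.
have cphi : continuous (fun x : R => expR (x / 2) / 2) by cont.
have := integral_substitution dphi cphi _ (fun x => cd _).
rewrite (_ : [set expR (x / 2) | x in setT] = `]0%R, +oo[%classic); last first.
  apply/seteqP; split=> [_ [x _ <-]|w]; rewrite /= in_itv/= andbT ?expR_gt0//.
  move=> w0; exists (2 * ln w) => //.
  by rewrite mulrAC divff// mul1r lnK.
move=> ->; last by move=> x; rewrite divr_gt0// expR_gt0.
have h0 x : 0 <= dupker e (expR (x / 2)) * (expR (x / 2) / 2).
  by rewrite mulr_ge0 ?expR_ge0// divr_ge0// expR_ge0.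
rewrite -ge0_integralZl//; last 2 first.
- apply/measurable_EFinP.
  apply: (@continuous_measurable_fun _ (fun x => dupker e (expR (x / 2)) * (expR (x / 2) / 2))).
  by cont.
- by move=> x _; rewrite lee_fin.
apply: eq_integral => x _; rewrite -EFinM; congr EFin.
rewrite [RHS](_ : _ = dupker e (expR (x / 2)) * expR (x / 2)); last by field.
rewrite /dupker /bker.
rewrite -expRM_natr mulfVK// -expRD; congr expR.
by field.
Qed.

Definition cosh2 x : R := (expR (x / 2) + expR (- (x / 2))) / 2.
Definition sinh2 x : R := (expR (x / 2) - expR (- (x / 2))) / 2.

Lemma cosh2_gt0 x : 0 < cosh2 x.
Proof. by rewrite divr_gt0// addr_gt0// expR_gt0. Qed.

Lemma range_sinh2 : range sinh2 = setT.
Proof.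
apply/seteqP; split=> // y _; pose s := Num.sqrt (1 + y ^+ 2).
have s2 : s ^+ 2 = 1 + y ^+ 2 by rewrite sqr_sqrtr// addr_ge0// sqr_ge0.
have sy : `|y| < s.
  by rewrite -sqrtr_sqr ltr_sqrt ?ltr_pwDl ?sqr_ge0.
have t0 : 0 < s + y by rewrite -ltrBlDr sub0r (le_lt_trans (ler_norm _))// normrN.
exists (2 * ln (s + y)) => //; rewrite /sinh2.
have -> : 2 * ln (s + y) / 2 = ln (s + y) by rewrite mulrAC divff// mul1r.
rewrite expRN lnK//.
have -> : (s + y)^-1 = s - y.
  apply: (mulfI (lt0r_neq0 t0)); rewrite divff ?lt0r_neq0//.
  by rewrite mulrC -subr_sqr s2 addrK.
by field.
Qed.

Lemma integral_dupker_sinh e :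
  (\int[mu]_w (dupker e w)%:E =
   \int[mu]_x (2 `^ (2 * e - 1) * bker e e x)%:E)%E.
Proof.
have cd := @continuous_dupker e.
have dphi x : is_derive x (1 : R) sinh2 (cosh2 x / 2).
  rewrite /sinh2; apply: der_eq; first der.
  by rewrite /cosh2 /GRing.scale/=; field.
have cphi : continuous (fun x : R => cosh2 x / 2) by rewrite /cosh2; cont.
have := integral_substitution dphi cphi _ (fun x => cd _).
rewrite range_sinh2 => ->; last by move=> x; rewrite divr_gt0// cosh2_gt0.
apply: eq_integral => x _; congr EFin.
have E1 : 1 + sinh2 x ^+ 2 = cosh2 x ^+ 2.
  rewrite /sinh2 /cosh2 expRN; have := expR_gt0 (x / 2) => h.
  by field; rewrite gt_eqF.
have E2 : 1 + expR x = 2 * (expR (x / 2) * cosh2 x).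
  rewrite /cosh2 expRN {1}(_ : x = x / 2 + x / 2); last by field.
  by rewrite expRD; have := expR_gt0 (x / 2) => h; field; rewrite gt_eqF.
have c0 := cosh2_gt0 x.
have E3 : ln (1 + expR x) = ln 2 + (x / 2 + ln (cosh2 x)).
  have p1 : 0 < expR (x / 2) * cosh2 x by rewrite mulr_gt0// expR_gt0.
  have lnMp u v : 0 < u -> 0 < v -> ln (u * v) = ln u + ln v :> R.
    by move=> u0 v0; rewrite lnM ?posrE.
  by rewrite E2 (lnMp _ _ (ltr0Sn _ _) p1) (lnMp _ _ (expR_gt0 _) c0) expRK.
have E4 : ln (1 + sinh2 x ^+ 2) = 2 * ln (cosh2 x).
  by rewrite E1 lnXn// mulr_natl.
have E5 : cosh2 x / 2 = expR (ln (cosh2 x) - ln 2) by rewrite expRB !lnK ?posrE.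
by rewrite /dupker /bker E3 E4 E5 /powR pnatr_eq0/= -!expRD; congr expR; field.
Qed.

Lemma Rintegral_bker_duplication e : 0 < e ->
  rgam e * rgam e / rgam (2 * e) =
  2 `^ (1 - 2 * e) * (rgam (1 / 2) * rgam e / rgam (1 / 2 + e)).
Proof.
move=> e0; have h0 : 0 < 1 / 2 :> R by rewrite divr_gt0.
have -> : 2 * e = e + e by rewrite mulr2n mulrDl !mul1r.
rewrite -!Rintegral_bker//.
have -> : \int[mu]_x bker (1 / 2) e x = 2 `^ (2 * e - 1) * \int[mu]_x bker e e x.
  rewrite -RintegralZl//; last exact: integrable_bker.
  by congr fine; rewrite integral_dupker_exp integral_dupker_sinh.
rewrite mulrA -powRD ?pnatr_eq0 ?implybT//.
by rewrite (_ : 1 - (e + e) + (2 * e - 1) = 0) ?powRr0 ?mul1r//; ring.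
Qed.

Lemma rgam_half : rgam (1 / 2) = Num.sqrt pi :> R.
Proof.
have h0 : 0 < 1 / 2 :> R by rewrite divr_gt0.
have : \int[mu]_x bker (1 / 2) (1 / 2) x = pi :> R.
  rewrite /Rintegral integral_dupker_exp.
  under eq_integral => w _.
    rewrite /dupker (_ : 1 / 2 + 1 / 2 = 1) ?mul1r; last by field.
    rewrite expRN lnK ?posrE ?ltr_pwDl ?sqr_ge0//; over.
  by rewrite integral_Cauchy.
rewrite Rintegral_bker// (_ : 1 / 2 + 1 / 2 = 1); last by field.
rewrite rgam1 divr1 -expr2 => <-.
by rewrite sqrtr_sqr ger0_norm// rgam_ge0.
Qed.

(** The two substitutions relate B(e, 1/2) to B(e, e). *)
Lemma rgam_duplication e : 0 < e ->
  rgam e * rgam (e + 1 / 2) = 2 `^ (1 - 2 * e) * Num.sqrt pi * rgam (2 * e).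
Proof.
move=> e0; have := Rintegral_bker_duplication e0; rewrite rgam_half.
have h0 : 0 < 1 / 2 :> R by rewrite divr_gt0.
have r1 : rgam e != 0 by rewrite gt_eqF// rgam_gt0.
have r2 : rgam (2 * e) != 0 by rewrite gt_eqF// rgam_gt0// mulr_gt0.
have r3 : rgam (e + 1 / 2) != 0 by rewrite gt_eqF// rgam_gt0// addr_gt0.
rewrite [1 / 2 + e]addrC; move: (rgam e) (rgam (2 * e)) (rgam (e + 1 / 2)) r1 r2 r3.
move=> x y z x0 y0 z0 H; apply: (mulfI x0); apply: (mulIf (invr_neq0 y0)).
rewrite (_ : x * (x * z) / y = (x * x / y) * z); last by ring.
by rewrite H; field; rewrite y0 z0.
Qed.

(** For [b] between [a/2] and [2a], [gker b] is dominated by the sum of the kernels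
at the two ends. *)
Lemma continuous_rgam a : 0 < a -> {for a, continuous (@rgam R)}.
Proof.
move=> a0; apply: (@continuity_under_integral R _ RR mu gker setT
  measurableT (a / 2) (2 * a) _ _ (fun x => gker (a / 2) x + gker (2 * a) x)).
- move=> b /=; rewrite in_itv/= => /andP[ab _]; apply: integrable_gker.
  by rewrite (lt_trans _ ab)// divr_gt0.
- apply: aeW => x _ b _.
  suff : continuous (fun b => gker b x) by apply.
  by rewrite /gker; cont.
- by apply: integrableD2; apply: integrable_gker; rewrite ?divr_gt0 ?mulr_gt0.
- move=> b /=; rewrite in_itv/= => /andP[b1 b2]; apply: aeW => x _.
  rewrite ger0_norm ?gker_ge0//; have [x0|x0] := leP 0 x.
    rewrite (@le_trans _ _ (gker (2 * a) x))// ?lerDr ?gker_ge0//.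
    by rewrite ler_expR lerD2r ler_wpM2r// ltW.
  rewrite (@le_trans _ _ (gker (a / 2) x))// ?lerDl ?gker_ge0//.
  by rewrite ler_expR lerD2r ler_wnM2r// ltW.
- by rewrite inE/= in_itv/=; apply/andP; split; lra.
Qed.

End Duplication.

(** * Pochhammer symbols and the orthogonality of Jacobi polynomials *)

Section Pochhammer.
Context {F : comNzRingType}.
Implicit Types (a : F).

Lemma poch0 a : poch a 0 = 1.
Proof. by rewrite /poch big_ord0. Qed.

Lemma pochSr a n : poch a n.+1 = poch a n * (a + n%:R).
Proof. by rewrite /poch big_ord_recr. Qed.

Lemma pochD a n m : poch a (n + m) = poch a n * poch (a + n%:R) m.
Proof.
elim: m => [|m IH]; first by rewrite addn0 poch0 mulr1.
by rewrite addnS !pochSr IH mulrA -addrA natrD.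
Qed.

Lemma pochS a n : poch a n.+1 = a * poch (a + 1) n.
Proof. by rewrite -add1n pochD /poch big_ord1 addr0. Qed.

Lemma pochN n s : poch (- n%:R : F) s = (-1) ^+ s * (n ^_ s)%:R.
Proof.
elim: s => [|s IH]; first by rewrite poch0 ffactn0 mulr1.
rewrite pochSr IH ffactnSr exprSr; have [sn|ns] := leqP s n.
  by rewrite natrM natrB//; ring.
by rewrite ffact_small// !(mul0n, mulr0, mul0r).
Qed.

Lemma poch_reflect a n : poch (1 - a - n%:R) n = (-1) ^+ n * poch a n.
Proof.
elim: n a => [|n IH] a; first by rewrite !poch0 mul1r.
rewrite pochS pochSr (_ : 1 - a - n.+1%:R + 1 = 1 - a - n%:R) ?IH.
  by rewrite exprSr -natr1; ring.
by rewrite -natr1; ring.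
Qed.

End Pochhammer.

Lemma poch_rmorph (F G : comNzRingType) (f : {rmorphism F -> G}) (a : F) n :
  f (poch a n) = poch (f a) n.
Proof.
by rewrite /poch rmorph_prod; apply: eq_bigr => i _; rewrite rmorphD rmorph_nat.
Qed.

Section FiniteDifference.
Context {F : numFieldType}.
Implicit Types (c E S : F) (p : {poly F}).

Lemma poch_neq0 E n : (forall s, E + s%:R != 0) -> poch E n != 0.
Proof. by move=> h; rewrite /poch; apply/prodf_neq0 => i _; exact: h. Qed.

(** Pascal's rule: an alternating binomial sum of order [n + 1] is one of order [n]
of the first difference of [f]. *)
Lemma alternating_binS n (f : nat -> F) :
  \sum_(s < n.+2) (-1) ^+ s * 'C(n.+1, s)%:R * f s =
  \sum_(s < n.+1) (-1) ^+ s * 'C(n, s)%:R * (f s - f s.+1).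
Proof.
under [RHS]eq_bigr do rewrite mulrBr.
rewrite sumrB big_ord_recl bin0 /=.
under eq_bigr do rewrite /bump/= add1n binS natrD mulrDr mulrDl.
rewrite big_split/= addrA; congr (_ + _).
  rewrite big_ord_recr/= bin_small// mulr0 mul0r addr0 [RHS]big_ord_recl bin0.
  by congr (_ + _); apply: eq_bigr.
rewrite -sumrN; apply: eq_bigr => i _.
by rewrite exprS mulN1r !mulNr.
Qed.

Lemma size_finite_difference p n : (size p <= n.+1)%N ->
  (size (p - (p \Po ('X + 1%:P)))%R <= n)%N.
Proof.
move=> pn; have [->|p0] := eqVneq p 0; first by rewrite comp_poly0 subrr size_poly0.
have sX : size ('X + 1%:P : {poly F}) = 2 by rewrite size_XaddC.
have sc : size (p \Po ('X + 1%:P)) = size p by rewrite size_comp_poly2.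
have lc : lead_coef (p \Po ('X + 1%:P)) = lead_coef p.
  by rewrite lead_coef_comp ?sX// lead_coefXaddC expr1n mulr1.
apply/leq_sizeP => j; rewrite leq_eqVlt => /predU1P[<-|nj].
  rewrite coefB; have [pn1|pn1] := eqVneq (size p) n.+1.
    by move: lc; rewrite !lead_coefE sc pn1/= => ->; rewrite subrr.
  have pn2 : (size p <= n)%N by rewrite -ltnS ltn_neqAle pn1.
  by rewrite !nth_default ?sc// subr0.
by rewrite coefB !nth_default ?sc ?subr0// (leq_trans pn).
Qed.

(** Each difference lowers the degree by one. *)
Lemma finite_difference0 n p : (size p <= n)%N ->
  \sum_(s < n.+1) (-1) ^+ s * 'C(n, s)%:R * p.[s%:R] = 0.
Proof.
elim: n p => [|n IH] p pn.
  by move: pn; rewrite leqn0 size_poly_eq0 => /eqP ->; rewrite big1// => i _; rewrite horner0 mulr0.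
rewrite (@alternating_binS n (fun s => p.[s%:R])) -[RHS](IH _ (size_finite_difference pn)).
apply: eq_bigr => i _; rewrite hornerD hornerN horner_comp !hornerE.
by rewrite natr1.
Qed.

(** The partial fraction expansion of [n! / (c)_(n+1)]. *)
Lemma alternating_bin_inv n c : (forall s, c + s%:R != 0) ->
  \sum_(s < n.+1) (-1) ^+ s * 'C(n, s)%:R * (s%:R + c)^-1 = n`!%:R / poch c n.+1.
Proof.
elim: n c => [|n IH] c c0.
  by rewrite big_ord1 bin0 expr0 !mul1r add0r pochSr poch0 addr0 mul1r.
rewrite (@alternating_binS n (fun s => (s%:R + c)^-1)).
under eq_bigr do rewrite mulrBr.
rewrite sumrB IH//.
under eq_bigr => i _ do rewrite -natr1 -addrA [1 + c]addrC.
have c1 s : c + 1 + s%:R != 0 by rewrite -addrA nat1r.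
rewrite IH// factS natrM [poch c n.+2]pochSr [poch c n.+1]pochS [poch (c + 1) n.+1]pochSr.
have := @poch_neq0 _ n c1; have := c0 0%N; have := c1 n; have := c0 n.+1.
rewrite addr0 -[(c + n.+1%:R)](_ : c + 1 + n%:R = _); last by rewrite -addrA nat1r.
move=> h1 h2 h3 h4; rewrite -natr1.
by field; rewrite h3 h4 h1.
Qed.

(** The Pochhammer symbol [(E + x)_n] as a polynomial in [x]. *)
Definition poch_poly E n : {poly F} := \prod_(i < n) ('X + (E + i%:R)%:P).

Lemma size_poch_poly E n : size (poch_poly E n) = n.+1.
Proof.
rewrite /poch_poly size_prod; last by move=> i _; rewrite -size_poly_eq0 size_XaddC.
rewrite (eq_bigr (fun=> 2%N)); last by move=> i _; rewrite size_XaddC.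
by rewrite sum_nat_const card_ord muln2 -addnn subSn ?leq_addl// addnK.
Qed.

Lemma horner_poch_poly E n x : (poch_poly E n).[x] = poch (E + x) n.
Proof.
rewrite /poch_poly horner_prod; apply: eq_bigr => i _.
by rewrite hornerD hornerX hornerC; ring.
Qed.

(** The ratios [(E)_s / (S)_s] are the moments of the beta distribution for which
the Jacobi polynomials are orthogonal. Up to constants the sum is an [n]-th
finite difference: of a polynomial of degree less than [n] when [r < n], and of
such a polynomial plus a multiple of [1 / (s + S + n - 1)] when [r = n]. *)
Lemma beta_moment_sum n r E S : (forall s, E + s%:R != 0) -> (forall s, S + s%:R != 0) ->
  (r <= n)%N ->
  \sum_(s < n.+1) poch (- n%:R) s * poch (n%:R + S - 1) s / (s`!%:R * poch E s) *
    (poch E (s + r) / poch S (s + r)) =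
  (r == n)%:R * (poch (- n%:R) n * poch (S - E) n / poch S (n + n)).
Proof.
move=> E0 S0 rn.
have fn0 k : k`!%:R != 0 :> F by rewrite pnatr_eq0 -lt0n fact_gt0.
case: n rn => [|n] rn.
  move: rn; rewrite leqn0 => /eqP ->.
  by rewrite big_ord1 !poch0 !mulr1 !invr1 !mulr1.
pose c := S + n%:R.
have cS s : c + s%:R != 0 by rewrite /c -addrA -natrD.
have termE (s : 'I_n.+2) : poch (- n.+1%:R) s * poch (n.+1%:R + S - 1) s / (s`!%:R * poch E s) *
    (poch E (s + r) / poch S (s + r)) = (poch S n)^-1 *
    ((-1) ^+ s * 'C(n.+1, s)%:R * (poch (E + s%:R) r * (poch c s * poch S n / poch S (s + r)))).
  rewrite pochN -bin_ffact natrM [poch E (s + r)]pochD.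
  rewrite (_ : n.+1%:R + S - 1 = c); last by rewrite /c -natr1; ring.
  have := @poch_neq0 _ s E0; have := @poch_neq0 _ n S0; have := @poch_neq0 _ (s + r)%N S0; have := fn0 s.
  move=> h1 h2 h3 h4; field; rewrite h1 h2 h3 h4//.
rewrite (eq_bigr _ (fun s _ => termE s)) -mulr_sumr.
have pcS s : poch c s * poch S n = poch S (n + s) by rewrite pochD mulrC.
have [rn1|rn1] := eqVneq r n.+1; last first.
  have {}rn : (r <= n)%N by rewrite -ltnS ltn_neqAle rn1.
  rewrite mul0r (eq_bigr (fun s : 'I_n.+2 => (-1) ^+ s * 'C(n.+1, s)%:R *
      (poch_poly E r * poch_poly (S + r%:R) (n - r)).[s%:R])); last first.
    move=> s _; congr (_ * _); rewrite hornerM !horner_poch_poly; congr (_ * _).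
    rewrite pcS (_ : (n + s = s + r + (n - r))%N); last by lia.
    by rewrite pochD mulrAC divff ?mul1r ?poch_neq0// natrD -addrA [r%:R + _]addrC.
  rewrite finite_difference0 ?mulr0//.
  by rewrite (leq_trans (size_polyMleq _ _))// !size_poch_poly; lia.
rewrite mul1r rn1.
(* division of [(E + x)_(n+1)] by [x + c]: only the remainder contributes *)
have [q qE] : exists q, poch_poly E n.+1 = q * ('X + c%:P) + (poch (E - c) n.+1)%:P.
  have : root (poch_poly E n.+1 - (poch (E - c) n.+1)%:P) (- c).
    by rewrite /root !hornerE horner_poch_poly subrr.
  move=> /factor_theorem[q qE]; exists q; apply/eqP; rewrite -subr_eq qE.
  by rewrite polyCN opprK.
have sq : (size q <= n.+1)%N.
  have [->|q0] := eqVneq q 0; first by rewrite size_poly0.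
  have : size (q * ('X + c%:P)) = (size q).+1.
    by rewrite size_Mmonic ?monicXaddC// size_XaddC addn2.
  have -> : q * ('X + c%:P) = poch_poly E n.+1 - (poch (E - c) n.+1)%:P.
    by rewrite qE addrK.
  move=> sz; rewrite -ltnS -sz (leq_trans (size_polyD _ _))//.
  by rewrite size_poch_poly size_polyN geq_max leqnn/= (leq_trans (size_polyC_leq1 _)).
rewrite (eq_bigr (fun s : 'I_n.+2 => (-1) ^+ s * 'C(n.+1, s)%:R * q.[s%:R] +
    poch (E - c) n.+1 * ((-1) ^+ s * 'C(n.+1, s)%:R * (s%:R + c)^-1))); last first.
  move=> s _; have sc : s%:R + c != 0 by rewrite addrC cS.
  rewrite pcS [(s + n.+1)%N]addnS [poch S _.+1]pochSr.
  have -> : poch (E + s%:R) n.+1 = q.[s%:R] * (s%:R + c) + poch (E - c) n.+1.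
    by rewrite -horner_poch_poly qE !hornerE.
  rewrite [(s + n)%N]addnC -[S + (n + s)%:R](_ : s%:R + c = _); last first.
    by rewrite /c natrD; ring.
  by have := @poch_neq0 _ (n + s)%N S0 => h; field; rewrite sc h.
rewrite big_split/= finite_difference0// add0r -mulr_sumr alternating_bin_inv//.
rewrite -[poch (E - c) _](_ : poch (1 - (S - E) - n.+1%:R) n.+1 = _); last first.
  by congr poch; rewrite /c -natr1; ring.
rewrite poch_reflect pochN ffactnn.
rewrite (_ : (n.+1 + n.+1 = n + n.+2)%N); last by lia.
rewrite [poch S (n + _)]pochD -/c.
by have := @poch_neq0 _ n S0; have := @poch_neq0 _ n.+2 cS => h1 h2; field; rewrite h1 h2.
Qed.

(** [jcoef n E S s] is the coefficient of [x ^+ s] in the Jacobi polynomial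
2F1(-n, n + S - 1; E; x). *)
Definition jcoef n E S s : F :=
  poch (- n%:R) s * poch (n%:R + S - 1) s / (s`!%:R * poch E s).

(** By symmetry [m <= n], and then only the leading monomial [r = n] of the second
polynomial can have a nonzero moment against the first. *)
Lemma Jacobi_orthogonality n m E S :
  (forall s, E + s%:R != 0) -> (forall s, S + s%:R != 0) ->
  \sum_(s < n.+1) \sum_(r < m.+1) jcoef n E S s * jcoef m E S r *
    (poch E (s + r) / poch S (s + r)) =
  (n == m)%:R * (n`!%:R * poch (n%:R + S - 1) n * poch (S - E) n /
    (poch S (n + n) * poch E n)).
Proof.
move=> E0 S0.
wlog mn : n m / (m <= n)%N => [H|].
  have [mn|/ltnW nm] := leqP m n; first exact: H.
  rewrite exchange_big/= (eq_bigr (fun r : 'I_m.+1 => \sum_(s < n.+1)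
      jcoef m E S r * jcoef n E S s * (poch E (r + s) / poch S (r + s)))); last first.
    by move=> r _; apply: eq_bigr => s _; rewrite addnC [jcoef n _ _ _ * _]mulrC.
  by rewrite H// eq_sym; have [->|] := eqVneq n m; rewrite ?mul0r.
rewrite exchange_big/=.
rewrite (eq_bigr (fun r : 'I_m.+1 => jcoef m E S r *
    ((val r == n)%:R * (poch (- n%:R) n * poch (S - E) n / poch S (n + n))))); last first.
  move=> r _; rewrite -beta_moment_sum// ?mulr_sumr; last first.
    exact: leq_trans (leq_ord r) mn.
  by apply: eq_bigr => s _; rewrite [RHS]mulrA [jcoef n _ _ _ * _]mulrC.
have [nm|nm] := eqVneq n m; last first.
  rewrite mul0r big1// => r _; rewrite ltn_eqF ?mul0r ?mulr0//.
  by apply: leq_ltn_trans (leq_ord r) _; rewrite ltn_neqAle eq_sym nm.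
rewrite -nm big_ord_recr/= big1 ?add0r; last first.
  by move=> r _; rewrite ltn_eqF ?mul0r ?mulr0//= .
rewrite eqxx !mul1r /jcoef pochN ffactnn.
have fn0 : n`!%:R != 0 :> F by rewrite pnatr_eq0 -lt0n fact_gt0.
have := @poch_neq0 _ n E0; have := @poch_neq0 _ (n + n)%N S0 => h1 h2.
set e := (-1) ^+ n; have e2 : e * e = 1 by rewrite -expr2 sqrr_sign.
rewrite (_ : _ * _ / _ * _ = (e * e) * (n`!%:R * poch (n%:R + S - 1) n * poch (S - E) n /
    (poch S (n + n) * poch E n))); first by rewrite e2 mul1r.
by field; rewrite h1 h2 fn0.
Qed.

End FiniteDifference.

(** * Terminating hypergeometric series *)

Section TerminatingSeries.
Context {R : realType}.

Lemma limn_eventually (f : nat -> R[i]) N : (forall n, (N <= n)%N -> f n = f N) ->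
  limn (f : nat -> R[i]^o) = f N.
Proof.
move=> fN; apply: lim_near_cst; first exact: norm_hausdorff.
by exists N => // n /= Nn; rewrite fN.
Qed.

(** The partial sums are constant from rank [n + 1] on, because [(- n)_s = 0] for
[s > n]. *)
Lemma pFq_terminating n (a b : seq R[i]) :
  pFq (- n%:R :: a) b 1 = \sum_(s < n.+1)
    (poch (- n%:R) s * \prod_(u <- a) poch u s) / (\prod_(v <- b) poch v s) / s`!%:R.
Proof.
rewrite /pFq (@limn_eventually _ n.+1); last first.
  move=> N nN; rewrite (big_cat_nat (n := n.+1))//= [X in _ + X]big1_seq ?addr0//.
  move=> s /andP[_]; rewrite mem_index_iota => /andP[ns _].
  by rewrite big_cons pochN ffact_small// mulr0 !mul0r.
rewrite big_mkord; apply: eq_bigr => s _.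
by rewrite big_cons expr1n mul1r.
Qed.

(** The sum is arranged as a polynomial in [c], the only entry that carries the
variable of a continuous Hahn polynomial. *)
Lemma pFq32E n (b c d e : R[i]) :
  pFq [:: - n%:R; b; c] [:: d; e] 1 = \sum_(s < n.+1)
    poch (- n%:R) s * poch b s / (s`!%:R * poch d s * poch e s) * poch c s.
Proof.
rewrite pFq_terminating; apply: eq_bigr => s _.
rewrite !big_cons !big_nil !mulr1 mulrA -!mulrA; congr (_ * (_ * _)).
by rewrite mulrC [in RHS]invfM [_^-1 / _]mulrC.
Qed.

End TerminatingSeries.

(** * Complex integrals over product spaces *)

Section ComplexIntegral.
Context {R : realType} d (T : measurableType d) (mu : {measure set T -> \bar R}).
Implicit Types (f g : T -> R[i]).

Lemma CintegrableD f g : Cintegrable mu setT f -> Cintegrable mu setT g ->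
  Cintegrable mu setT (fun x => f x + g x).
Proof.
move=> [f1 f2] [g1 g2]; split.
  by apply: eq_integrable (integrableD measurableT f1 g1) => // x _ /=; case: (f x) (g x) => ? ? [].
by apply: eq_integrable (integrableD measurableT f2 g2) => // x _ /=; case: (f x) (g x) => ? ? [].
Qed.

Lemma CintegralD f g : Cintegrable mu setT f -> Cintegrable mu setT g ->
  Cintegral mu setT (fun x => f x + g x) = Cintegral mu setT f + Cintegral mu setT g.
Proof.
move=> [f1 f2] [g1 g2]; rewrite /Cintegral.
rewrite [RHS](_ : _ = (\int[mu]_x complex.Re (f x) + \int[mu]_x complex.Re (g x)) +i*
  (\int[mu]_x complex.Im (f x) + \int[mu]_x complex.Im (g x)))//.
rewrite -!RintegralD//; congr (_ +i* _);
  by apply: eq_Rintegral => x _; case: (f x) (g x) => ? ? [].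
Qed.

Lemma CintegrableZ (r : R) f : Cintegrable mu setT f ->
  Cintegrable mu setT (fun x => r%:C * f x).
Proof.
move=> [f1 f2]; split.
  apply: eq_integrable (integrableZl measurableT r f1) => // x _ /=.
  by case: (f x) => ? ?; rewrite /= mul0r subr0.
apply: eq_integrable (integrableZl measurableT r f2) => // x _ /=.
by case: (f x) => ? ?; rewrite /= mul0r addr0.
Qed.

Lemma CintegralZ (r : R) f : Cintegrable mu setT f ->
  Cintegral mu setT (fun x => r%:C * f x) = r%:C * Cintegral mu setT f.
Proof.
move=> [f1 f2]; rewrite /Cintegral.
rewrite [RHS](_ : _ = (r * \int[mu]_x complex.Re (f x)) +i* (r * \int[mu]_x complex.Im (f x))).
  by rewrite -!RintegralZl//; congr (_ +i* _); apply: eq_Rintegral => x _;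
    case: (f x) => ? ?; rewrite /= mul0r ?subr0 ?addr0.
by congr (_ +i* _); rewrite /= !mul0r ?subr0 ?addr0.
Qed.

Lemma Cintegrable_Cintegral_sum (I : Type) (s : seq I) (F : I -> T -> R[i]) :
  (forall i, Cintegrable mu setT (F i)) ->
  Cintegrable mu setT (fun x => \sum_(i <- s) F i x) /\
  Cintegral mu setT (fun x => \sum_(i <- s) F i x) = \sum_(i <- s) Cintegral mu setT (F i).
Proof.
move=> Fi; elim: s => [|i s [IH1 IH2]].
  rewrite (_ : (fun x => _) = (fun=> 0)); last by apply/funext => x; rewrite big_nil.
  rewrite big_nil; split; last by rewrite /Cintegral/= Rintegral_cst// mul0r.
  by split; exact: integrable0.
rewrite (_ : (fun x => _) = (fun x => F i x + \sum_(j <- s) F j x)); last first.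
  by apply/funext => x; rewrite big_cons.
by rewrite big_cons CintegralD// IH2; split => //; exact: CintegrableD.
Qed.

End ComplexIntegral.

Section ProductMeasure.
Context {R : realType} d1 d2 (T1 : measurableType d1) (T2 : measurableType d2).
Variables (m1 : {sigma_finite_measure set T1 -> \bar R}).
Variables (m2 : {sigma_finite_measure set T2 -> \bar R}).

Lemma integrable_tensor (f : T1 -> R) (g : T2 -> R) :
  m1.-integrable setT (EFin \o f) -> m2.-integrable setT (EFin \o g) ->
  (m1 \x m2)%E.-integrable setT (EFin \o (fun z => f z.1 * g z.2)).
Proof.
move=> fi gi; have mf := measurable_int _ fi; have mg := measurable_int _ gi.
move/measurable_EFinP : (mf) => mf'; move/measurable_EFinP : (mg) => mg'.
have mF : measurable_fun setT (EFin \o (fun z : T1 * T2 => f z.1 * g z.2)).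
  apply/measurable_EFinP; apply: measurable_funM.
    exact: (measurableT_comp mf' measurable_fst).
  exact: (measurableT_comp mg' measurable_snd).
apply: (iffRL (@integrable12ltyP _ _ T1 T2 R m1 m2 _ mF)).
rewrite (eq_integral (fun x => `|(EFin \o f) x| * \int[m2]_y `|(EFin \o g) y|)%E); last first.
  move=> x _; rewrite -ge0_integralZl//; last exact: measurableT_comp.
  by apply: eq_integral => y _; rewrite /= -EFinM normrM.
rewrite ge0_integralZr//; last 2 first.
- exact: measurableT_comp.
- exact: integral_ge0.
have /integrableP[_ f1] := fi; have /integrableP[_ g1] := gi.
have f2 : (0 <= \int[m1]_x `|(EFin \o f) x|)%E by exact: integral_ge0.
have g2 : (0 <= \int[m2]_x `|(EFin \o g) x|)%E by exact: integral_ge0.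
have f3 : (\int[m1]_x `|(EFin \o f) x|)%E \is a fin_num by rewrite ge0_fin_numE.
have g3 : (\int[m2]_x `|(EFin \o g) x|)%E \is a fin_num by rewrite ge0_fin_numE.
by rewrite -(fineK f3) -(fineK g3) -EFinM ltry.
Qed.

Lemma Rintegral_tensor (f : T1 -> R) (g : T2 -> R) :
  m1.-integrable setT (EFin \o f) -> m2.-integrable setT (EFin \o g) ->
  \int[(m1 \x m2)%E]_z (f z.1 * g z.2) = \int[m1]_x f x * \int[m2]_y g y.
Proof.
move=> fi gi; rewrite /Rintegral -fineM; last 2 first.
- exact: integrable_fin_num.
- exact: integrable_fin_num.
congr fine; rewrite -(integral12_prod_meas1 (integrable_tensor fi gi)) /fubini_F /=.
have gf : (\int[m2]_y (g y)%:E)%E \is a fin_num by exact: integrable_fin_num.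
under eq_integral do (under eq_integral do rewrite EFinM); rewrite -(fineK gf).
under eq_integral => x _ do rewrite integralZl// -(fineK gf).
by rewrite integralZr.
Qed.

Lemma Cintegral_tensor (f : T1 -> R[i]) (g : T2 -> R[i]) :
  Cintegrable m1 setT f -> Cintegrable m2 setT g ->
  Cintegrable (m1 \x m2)%E setT (fun z => f z.1 * g z.2) /\
  Cintegral (m1 \x m2)%E setT (fun z => f z.1 * g z.2) =
    Cintegral m1 setT f * Cintegral m2 setT g.
Proof.
move=> [f1 f2] [g1 g2].
have ReE z : complex.Re (f z.1 * g z.2) =
    complex.Re (f z.1) * complex.Re (g z.2) - complex.Im (f z.1) * complex.Im (g z.2).
  by case: (f z.1) (g z.2) => ? ? [].
have ImE z : complex.Im (f z.1 * g z.2) =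
    complex.Re (f z.1) * complex.Im (g z.2) + complex.Im (f z.1) * complex.Re (g z.2).
  by case: (f z.1) (g z.2) => ? ? [].
have i11 := integrable_tensor f1 g1; have i12 := integrable_tensor f1 g2.
have i21 := integrable_tensor f2 g1; have i22 := integrable_tensor f2 g2.
split; first split.
- by apply: eq_integrable (integrableB measurableT i11 i22) => // z _ /=; rewrite ReE EFinB.
- by apply: eq_integrable (integrableD measurableT i12 i21) => // z _ /=; rewrite ImE EFinD.
rewrite /Cintegral (eq_Rintegral _ (fun z _ => ReE z)) (eq_Rintegral _ (fun z _ => ImE z)).
rewrite RintegralB// RintegralD//.
have tens := @Rintegral_tensor.
by rewrite (tens _ _ f1 g1) (tens _ _ f1 g2) (tens _ _ f2 g1) (tens _ _ f2 g2).
Qed.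

End ProductMeasure.

Section TupleIntegral.
Context {R : realType}.
Notation RR := (measurableTypeR R).
Let mu : {sigma_finite_measure set RR -> \bar R} := @lebesgue_measure R.

Lemma Cintegral_cons n (g : n.+1.-tuple RR -> R[i]) :
  Cintegrable (mu \x lebesgue_tuple n)%E setT (g \o (@consR R n)) ->
  Cintegrable (lebesgue_tuple n.+1) setT g /\
  Cintegral (lebesgue_tuple n.+1) setT g =
    Cintegral (mu \x lebesgue_tuple n)%E setT (g \o (@consR R n)).
Proof.
move=> [g1 g2].
have mg (h : R[i] -> R) : (mu \x lebesgue_tuple n)%E.-integrable setT
    (EFin \o (fun z => h (g (consR z)))) -> measurable_fun setT (EFin \o (h \o g)).
  move=> hi; have := measurableT_comp (measurable_int _ hi) (@measurable_unconsR R n).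
  apply: eq_measurable_fun => v _; rewrite /= unconsRK//.
have m1 := mg _ g1; have m2 := mg _ g2; have mc := @measurable_consR R n.
have i1 := integrable_pushforward mc m1 g1 measurableT.
have i2 := integrable_pushforward mc m2 g2 measurableT.
split; first by split.
rewrite /Cintegral /Rintegral; congr (_ +i* _); congr fine.
  exact: (integral_pushforward mc m1 g1 measurableT).
exact: (integral_pushforward mc m2 g2 measurableT).
Qed.

(** The measure on tuples is an iterated product, so a product of functions of the
separate coordinates integrates factor by factor. *)
Lemma Cintegral_tuple n (f : 'I_n -> R -> R[i]) :
  (forall i, Cintegrable mu setT (f i)) ->
  Cintegrable (lebesgue_tuple n) setT (fun v => \prod_(i < n) f i (tnth v i)) /\
  Cintegral (lebesgue_tuple n) setT (fun v => \prod_(i < n) f i (tnth v i)) =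
    \prod_(i < n) Cintegral mu setT (f i).
Proof.
elim: n f => [|n IH] f fi.
  rewrite (_ : (fun v => _) = (fun=> 1)); last by apply/funext => v; rewrite big_ord0.
  have T0 : (lebesgue_tuple 0 setT = 1 :> \bar R)%E by rewrite /= diracE in_setT.
  rewrite big_ord0; split; last first.
    rewrite /Cintegral; congr (_ +i* _).
      transitivity (1 * fine (lebesgue_tuple 0 setT) : R); last by rewrite T0 mulr1.
      exact: Rintegral_cst.
    transitivity (0 * fine (lebesgue_tuple 0 setT) : R); last by rewrite mul0r.
    exact: Rintegral_cst.
  split; last exact: integrable0.
  apply/integrableP; split; first exact: measurable_cst.
  rewrite (eq_integral (cst 1%E)); last by move=> v _; rewrite /= normr1.
  apply: (@le_lt_trans _ _ (1 * lebesgue_tuple 0 setT)%E); first by rewrite integral_cst.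
  by rewrite T0 mul1e ltry.
have [IH1 IH2] := IH (fun i => f (lift ord0 i)) (fun i => fi _).
have [T1 T2] := Cintegral_tensor (fi ord0) IH1.
have E : (fun v : n.+1.-tuple RR => \prod_(i < n.+1) f i (tnth v i)) \o (@consR R n) =
    (fun z => f ord0 z.1 * \prod_(i < n) f (lift ord0 i) (tnth z.2 i)).
  apply/funext => -[x v] /=; rewrite big_ord_recl; congr (_ * _).
  by apply: eq_bigr => i _; congr (f _ _); rewrite !(tnth_nth 0).
have [|C1 C2] := @Cintegral_cons n (fun v => \prod_(i < n.+1) f i (tnth v i)); first by rewrite E.
by split => //; rewrite C2 E T2 IH2 big_ord_recl.
Qed.

End TupleIntegral.

(* And so is [rgam]. *)
Opaque rgam.

(** * Orthogonality of continuous Hahn polynomials *)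

Section HahnOrthogonality.
Context {R : realType}.
Notation RR := (measurableTypeR R).
Let mu : {sigma_finite_measure set RR -> \bar R} := @lebesgue_measure R.
Implicit Types (a b c d x y E S : R).

Lemma Gm_shift a y n : 0 < a -> Gm (a + n%:R) y = poch (a +i* y) n * Gm a y.
Proof.
move=> a0; elim: n => [|n IH]; first by rewrite addr0 poch0 mul1r.
have an0 : 0 < a + n%:R by rewrite ltr_wpDr.
rewrite -natr1 addrA (GmS _ an0) IH pochSr mulrA [poch _ _ * _]mulrC; congr (_ * _ * _).
by rewrite -(rmorph_nat (real_complex R)); apply/eqP; rewrite eq_complex/= addr0 !eqxx.
Qed.

Lemma rgam_shift a n : 0 < a -> rgam (a + n%:R) = poch a n * rgam a.
Proof.
move=> a0; elim: n => [|n IH]; first by rewrite addr0 poch0 mul1r.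
have an0 : 0 < a + n%:R by rewrite ltr_wpDr.
by rewrite -natr1 addrA (rgamS an0) IH pochSr mulrA [poch _ _ * _]mulrC.
Qed.

Lemma poch_gt0 a n : 0 < a -> 0 < poch a n.
Proof. by move=> a0; apply: prodr_gt0 => i _; rewrite ltr_wpDr. Qed.

(** The Pochhammer symbols of a Hahn polynomial on the line are absorbed in the Gamma
factors, and each monomial becomes a Barnes integrand with shifted parameters. *)
Lemma barnes_shift a b c d y s r : 0 < a -> 0 < c ->
  barnes_integrand (a + s%:R) b (c + r%:R) d y =
  poch (a +i* y) s * poch (c -i* y) r * barnes_integrand a b c d y.
Proof.
move=> a0 c0; rewrite /barnes_integrand (Gm_shift _ _ a0) (Gm_shift _ _ c0).
by move: (Gm a y) (Gm b y) (Gm c _) (Gm d _) => ? ? ? ?; ring.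
Qed.

Definition barnes_value a b c d : R :=
  2 * pi * (rgam (a + c) * rgam (a + d) * rgam (b + c) * rgam (b + d)) /
  rgam (a + b + c + d).

Lemma Cintegral_barnes a b c d : 0 < a -> 0 < b -> 0 < c -> 0 < d ->
  Cintegrable mu setT (fun x => barnes_integrand a b c d (x / 2)) /\
  Cintegral mu setT (fun x => barnes_integrand a b c d (x / 2)) =
  (2 * barnes_value a b c d)%:C.
Proof.
move=> a0 b0 c0 d0.
have [iR iI] := integrable_barnes a0 b0 c0 d0.
have [cR cI] := continuous_barnes a0 b0 c0 d0.
have H (f : R -> R) : continuous f -> mu.-integrable setT (EFin \o f) ->
    mu.-integrable setT (EFin \o (fun x => f (x / 2))) /\
    \int[mu]_x f (x / 2) = 2 * \int[mu]_x f x.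
  move=> cf fi; have dphi x : is_derive x (1 : R) (fun x => x / 2) 2^-1.
    apply: (der_eq (derM (der_id x) (der_cst 2^-1 x))).
    by rewrite mulr0 add0r mulr1.
  have Hs (g : R -> R) : continuous g ->
      (\int[mu]_x (g x)%:E = \int[mu]_x (g (x / 2) * 2^-1)%:E)%E.
    move=> cg; have := integral_substitution dphi (@cont_cst _ _) _ (fun x => cg _).
    rewrite (_ : [set x / 2 | x in setT] = setT); first by apply; rewrite invr_gt0.
    by apply/seteqP; split=> // y _; exists (2 * y) => //; rewrite mulrC mulKf.
  have cf2 : continuous (fun x => f (x / 2)) by cont.
  have fi2 : mu.-integrable setT (EFin \o (fun x => f (x / 2) * 2^-1)).
    have cf3 : continuous (fun x => f (x / 2) * 2^-1) by cont.
    apply/integrableP; split.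
      by apply/measurable_EFinP; exact: continuous_measurable_fun.
    have cn : continuous (fun x => `|f x|) by cont.
    case/integrableP : fi => _ /=; rewrite (Hs _ cn); apply: le_lt_trans.
    rewrite le_eqVlt; apply/orP; left; apply/eqP; apply: eq_integral => x _ /=.
    by rewrite normrM [`|2^-1|]ger0_norm ?invr_ge0.
  have fi3 : mu.-integrable setT (EFin \o (fun x => f (x / 2))).
    apply: eq_integrable (integrableZ 2 fi2) => // x _ /=.
    by rewrite mulrCA divff// mulr1.
  split => //; rewrite {2}/Rintegral Hs// -/(Rintegral _ _ _) RintegralZr// mulrC divfK//.
have [iR2 eR] := H _ cR iR; have [iI2 eI] := H _ cI iI.
split; first by split.
rewrite /Cintegral eR eI Rintegral_barnes_Re// Rintegral_barnes_Im//.
by rewrite mulr0.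
Qed.

Section linear_combination.
Variables (a b c d : R) (u v : nat -> R) (n m : nat).
Hypotheses (a0 : 0 < a) (b0 : 0 < b) (c0 : 0 < c) (d0 : 0 < d).

Let f x : R[i] := barnes_integrand a b c d (x / 2) *
  (\sum_(s < n.+1) (u s)%:C * poch (a +i* (x / 2)) s) *
  (\sum_(r < m.+1) (v r)%:C * poch (c -i* (x / 2)) r).

Let F (i : 'I_n.+1 * 'I_m.+1) x : R[i] := (u i.1 * v i.2)%:C *
  barnes_integrand (a + (i.1 : nat)%:R) b (c + (i.2 : nat)%:R) d (x / 2).

Let FE : f = (fun x => \sum_i F i x).
Proof.
apply/funext => x; rewrite /f -mulrA big_distrlr/= pair_bigA/= mulr_sumr.
apply: eq_bigr => -[s r] _; rewrite /F /= barnes_shift// rmorphM/=.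
by ring.
Qed.

Let F_prop i : Cintegrable mu setT (F i) /\ Cintegral mu setT (F i) =
  (u i.1 * v i.2 * (2 * barnes_value (a + (i.1 : nat)%:R) b (c + (i.2 : nat)%:R) d))%:C.
Proof.
have [|||| I1 I2] := @Cintegral_barnes (a + (i.1 : nat)%:R) b (c + (i.2 : nat)%:R) d => //.
- by rewrite ltr_wpDr.
- by rewrite ltr_wpDr.
split; first exact: CintegrableZ.
by rewrite CintegralZ// I2 -rmorphM.
Qed.

Lemma Cintegrable_barnes_poly : Cintegrable mu setT f.
Proof.
rewrite FE.
by case: (Cintegrable_Cintegral_sum (index_enum _) (fun i => (F_prop i).1)).
Qed.

Lemma Cintegral_barnes_poly : Cintegral mu setT f = (2 * barnes_value a b c d *
  \sum_(s < n.+1) \sum_(r < m.+1) u s * v r * (poch (a + c) (s + r) /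
    poch (a + b + c + d) (s + r) * poch (a + d) s * poch (b + c) r))%:C.
Proof.
rewrite FE; have [_ ->] := Cintegrable_Cintegral_sum (index_enum _) (fun i => (F_prop i).1).
rewrite pair_bigA/= mulr_sumr rmorph_sum/=; apply: eq_bigr => -[s r] _.
rewrite (F_prop _).2 /=; congr (_%:C); rewrite /barnes_value.
rewrite (_ : a + s%:R + (c + r%:R) = a + c + (s + r)%:R); last by rewrite natrD; ring.
rewrite (_ : a + s%:R + d = a + d + s%:R); last by ring.
rewrite (_ : b + (c + r%:R) = b + c + r%:R); last by ring.
rewrite (_ : a + s%:R + b + (c + r%:R) + d = a + b + c + d + (s + r)%:R); last first.
  by rewrite natrD; ring.
have S0 : 0 < a + b + c + d by rewrite !addr_gt0.
rewrite !rgam_shift ?addr_gt0//.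
have := poch_gt0 (s + r) S0; have := rgam_gt0 S0.
move: (rgam (a + c)) (rgam (a + d)) (rgam (b + c)) (rgam (b + d)).
move: (rgam (a + b + c + d)) (poch (a + b + c + d) (s + r)) => g p.
move: (poch (a + c) (s + r)) (poch (a + d) s) (poch (b + c) r) (u s) (v r).
by move=> ? ? ? ? ? ? ? ? ? g0 p0; field; rewrite !gt_eqF.
Qed.

End linear_combination.

(** The hypergeometric factor of a continuous Hahn polynomial, as the Jacobi
polynomial with coefficients [jcoef n E S] in which [(z)_s / (A)_s] replaces
[x ^+ s]. *)
Definition hahn_poly n E S A (z : R[i]) : R[i] :=
  \sum_(s < n.+1) (jcoef n E S s / poch A s)%:C * poch z s.

Lemma pFq_hahn n E S A z : pFq [:: - n%:R; (n%:R + S - 1)%:C; z] [:: E%:C; A%:C] 1 =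
  hahn_poly n E S A z.
Proof.
rewrite pFq32E; apply: eq_bigr => s _; congr (_ * _).
rewrite /jcoef !rmorphM/= !fmorphV/= !rmorphM/= !poch_rmorph/= rmorph_nat rmorphN rmorph_nat.
by rewrite [in LHS]invfM mulrA.
Qed.

(** The squared norm of the continuous Hahn polynomials, for the normalisation
[hahn_poly]. *)
Definition hahn_norm n a b c d : R :=
  2 * barnes_value a b c d * (n`!%:R * poch (n%:R + (a + b + c + d) - 1) n * poch (b + d) n /
    (poch (a + b + c + d) (n + n) * poch (a + c) n)).

(** The first polynomial is expanded in the symbols [(a + iy)_s] and the second in
[(c - iy)_r]. By Barnes' lemma the integral of [(a + iy)_s (c - iy)_r] contains
[(a + d)_s (b + c)_r], which cancels the lower parameters [A] of the two
polynomials, times the beta moment of order [s + r]: what is left is Jacobi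
orthogonality. *)
Lemma Cintegral_hahn n m a b c d : 0 < a -> 0 < b -> 0 < c -> 0 < d ->
  Cintegral mu setT (fun x => barnes_integrand a b c d (x / 2) *
    hahn_poly n (a + c) (a + b + c + d) (a + d) (a +i* (x / 2)) *
    hahn_poly m (a + c) (a + b + c + d) (b + c) (c -i* (x / 2))) =
  ((n == m)%:R * hahn_norm n a b c d)%:C.
Proof.
move=> a0 b0 c0 d0; set S := a + b + c + d.
have S0 : 0 < S by rewrite !addr_gt0.
rewrite (Cintegral_barnes_poly (fun s => jcoef n (a + c) S s / poch (a + d) s)
  (fun s => jcoef m (a + c) S s / poch (b + c) s))//.
congr (_%:C); rewrite /hahn_norm -/S [RHS]mulrCA; congr (_ * _).
have -> : b + d = S - (a + c) by rewrite /S; ring.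
rewrite -Jacobi_orthogonality; last 2 first.
- by move=> s; rewrite gt_eqF// ltr_wpDr// addr_gt0.
- by move=> s; rewrite gt_eqF// ltr_wpDr.
apply: eq_bigr => s _; apply: eq_bigr => r _.
have := poch_gt0 s (addr_gt0 a0 d0); have := poch_gt0 r (addr_gt0 b0 c0).
have := poch_gt0 (s + r) S0; move: (poch S (s + r)) (poch (a + d) s) (poch (b + c) r).
move: (jcoef n _ _ _) (jcoef m _ _ _) (poch (a + c) _) => ? ? ? p q r' p0 q0 r0.
by field; rewrite !gt_eqF.
Qed.

Lemma half_real x : x%:C / 2 = (x / 2)%:C :> R[i].
Proof. by rewrite rmorphM fmorphV rmorph_nat. Qed.

Lemma line_arg a x : a%:C + 'i * x%:C / 2 = a +i* (x / 2).
Proof. by rewrite -mulrA half_real [RHS]complexE. Qed.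

Lemma line_argN a x : a%:C - 'i * x%:C / 2 = a -i* (x / 2).
Proof. by rewrite -mulrA half_real [RHS]complexE/= rmorphN mulrN. Qed.

End HahnOrthogonality.

(** * Separation of variables in the integrand *)

Section Factorization.
Context {R : realType}.
Notation RR := (measurableTypeR R).
Let mu : {sigma_finite_measure set RR -> \bar R} := @lebesgue_measure R.
Variables (d : nat).
Implicit Types (a b c e x y : R) (k l : 'I_d -> nat).

Lemma tail_ge k i : (d <= i)%N -> tail k i = 0%N.
Proof.
move=> di; rewrite /tail big_pred0// => j; apply/negbTE; rewrite -ltnNge.
exact: leq_trans (ltn_ord j) di.
Qed.

Lemma tailS k (j : 'I_d) : tail k j = (k j + tail k j.+1)%N.
Proof.
rewrite /tail (bigD1 j)//=; congr (_ + _)%N.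
by apply: eq_bigl => i; rewrite ltn_neqAle eq_sym andbC.
Qed.

(** The parameter alpha_j of the continuous Hahn polynomial in [x_j] (alpha'_j when
[a] is [a2]). *)
Definition hahn_param k a (j : 'I_d) : R :=
  a + (tail k j.+1)%:R / 2 + (d - j.+1)%:R / 4.

Lemma hahn_param_gt0 k a (j : 'I_d) : 0 < a -> 0 < hahn_param k a j.
Proof. by move=> a0; rewrite /hahn_param !ltr_wpDr// divr_ge0. Qed.

(** The factor of the integrand that depends on [x_j]; for [tail k j.+1 = tail l j.+1]
it is a Barnes weight times two continuous Hahn polynomials for that weight. *)
Definition x_factor k l a1 a2 (j : 'I_d) x : R[i] :=
  let a := hahn_param k a1 j in let b := hahn_param l a2 j in
  barnes_integrand a b b a (x / 2) *
  hahn_poly (k j) (a + hahn_param k a2 j) (2 * (a + hahn_param k a2 j)) (a + a) (a +i* (x / 2)) *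
  hahn_poly (l j) (hahn_param l a1 j + b) (2 * (hahn_param l a1 j + b)) (b + b) (b -i* (x / 2)).

(** The factor that depends on [t]. The symbols [(b1 - it/2)_|k|] and
[(b2 + it/2)_|l|] have been absorbed in the Gamma factors. *)
Definition t_factor n k m l b1 b2 c1 c2 x : R[i] :=
  let K : R := (tail k 0)%:R in let L : R := (tail l 0)%:R in
  barnes_integrand (L + b2) c1 (K + b1) c2 (x / 2) *
  hahn_poly (m - tail l 0) (2 * L + (b1 + b2)) (2 * L + (b1 + b2) + (c1 + c2)) (L + b2 + c2)
    ((L + b2) +i* (x / 2)) *
  hahn_poly (n - tail k 0) (2 * K + (b1 + b2)) (2 * K + (b1 + b2) + (c1 + c2)) (K + b1 + c1)
    ((K + b1) -i* (x / 2)).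

Lemma addc_real (r a b : R) : r%:C + (a +i* b) = (r + a) +i* b :> R[i].
Proof. by apply/eqP; rewrite eq_complex/= add0r !eqxx. Qed.

Lemma x_arg k a (j : 'I_d) x :
  a%:C + ((tail k j.+1)%:R + 'i * x%:C) / 2 + (d - j.+1)%:R / 4 =
    hahn_param k a j +i* (x / 2) /\
  a%:C + ((tail k j.+1)%:R - 'i * x%:C) / 2 + (d - j.+1)%:R / 4 =
    hahn_param k a j -i* (x / 2).
Proof.
have -> : hahn_param k a j +i* (x / 2) = (hahn_param k a j)%:C + 'i * x%:C / 2.
  by rewrite line_arg.
have -> : hahn_param k a j -i* (x / 2) = (hahn_param k a j)%:C - 'i * x%:C / 2.
  by rewrite line_argN.
rewrite /hahn_param !rmorphD/= !rmorphM/= !fmorphV/= !rmorph_nat.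
by split; rewrite ?mulrDl ?mulrBl; ring.
Qed.

Lemma barnes_Cgamma a b c e x : 0 < a -> 0 < b -> 0 < c -> 0 < e ->
  Cgamma (a +i* x) * Cgamma (b +i* x) * (Cgamma (c -i* x) * Cgamma (e -i* x)) =
  barnes_integrand a b c e x.
Proof. by move=> a0 b0 c0 e0; rewrite !CgammaE. Qed.

Lemma x_pFq k a1 a2 (j : 'I_d) (z : R[i]) :
  let s : R[i] := (tail k j.+1)%:R in
  let e : R[i] := (d - j.+1)%N%:R in
  pFq [:: - (k j)%:R; (k j)%:R + 2 * (s + (a1 + a2)%:C + (e - 1) / 2); z]
      [:: s + (a1 + a2)%:C + e / 2; s + 2 * a1%:C + e / 2] 1 =
  hahn_poly (k j) (hahn_param k a1 j + hahn_param k a2 j)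
    (2 * (hahn_param k a1 j + hahn_param k a2 j)) (hahn_param k a1 j + hahn_param k a1 j) z.
Proof.
move=> s e; rewrite -pFq_hahn.
set al := hahn_param k a1 j; set al' := hahn_param k a2 j.
have e1 : ((k j)%:R + 2 * (al + al') - 1)%:C =
    (k j)%:R + 2 * (s + (a1 + a2)%:C + (e - 1) / 2).
  rewrite /al /al' /hahn_param.
  rewrite !(rmorphD, rmorphM, rmorphB, fmorphV, rmorph_nat, rmorph1)/= -/s -/e.
  by field.
have e2 : (al + al')%:C = s + (a1 + a2)%:C + e / 2.
  rewrite /al /al' /hahn_param.
  rewrite !(rmorphD, rmorphM, rmorphB, fmorphV, rmorph_nat, rmorph1)/= -/s -/e.
  by field.
have e3 : (al + al)%:C = s + 2 * a1%:C + e / 2.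
  rewrite /al /hahn_param.
  rewrite !(rmorphD, rmorphM, rmorphB, fmorphV, rmorph_nat, rmorph1)/= -/s -/e.
  by field.
by rewrite e1 e2 e3.
Qed.

Lemma t_pFq n k b1 b2 c1 c2 (z : R[i]) : (tail k 0 <= n)%N ->
  let K : R[i] := (tail k 0)%:R in
  pFq [:: - n%:R + K; n%:R + K + (b1 + b2)%:C + (c1 + c2)%:C - 1; z]
      [:: 2 * K + (b1 + b2)%:C; K + b1%:C + c1%:C] 1 =
  hahn_poly (n - tail k 0) (2 * (tail k 0)%:R + (b1 + b2))
    (2 * (tail k 0)%:R + (b1 + b2) + (c1 + c2)) ((tail k 0)%:R + b1 + c1) z.
Proof.
move=> kn K; rewrite -pFq_hahn; set p := (n - tail k 0)%N.
have e0 : - p%:R = - n%:R + K by rewrite /p natrB// opprB addrC.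
have e1 : (p%:R + (2 * (tail k 0)%:R + (b1 + b2) + (c1 + c2)) - 1)%:C =
    n%:R + K + (b1 + b2)%:C + (c1 + c2)%:C - 1.
  by rewrite /p natrB// !(rmorphD, rmorphM, rmorphB, rmorph_nat, rmorph1)/= -/K; ring.
have e2 : (2 * (tail k 0)%:R + (b1 + b2))%:C = 2 * K + (b1 + b2)%:C.
  by rewrite !(rmorphD, rmorphM, rmorph_nat).
have e3 : ((tail k 0)%:R + b1 + c1)%:C = K + b1%:C + c1%:C.
  by rewrite !(rmorphD, rmorph_nat).
by rewrite e0 e1 e2 e3.
Qed.

(** The factor of [Bfun] in the variable [x_j]. *)
Definition hahn_weight k a b (j : 'I_d) x : R[i] :=
  let al := hahn_param k a j in
  Cgamma (al -i* (x / 2)) * Cgamma (al +i* (x / 2)) *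
  hahn_poly (k j) (al + hahn_param k b j) (2 * (al + hahn_param k b j)) (al + al)
    (al +i* (x / 2)).

Lemma Bfun_line n k a1 a2 b1 b2 c1 c2 y (x : 'I_d -> R) : (tail k 0 <= n)%N ->
  let K : R := (tail k 0)%:R in
  Bfun n k a1 a2 b1 b2 c1 c2 ('i * y%:C) (fun j => 'i * (x j)%:C) =
  hahn_poly (n - tail k 0) (2 * K + (b1 + b2)) (2 * K + (b1 + b2) + (c1 + c2)) (K + b1 + c1)
    ((K + b1) -i* (y / 2)) * poch (b1 -i* (y / 2)) (tail k 0) *
  \prod_(j < d) hahn_weight k a1 a2 j (x j).
Proof.
move=> kn K; rewrite /Bfun t_pFq// line_argN; congr (hahn_poly _ _ _ _ _ * _ * _).
  by rewrite -addrA line_argN -(rmorph_nat (real_complex R)) addc_real.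
apply: eq_bigr => j _; have [e1 e2] := x_arg k a1 j (x j).
by rewrite x_pFq e1 e2.
Qed.

Lemma integrand_factor n k m l a1 a2 b1 b2 c1 c2 (v : d.+1.-tuple RR) :
  0 < a1 -> 0 < a2 -> 0 < b1 -> 0 < b2 -> 0 < c1 -> 0 < c2 ->
  (tail k 0 <= n)%N -> (tail l 0 <= m)%N ->
  integrand n k m l a1 a2 b1 b2 c1 c2 v =
  t_factor n k m l b1 b2 c1 c2 (tnth v ord0) *
  \prod_(j < d) x_factor k l a1 a2 j (tnth v (lift ord0 j)).
Proof.
move=> a1_0 a2_0 b1_0 b2_0 c1_0 c2_0 kn lm; rewrite /integrand.
set t := tnth v ord0.
have minus x : - ('i * x%:C) = 'i * (- x)%:C :> R[i] by rewrite rmorphN mulrN.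
have -> : Bfun m l a2 a1 b2 b1 c2 c1 (- ('i * t%:C))
     (fun j => - ('i * (tnth v (lift ord0 j))%:C)) =
   Bfun m l a2 a1 b2 b1 c2 c1 ('i * (- t)%:C)
     (fun j => 'i * (- tnth v (lift ord0 j))%:C).
  by rewrite minus; congr (Bfun _ _ _ _ _ _ _ _ _ _); apply/funext => j; rewrite minus.
rewrite !Bfun_line// !(line_arg, line_argN).
have -> : \prod_(j < d) x_factor k l a1 a2 j (tnth v (lift ord0 j)) =
  (\prod_(j < d) hahn_weight k a1 a2 j (tnth v (lift ord0 j))) *
  (\prod_(j < d) hahn_weight l a2 a1 j (- tnth v (lift ord0 j))).
  rewrite -big_split/=; apply: eq_bigr => j _; rewrite /x_factor /hahn_weight mulNr opprK.
  have p1 := hahn_param_gt0 k j a1_0; have p2 := hahn_param_gt0 l j a2_0.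
  rewrite -(barnes_Cgamma _ p1 p2 p2 p1) [hahn_param l a2 j + hahn_param l a1 j]addrC.
  move: (hahn_poly (k j) _ _ _ _) (hahn_poly (l j) _ _ _ _) => P Q.
  move: (Cgamma _) (Cgamma _) (Cgamma _) (Cgamma _) => ? ? ? ?; ring.
rewrite /t_factor mulNr opprK.
have K0 (q : nat) b : 0 < b -> 0 < q%:R + b by move=> b0; rewrite ltr_wpDl.
rewrite -(barnes_Cgamma _ (K0 _ _ b2_0) c1_0 (K0 _ _ b1_0) c2_0).
have shift (q : nat) b (y : R) : 0 < b ->
    Cgamma ((q%:R + b) +i* y) = poch (b +i* y) q * Cgamma (b +i* y).
  by move=> b0; rewrite (CgammaE _ (K0 q b b0)) (CgammaE _ b0) addrC Gm_shift.
rewrite !shift// [b2 + b1]addrC [c2 + c1]addrC.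
move: (hahn_poly (n - _) _ _ _ _) (hahn_poly (m - _) _ _ _ _) => P Q.
move: (poch _ _) (poch _ _) (\prod_(j < d) _) (\prod_(j < d) _) => ? ? ? ?.
move: (Cgamma _) (Cgamma _) (Cgamma _) (Cgamma _) => ? ? ? ?; ring.
Qed.

Lemma Cintegrable_x_factor k l a1 a2 (j : 'I_d) : 0 < a1 -> 0 < a2 ->
  Cintegrable mu setT (x_factor k l a1 a2 j).
Proof.
move=> a1_0 a2_0; have p1 := hahn_param_gt0 k j a1_0; have p2 := hahn_param_gt0 l j a2_0.
exact: (Cintegrable_barnes_poly (fun s => _ / _) (fun s => _ / _)).
Qed.

Lemma Cintegrable_t_factor n k m l b1 b2 c1 c2 : 0 < b1 -> 0 < b2 -> 0 < c1 -> 0 < c2 ->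
  Cintegrable mu setT (t_factor n k m l b1 b2 c1 c2).
Proof.
move=> b1_0 b2_0 c1_0 c2_0; rewrite /t_factor.
by apply: (Cintegrable_barnes_poly (fun s => _ / _) (fun s => _ / _)); rewrite // ltr_wpDl.
Qed.

Lemma Cintegral_x_factor k l a1 a2 (j : 'I_d) : 0 < a1 -> 0 < a2 ->
  tail k j.+1 = tail l j.+1 ->
  let al := hahn_param k a1 j in let al' := hahn_param k a2 j in
  Cintegral mu setT (x_factor k l a1 a2 j) =
  ((k j == l j)%:R * hahn_norm (k j) al al' al' al)%:C.
Proof.
move=> a1_0 a2_0 kl al al'.
have p1 := hahn_param_gt0 k j a1_0; have p2 := hahn_param_gt0 k j a2_0.
rewrite -(Cintegral_hahn (k j) (l j) p1 p2 p2 p1).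
suff -> : x_factor k l a1 a2 j = (fun x => barnes_integrand al al' al' al (x / 2) *
    hahn_poly (k j) (al + al') (al + al' + al' + al) (al + al) (al +i* (x / 2)) *
    hahn_poly (l j) (al + al') (al + al' + al' + al) (al' + al') (al' -i* (x / 2))) by [].
apply/funext => x; rewrite /x_factor.
have -> : hahn_param l a1 j = al by rewrite /hahn_param -kl.
have -> : hahn_param l a2 j = al' by rewrite /hahn_param -kl.
by rewrite -/al -/al' (_ : 2 * (al + al') = al + al' + al' + al)//; ring.
Qed.

Lemma Cintegral_t_factor n k m b1 b2 c1 c2 :
  0 < b1 -> 0 < b2 -> 0 < c1 -> 0 < c2 -> (tail k 0 <= n)%N -> (tail k 0 <= m)%N ->
  let K : R := (tail k 0)%:R in
  Cintegral mu setT (t_factor n k m k b1 b2 c1 c2) =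
  ((n == m)%:R * hahn_norm (n - tail k 0) (K + b2) c1 (K + b1) c2)%:C.
Proof.
move=> b1_0 b2_0 c1_0 c2_0 kn km K.
have -> : (n == m) = (m - tail k 0 == n - tail k 0)%N.
  by rewrite -[RHS](eqn_add2r (tail k 0)) !subnK// eq_sym.
have [p1 p2] : 0 < K + b2 /\ 0 < K + b1 by rewrite !ltr_wpDl.
have -> : (m - tail k 0 == n - tail k 0)%N%:R * hahn_norm (n - tail k 0) (K + b2) c1 (K + b1) c2 =
  (m - tail k 0 == n - tail k 0)%N%:R * hahn_norm (m - tail k 0) (K + b2) c1 (K + b1) c2.
  by have [->|] := eqVneq; rewrite ?mul0r.
rewrite -(Cintegral_hahn (m - tail k 0) (n - tail k 0) p1 c1_0 p2 c2_0).
suff -> : t_factor n k m k b1 b2 c1 c2 = (fun x => barnes_integrand (K + b2) c1 (K + b1) c2 (x / 2) *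
    hahn_poly (m - tail k 0) (K + b2 + (K + b1)) (K + b2 + c1 + (K + b1) + c2) (K + b2 + c2)
      ((K + b2) +i* (x / 2)) *
    hahn_poly (n - tail k 0) (K + b2 + (K + b1)) (K + b2 + c1 + (K + b1) + c2) (c1 + (K + b1))
      ((K + b1) -i* (x / 2))) by [].
apply/funext => x; rewrite /t_factor -/K.
rewrite (_ : 2 * K + (b1 + b2) = K + b2 + (K + b1)); last by ring.
rewrite (_ : K + b2 + (K + b1) + (c1 + c2) = K + b2 + c1 + (K + b1) + c2); last by ring.
by rewrite (_ : K + b1 + c1 = c1 + (K + b1))//; ring.
Qed.

(** The value of the integral in the diagonal case, free of removable
singularities. *)
Definition diagonal_value n k a1 a2 b1 b2 c1 c2 : R :=
  let K : R := (tail k 0)%:R in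
  hahn_norm (n - tail k 0) (K + b2) c1 (K + b1) c2 *
  \prod_(j < d) hahn_norm (k j) (hahn_param k a1 j) (hahn_param k a2 j)
    (hahn_param k a2 j) (hahn_param k a1 j).

(** The variables separate, but the polynomials in [x_j] depend on [tail k j.+1],
so the factors are orthogonal only once [k] and [l] agree beyond [j]. If [k] and
[l] differ, the last [j] where they do gives a vanishing factor; if they are
equal, every factor is a norm. *)
Lemma Cintegral_integrand n k m l a1 a2 b1 b2 c1 c2 :
  0 < a1 -> 0 < a2 -> 0 < b1 -> 0 < b2 -> 0 < c1 -> 0 < c2 ->
  (tail k 0 <= n)%N -> (tail l 0 <= m)%N ->
  Cintegrable (lebesgue_tuple d.+1) setT (integrand n k m l a1 a2 b1 b2 c1 c2) /\
  Cintegral (lebesgue_tuple d.+1) setT (integrand n k m l a1 a2 b1 b2 c1 c2) =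
  ((n == m)%:R * (\prod_(j < d) (k j == l j)%:R) *
    diagonal_value n k a1 a2 b1 b2 c1 c2)%:C.
Proof.
move=> a1_0 a2_0 b1_0 b2_0 c1_0 c2_0 kn lm.
pose f (i : 'I_d.+1) : R -> R[i] := if unlift ord0 i is Some j then x_factor k l a1 a2 j
  else t_factor n k m l b1 b2 c1 c2.
have fi i : Cintegrable mu setT (f i).
  rewrite /f; case: unliftP => [j _|_]; first exact: Cintegrable_x_factor.
  exact: Cintegrable_t_factor.
have f0 : f ord0 = t_factor n k m l b1 b2 c1 c2 by rewrite /f unlift_none.
have fS j : f (lift ord0 j) = x_factor k l a1 a2 j by rewrite /f liftK.
have FE : integrand n k m l a1 a2 b1 b2 c1 c2 =
    (fun v : d.+1.-tuple RR => \prod_(i < d.+1) f i (tnth v i)).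
  apply/funext => v; rewrite integrand_factor// big_ord_recl f0; congr (_ * _).
  by apply: eq_bigr => j _; rewrite fS.
have [I1 I2] := Cintegral_tuple fi; rewrite FE; split => //; rewrite I2 big_ord_recl f0.
have [/forallP kl|] := boolP [forall j, k j == l j].
  have {}kl : k = l by apply/funext => j; exact/eqP.
  rewrite -kl in lm *; rewrite Cintegral_t_factor// [\prod_(j < d) (k j == k j)%:R]big1 ?mulr1; last first.
    by move=> j _; rewrite eqxx.
  rewrite /diagonal_value [in RHS]mulrA [RHS]rmorphM/= rmorph_prod/=; congr (_ * _).
  apply: eq_bigr => j _; rewrite fS -kl (Cintegral_x_factor a1_0 a2_0 erefl).
  by rewrite eqxx mul1r.
rewrite negb_forall => /existsP[j0 kl0].
have [j klj jmax] := @arg_maxnP _ j0 (fun j => k j != l j) val kl0.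
have tkl : tail k j.+1 = tail l j.+1.
  apply: eq_bigr => i ji; apply/eqP; apply: contraTT ji => /jmax.
  by rewrite -leqNgt.
rewrite [X in _ * X](bigD1 j)//= fS (Cintegral_x_factor a1_0 a2_0 tkl) (negbTE klj).
by rewrite [in RHS](bigD1 j)//= (negbTE klj) !(mul0r, mulr0).
Qed.

End Factorization.

(** * The closed form of the diagonal value *)

Section ClosedForm.
Context {R : realType}.
Implicit Types (a b c x q A E S : R).

Lemma Rgamma_gt0 x : 0 < x -> Rgamma x = rgam x.
Proof. by move=> x0; rewrite /Rgamma (CgammaE 0 x0) Gm0. Qed.

(** Only an argument above -1 occurs: for [n = 0] the closed form contains
Gamma(|b| + |c| - 1). *)
Lemma RgammaS x : -1 < x -> x != 0 -> x * Rgamma x = rgam (x + 1).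
Proof.
move=> x1 xn0; have [x0|xle0] := ltP 0 x; first by rewrite Rgamma_gt0// rgamS.
have x0 : x < 0 by rewrite lt_neqAle xn0.
rewrite /Rgamma /Cgamma /= ltNge xle0/=.
have -> : Num.truncn (- x) = 0%N.
  by apply/eqP; rewrite -leqn0 truncn_le_nat ltrNl.
have -> : x%:C + 1%:R = (x + 1) +i* 0 by apply/eqP; rewrite eq_complex/= addr0 !eqxx.
have x10 : 0 < x + 1 by rewrite -ltrBlDr sub0r.
rewrite gamma_int_line -[_ +i* _]/(Gm (x + 1) 0) Gm0 /poch big_ord1 addr0.
by rewrite -fmorphV -rmorphM/= mulrC divfK.
Qed.

Lemma poch_duplication x n :
  poch (2 * x) (n + n) = 4 ^+ n * poch x n * poch (x + 1 / 2) n.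
Proof.
elim: n => [|n IH]; first by rewrite !poch0 !mulr1.
by rewrite addnS addSn !pochSr IH exprS -natr1 natrD; field.
Qed.

(** The factor of the closed form that comes from [t]. Gamma(n + |k| + |b| + |c| - 1)
is the one Gamma value whose argument may be negative. *)
Lemma hahn_norm_t (N : nat) (K : nat) b1 b2 c1 c2 :
  0 < b1 -> 0 < b2 -> 0 < c1 -> 0 < c2 ->
  let n := (N + K)%N in let B := b1 + b2 in let C := c1 + c2 in
  2 * n%:R + B + C - 1 != 0 ->
  hahn_norm N (K%:R + b2) c1 (K%:R + b1) c2 =
  4 * pi * N`!%:R * (Rgamma (n%:R + K%:R + B) * Rgamma (n%:R - K%:R + C)
     * Rgamma (K%:R + b1 + c1) * Rgamma (K%:R + b2 + c2)
     / (poch (2 * K%:R + B) N ^+ 2 * (2 * n%:R + B + C - 1)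
        * Rgamma (n%:R + K%:R + B + C - 1))).
Proof.
move=> b1_0 b2_0 c1_0 c2_0 n B C; rewrite /n natrD.
set k : R := K%:R; set nn : R := N%:R; pose E := 2 * k + B; pose S := E + C.
have k0 : 0 <= k by rewrite /k.
have B0 : 0 < B by rewrite addr_gt0.
have C0 : 0 < C by rewrite addr_gt0.
have E0 : 0 < E by rewrite /E ltr_wpDl// mulr_ge0.
have S0 : 0 < S by rewrite addr_gt0.
rewrite (_ : 2 * (nn + k) + B + C - 1 = S + nn + nn - 1); last by rewrite /S /E; ring.
move=> den0; have n0 : 0 <= nn by rewrite /nn.
rewrite (_ : nn + k + k + B = E + nn); last by rewrite /E; ring.
rewrite (_ : nn + k - k + C = C + nn); last by ring.
rewrite (_ : E + nn + C - 1 = S + nn - 1); last by rewrite /S; ring.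
have En0 : 0 < E + nn by rewrite ltr_wpDr.
have Cn0 : 0 < C + nn by rewrite ltr_wpDr.
rewrite -/E (Rgamma_gt0 En0) (Rgamma_gt0 Cn0).
have kb1 : 0 < k + b1 + c1 by rewrite ltr_wpDr ?(ltW c1_0)// ltr_wpDl.
have kb2 : 0 < k + b2 + c2 by rewrite ltr_wpDr ?(ltW c2_0)// ltr_wpDl.
rewrite (Rgamma_gt0 kb1) (Rgamma_gt0 kb2).
have last_gamma : (S + nn + nn - 1) * Rgamma (S + nn - 1) * poch (S + nn - 1) N =
    poch S (N + N) * rgam S.
  rewrite -rgam_shift// natrD -/nn.
  have [N0|N0] := posnP N.
    move: den0; rewrite /nn N0 poch0 mulr1 !addr0 => den0.
    by rewrite RgammaS ?subrK// ltrDr ?ltrBlDr.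
  have n1 : 1 <= nn by rewrite /nn ler1n.
  have x0 : 0 < S + nn - 1 by lra.
  rewrite Rgamma_gt0// mulrAC -mulrA -rgam_shift// -/nn.
  rewrite (_ : S + nn + nn - 1 = S + nn - 1 + nn); last by ring.
  have x1 : 0 < S + nn - 1 + nn by rewrite ltr_wpDr.
    rewrite -(rgamS x1) (_ : S + nn - 1 + nn + 1 = S + (nn + nn))//.
    by clear; ring.
rewrite /nn !rgam_shift// -/nn /hahn_norm /barnes_value.
rewrite (_ : k + b2 + (k + b1) = E); last by rewrite /E /B; ring.
rewrite (_ : k + b2 + c1 + (k + b1) + c2 = S); last by rewrite /S /E /B /C; ring.
rewrite (_ : c1 + (k + b1) = k + b1 + c1); last by ring.
rewrite -/C (_ : nn + S - 1 = S + nn - 1); last by ring.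
have rS := rgam_gt0 S0; have pS := poch_gt0 (N + N) S0; have pE := poch_gt0 N E0.
have G0 : Rgamma (S + nn - 1) != 0.
  apply/eqP => G0; move: last_gamma; rewrite G0 mulr0 mul0r => /esym/eqP.
  by rewrite mulf_eq0 !gt_eqF.
have -> : poch (S + nn - 1) N = poch S (N + N) * rgam S /
    ((S + nn + nn - 1) * Rgamma (S + nn - 1)).
  by rewrite -last_gamma mulrAC divff ?mul1r// mulf_neq0.
move: (poch S (N + N)) (rgam S) (Rgamma _) (rgam (k + b1 + c1)) (rgam (k + b2 + c2)) rS pS G0.
move: (rgam E) (rgam C) (poch E N) (poch C N) pE (S + nn + nn - 1) den0.
move=> rE rC pE pC pE0 den den0 pS rS RG r1 r2 rS0 pS0 RG0.
by field; rewrite RG0 den0 !gt_eqF.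
Qed.

(** In [diagonal_valueE], [q = |a| + (d - j.+1) / 2], [s = tail k j.+1] and [k] stands
for [k j]: the norm in the variable [x_j] is the [j]-th factor of the closed form
times two quotients. Up to powers of 2 and pi these are ratios, from [j] to
[j.+1], of one Gamma value and one inverse Pochhammer symbol, and telescope in the
product. The duplication formulas for Gamma and for Pochhammer symbols remove the
half-integer shifts. *)
Lemma hahn_norm_x (s k : nat) q (al al' : R) : 0 < q -> 0 < al -> 0 < al' ->
  let E := q + s%:R in al + al' = E ->
  poch (2 * E - 1) k != 0 -> poch (q - 1 / 2) s != 0 ->
  poch (q - 1 / 2) (k + s) * poch (2 * E - 1) k / (k`!%:R * poch q (k + s)) *
  (k`!%:R ^+ 2 * rgam (al + al) * rgam (al' + al') /
    (2 ^+ (2 * s) * poch (2 * E - 1) k ^+ 2)) *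
  (4 * pi * Num.sqrt pi * 2 `^ (1 - 2 * q) *
    (rgam E / rgam (q + 1 / 2 + (k + s)%:R)) * (poch q (k + s) / poch (q - 1 / 2) s)) =
  hahn_norm k al al' al' al.
Proof.
move=> q0 al0 al'0 E alE P0 Q0; have E0 : 0 < E by rewrite ltr_wpDr.
have h0 : 0 < 1 / 2 :> R by rewrite divr_gt0.
have Eh0 : 0 < E + 1 / 2 by rewrite addr_gt0.
have E20 : 0 < 2 * E by rewrite mulr_gt0.
rewrite /hahn_norm /barnes_value (addrC al' al) alE.
rewrite (_ : E + al' + al = 2 * E); last by rewrite -alE; ring.
rewrite (_ : k%:R + 2 * E - 1 = 2 * E - 1 + k%:R); last by ring.
have dupl := rgam_duplication E0.
have -> : q + 1 / 2 + (k + s)%:R = E + 1 / 2 + k%:R by rewrite /E natrD; ring.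
rewrite rgam_shift//.
have -> : poch (q - 1 / 2) (k + s) = poch (q - 1 / 2) s * poch (E - 1 / 2) k.
  by rewrite addnC pochD /E; congr (_ * poch _ _); ring.
have pw : 2 `^ (1 - 2 * E) = 2 `^ (1 - 2 * q) / 2 ^+ (2 * s).
  rewrite -powR_invn// -powRD ?pnatr_eq0 ?implybT//; congr (_ `^ _).
  by rewrite /E natrM; ring.
have X : poch (2 * E - 1) k * poch (2 * E - 1 + k%:R) k =
    4 ^+ k * poch (E - 1 / 2) k * poch E k.
  rewrite -pochD (_ : 2 * E - 1 = 2 * (E - 1 / 2)); last by field.
  by rewrite poch_duplication; congr (_ * poch _ _); ring.
have -> : poch (2 * E - 1 + k%:R) k =
    4 ^+ k * poch (E - 1 / 2) k * poch E k / poch (2 * E - 1) k.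
  by rewrite -X mulrAC divff ?mul1r.
rewrite poch_duplication.
have r1 := rgam_gt0 E0; have r2 := rgam_gt0 Eh0; have r3 := rgam_gt0 E20.
have sp0 : 0 < Num.sqrt pi :> R by rewrite sqrtr_gt0 pi_gt0.
have pw0 : 0 < 2 `^ (1 - 2 * q) :> R by rewrite powR_gt0.
have t0 : 0 < 2 ^+ (2 * s) :> R by rewrite exprn_gt0.
have f0 : 0 < 4 ^+ k :> R by rewrite exprn_gt0.
have -> : rgam (2 * E) = rgam E * rgam (E + 1 / 2) * 2 ^+ (2 * s) /
   (2 `^ (1 - 2 * q) * Num.sqrt pi).
  rewrite dupl pw; move: (Num.sqrt pi) (2 `^ _) (rgam _) (2 ^+ _) sp0 pw0 t0.
  by move=> ? ? ? ? h1 h2 h3; field; rewrite !gt_eqF.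
have p1 := poch_gt0 k Eh0; have p2 := poch_gt0 k E0; have p3 := poch_gt0 (k + s) q0.
have fk : k`!%:R != 0 :> R by rewrite pnatr_eq0 -lt0n fact_gt0.
move: (rgam E) (rgam (E + 1 / 2)) (rgam (al + al)) (rgam (al' + al')) r1 r2.
move: (poch (2 * E - 1) k) (poch (q - 1 / 2) s) (poch (E - 1 / 2) k) P0 Q0.
move: (poch (E + 1 / 2) k) (poch E k) (poch q (k + s)) p1 p2 p3.
move: (Num.sqrt pi) (2 `^ _) (2 ^+ _) (4 ^+ k) (k`!%:R) sp0 pw0 t0 f0 fk => sp pw' t f fk.
move=> h1 h2 h3 h4 h5 x1 x2 x3 h6 h7 h8 y1 y2 y3 h9 h10 z1 z2 z3 z4 h11 h12.
by field; rewrite h9 h10 h5 !gt_eqF.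
Qed.

Lemma prod_telescope (u : nat -> R) n : (forall i, u i != 0) ->
  \prod_(j < n) (u j.+1 / u j) = u n / u 0%N.
Proof.
move=> u0; elim: n => [|n IH]; first by rewrite big_ord0 divff.
by rewrite big_ord_recr/= IH mulrC mulrA divfK.
Qed.

(** The powers of 2 and of pi: the duplication formula contributes
[2^(1 - 2|a| - (d - j.+1))] and a square root of pi for each [j]. *)
Lemma power_correctionE (d : nat) A : (0 < d)%N ->
  power_correction d * (2 * pi) ^+ d.+1 * 2 `^ (- (2 * d%:R * A) + d%:R + 2) *
    pi `^ (d%:R / 2) =
  4 * pi * \prod_(j < d) (4 * pi * Num.sqrt pi * 2 `^ (1 - 2 * (A + (d - j.+1)%:R / 2))).
Proof.
have p2 : (2 : R) != 0 by rewrite pnatr_eq0.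
have sp : pi `^ (1 / 2) = Num.sqrt pi :> R by rewrite div1r powR12_sqrt// pi_ge0.
rewrite (reindex_inj rev_ord_inj)/= => d0.
rewrite (eq_bigr (fun j : 'I_d => 4 * pi * Num.sqrt pi * 2 `^ (1 - 2 * (A + j%:R / 2)))); last first.
  by move=> j _; rewrite -subSn// subSS subKn// ltnW.
case: d d0 => // d _; elim: d => [|d IH].
  rewrite big_ord1 /power_correction /= expr0 invr1 mul1r sp mul0r addr0.
  rewrite (_ : - (2 * 1 * A) + 1 + 2 = (1 - 2 * A) + 2%:R); last by ring.
  by rewrite powRD ?p2 ?implybT// powR_mulrn//; ring.
rewrite big_ord_recr/= mulrA -IH /power_correction/=.
have -> : (2 ^- 'C(d.+1, 2) : R) = 2 ^- 'C(d, 2) * 2 ^- d.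
  by rewrite binS bin1 exprD invfM.
have -> : 2 `^ (- (2 * d.+2%:R * A) + d.+2%:R + 2) =
    2 `^ (- (2 * d.+1%:R * A) + d.+1%:R + 2) * 2 `^ (1 - 2 * A) :> R.
  by rewrite -powRD ?p2 ?implybT//; congr (_ `^ _); rewrite -[d.+2%:R]natr1; ring.
have -> : pi `^ (d.+2%:R / 2) = pi `^ (d.+1%:R / 2) * Num.sqrt pi :> R.
  rewrite -sp -powRD ?gt_eqF ?pi_gt0 ?implybT//; congr (_ `^ _).
  by rewrite -[d.+2%:R]natr1; field.
have -> : 2 `^ (1 - 2 * (A + d.+1%:R / 2)) = 2 `^ (1 - 2 * A) * 2 ^- d / 2 :> R.
  rewrite (_ : 1 - 2 * (A + d.+1%:R / 2) = 1 - 2 * A - d.+1%:R); last by field.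
  rewrite powRD ?p2 ?implybT// powR_invn// exprS invfM; ring.
rewrite [_ ^+ d.+3]exprS.
move: (2 ^- 'C(d, 2)) (2 ^- d) (_ ^+ d.+2) (2 `^ _) (2 `^ _) (pi `^ _) (Num.sqrt pi).
by move=> ? ? ? ? ? ? ?; field.
Qed.

(** The product over [j] telescopes to the Gamma values and the Pochhammer symbol in
front of the product in [ball_norm]. *)
Lemma diagonal_valueE (d : nat) n m (k l : 'I_d -> nat) a1 a2 b1 b2 c1 c2 :
  (0 < d)%N -> 0 < a1 -> 0 < a2 -> 0 < b1 -> 0 < b2 -> 0 < c1 -> 0 < c2 ->
  (tail k 0 <= n)%N -> rhs_defined n k a1 a2 b1 b2 c1 c2 ->
  power_correction d * biorth_rhs n k m l a1 a2 b1 b2 c1 c2 =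
  (n == m)%:R * (\prod_(j < d) (k j == l j)%:R) * diagonal_value n k a1 a2 b1 b2 c1 c2.
Proof.
move=> d0 a1_0 a2_0 b1_0 b2_0 c1_0 c2_0 kn /andP[den0 /forallP poch_n0].
rewrite /biorth_rhs big_split/= /ball_norm.
have nE : n = ((n - tail k 0) + tail k 0)%N by rewrite subnK.
have := @hahn_norm_t (n - tail k 0) (tail k 0) b1 b2 c1 c2 b1_0 b2_0 c1_0 c2_0.
rewrite /= -nE => /(_ den0) tE; rewrite /diagonal_value tE {tE}.
set A := a1 + a2; have A0 : 0 < A by rewrite addr_gt0.
pose Phi i := rgam (A + (d - i)%N%:R / 2 + (tail k i)%:R).
pose Om i := poch (A + (d - i)%N%:R / 2 - 1 / 2) (tail k i).
have Phi0 i : Phi i != 0 by rewrite gt_eqF// rgam_gt0//; rewrite ltr_wpDr// ltr_wpDr// divr_ge0.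
have Om0 i : Om i != 0.
  rewrite /Om; have [di|id] := leqP d i.
    by rewrite tail_ge// poch0 oner_neq0.
  rewrite gt_eqF// poch_gt0//.
  have : 1 <= (d - i)%N%:R :> R by rewrite ler1n subn_gt0.
  lra.
pose cst j : R := 4 * pi * Num.sqrt pi * 2 `^ (1 - 2 * (A + (d - j.+1)%N%:R / 2)).
have -> : \prod_(j < d) hahn_norm (k j) (hahn_param k a1 j) (hahn_param k a2 j)
    (hahn_param k a2 j) (hahn_param k a1 j) =
  (\prod_(j < d) (poch (a1 + a2 - 1 / 2 + (d - j.+1)%:R / 2) (tail k j) *
     poch (2 * (a1 + a2 - 1 / 2) + 2 * (tail k j.+1)%:R + (d - j.+1)%:R) (k j) /
     ((k j)`!%:R * poch (a1 + a2 - 1 / 2 + ((d - j.+1)%:R + 1) / 2) (tail k j)))) *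
  (\prod_(j < d) ((k j)`!%:R ^+ 2 * Rgamma ((tail k j.+1)%:R + 2 * a1 + (d - j.+1)%:R / 2) *
     Rgamma ((tail k j.+1)%:R + 2 * a2 + (d - j.+1)%:R / 2) /
     (2 ^+ (2 * tail k j.+1) *
        poch (2 * (tail k j.+1)%:R + 2 * A + (d - j.+1)%:R - 1) (k j) ^+ 2))) *
  (\prod_(j < d) cst j) * (\prod_(j < d) (Phi j.+1 / Phi j)) *
  (\prod_(j < d) ((Om j.+1)^-1 / (Om j)^-1)).
  rewrite -!big_split/=; apply: eq_bigr => j _.
  have e0 : 0 <= (d - j.+1)%N%:R / 2 :> R by rewrite divr_ge0.
  have q0 : 0 < A + (d - j.+1)%N%:R / 2 by rewrite ltr_wpDr.
  have p1 := hahn_param_gt0 k j a1_0; have p2 := hahn_param_gt0 k j a2_0.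
  have := @hahn_norm_x (tail k j.+1) (k j) (A + (d - j.+1)%N%:R / 2)
    (hahn_param k a1 j) (hahn_param k a2 j) q0 p1 p2.
  have dj : (d - j)%N%:R = (d - j.+1)%N%:R + 1 :> R.
    by rewrite natr1 -subSn// subSS.
  set e : R := (d - j.+1)%N%:R in dj e0 q0 *; set q := A + e / 2 in q0 *.
  set s : R := (tail k j.+1)%:R => /= H.
  have alE : hahn_param k a1 j + hahn_param k a2 j = q + s.
    by rewrite /hahn_param -/s -/e /q /A; field.
  have e2E : 2 * (a1 + a2 - 1 / 2) + 2 * s + e = 2 * (q + s) - 1 by rewrite /q /A; field.
  have e2E' : 2 * s + 2 * A + e - 1 = 2 * (q + s) - 1 by rewrite /q; field.
  have P0 : poch (2 * (q + s) - 1) (k j) != 0 by rewrite -e2E'; exact: poch_n0.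
  have OmS : Om j.+1 = poch (q - 1 / 2) (tail k j.+1) by [].
  have Q0 : poch (q - 1 / 2) (tail k j.+1) != 0 by rewrite -OmS.
  have OmE : Om j = poch q (tail k j).
    by rewrite /Om dj (_ : A + (e + 1) / 2 - 1 / 2 = q)//; rewrite /q; field.
  have PhiS : Phi j.+1 = rgam (q + s) by [].
  have PhiE : Phi j = rgam (q + 1 / 2 + (tail k j)%:R).
    rewrite /Phi dj (_ : A + (e + 1) / 2 = q + 1 / 2); first by [].
    by rewrite /q; field.
  have g a : 0 < a -> Rgamma (s + 2 * a + e / 2) = rgam (hahn_param k a j + hahn_param k a j).
    move=> a0; rewrite Rgamma_gt0; last by rewrite ltr_wpDr// ltr_wpDl// mulr_gt0.
    rewrite (_ : s + 2 * a + e / 2 = hahn_param k a j + hahn_param k a j); first by [].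
    by rewrite /hahn_param -/s -/e; field.
  rewrite -(H alE P0 Q0) e2E e2E' (g _ a1_0) (g _ a2_0) OmS OmE PhiS PhiE.
  rewrite (_ : a1 + a2 - 1 / 2 + e / 2 = q - 1 / 2); last by rewrite /q /A; ring.
  rewrite (_ : a1 + a2 - 1 / 2 + (e + 1) / 2 = q); last by rewrite /q /A; field.
  rewrite /cst -/e -/q -/A (tailS k j) addnC invrK.
  move: (poch _ _) (poch _ _) (poch _ _) (poch _ _) => ? ? ? ?.
  move: (rgam _) (rgam _) (rgam _) (rgam _) (2 `^ _) (Num.sqrt _) (2 ^+ _) => ? ? ? ? ? ? ?.
  by ring.
rewrite prod_telescope// (@prod_telescope (fun j => (Om j)^-1)); last first.
  by move=> i; rewrite invr_eq0.
have td : tail k d = 0%N by exact: tail_ge.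
have -> : Om d = 1 by rewrite /Om td poch0.
have PhidE : Rgamma (A - 1 / 2 + 1 / 2) = Phi d.
  by rewrite subrK (Rgamma_gt0 A0) /Phi td subnn mul0r !addr0.
have Phi0E : Rgamma (A - 1 / 2 + (d%:R + 1) / 2 + (tail k 0)%:R) = Phi 0%N.
  rewrite (_ : A - 1 / 2 + (d%:R + 1) / 2 = A + d%:R / 2); last by field.
  rewrite Rgamma_gt0; first by rewrite /Phi subn0.
  by rewrite ltr_wpDr// ltr_wpDr// divr_ge0.
have Om0E : poch (A - 1 / 2 + d%:R / 2) (tail k 0) = Om 0%N.
  by rewrite /Om subn0 (_ : A - 1 / 2 + d%:R / 2 = A + d%:R / 2 - 1 / 2)//; ring.
rewrite PhidE Phi0E Om0E -/cst invr1 invrK.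
have := power_correctionE A d0; rewrite -/(\prod_(j < d) cst j).
move: (\prod_(j < d) cst j) (Rgamma _ * _ * _ * _ / _) => C G pE.
move: (\prod_(j < d) _) (\prod_(j < d) _) (\prod_(j < d) _) => D P1 P2.
transitivity ((power_correction d * (2 * pi) ^+ d.+1 * 2 `^ (- (2 * d%:R * A) + d%:R + 2) *
    pi `^ (d%:R / 2)) * ((n == m)%:R * D * G * (n - tail k 0)`!%:R * P1 * P2 * (Phi d / Phi 0%N) * Om 0%N)).
  move: (power_correction d) (2 `^ _) (pi `^ _) (_ ^+ _) (Phi d) (Phi 0%N) (Om 0%N).
  by move=> ? ? ? ? ? ? ?; ring.
rewrite pE; move: (Phi d) (Phi 0%N) (Om 0%N) => ? ? ?; ring.
Qed.

End ClosedForm.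

(** * The two expressions of the biorthogonal functions *)

Section HahnForm.
Context {R : realType}.
Implicit Types (a b c : R) (A B C D x : R[i]).

Lemma complexiX2 : 'i * 'i = -1 :> R[i].
Proof. by rewrite -expr2 sqr_i. Qed.

Lemma complexi_neq0 : 'i != 0 :> R[i].
Proof. by rewrite eq_complex/= oner_eq0 andbF. Qed.

(** Up to its normalising constant, a continuous Hahn polynomial is its
hypergeometric factor. *)
Lemma continuous_Hahn_pFq p x A B C D : poch (A + C) p != 0 -> poch (A + D) p != 0 ->
  p`!%:R * 'i ^- p / (poch (A + D) p * poch (A + C) p) * continuous_Hahn p x A B C D =
  pFq [:: - p%:R; p%:R + A + B + C + D - 1; A + 'i * x] [:: A + C; A + D] 1.
Proof.
rewrite /continuous_Hahn => p1 p2; move: (pFq _ _ _) => F.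
have ip : 'i ^+ p != 0 :> R[i] by rewrite expf_neq0// complexi_neq0.
have fp : p`!%:R != 0 :> R[i] by rewrite pnatr_eq0 -lt0n fact_gt0.
move: (poch _ _) (poch _ _) ('i ^+ p) (p`!%:R) p1 p2 ip fp => u v w f u0 v0 w0 f0.
by field; rewrite u0 v0 w0 f0.
Qed.

Lemma poch_real_neq0 a n : 0 < a -> poch a%:C n != 0.
Proof. by move=> a0; rewrite -poch_rmorph fmorph_eq0 gt_eqF// poch_gt0. Qed.

Lemma Bfun_HahnE (d : nat) n (k : 'I_d -> nat) a1 a2 b1 b2 c1 c2 (t : R[i]) (x : 'I_d -> R[i]) :
  0 < a1 -> 0 < a2 -> 0 < b1 -> 0 < b2 -> 0 < c1 -> 0 < c2 ->
  (tail k 0 <= n)%N ->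
  Bfun n k a1 a2 b1 b2 c1 c2 t x = Bfun_Hahn n k a1 a2 b1 b2 c1 c2 t x.
Proof.
move=> a1_0 a2_0 b1_0 b2_0 c1_0 c2_0 kn; rewrite /Bfun /Bfun_Hahn.
congr (_ * _); last first.
  apply: eq_bigr => j _.
  set s : R[i] := (tail k j.+1)%:R; set e : R[i] := (d - j.+1)%N%:R.
  set al := a1%:C + s / 2 + e / 4; set al' := a2%:C + s / 2 + e / 4.
  have E1 : s + 2 * a1%:C + e / 2 = al + al by rewrite /al; field.
  have E2 : s + (a1 + a2)%:C + e / 2 = al + al' by rewrite /al /al' rmorphD/=; field.
  have h a a' : 0 < a -> 0 < a' ->
      poch (a%:C + s / 2 + e / 4 + (a'%:C + s / 2 + e / 4)) (k j) != 0.
    move=> a0 a'0; rewrite (_ : _ + _ =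
      (a + a' + (tail k j.+1)%:R + (d - j.+1)%N%:R / 2)%:C); last first.
      by rewrite !rmorphD rmorphM/= fmorphV !rmorph_nat -/s -/e; field.
    by apply: poch_real_neq0; rewrite ltr_wpDr// ?divr_ge0// ltr_wpDr// addr_gt0.
  have E3 : (k j)%:R + al + al' + al' + al - 1 =
      (k j)%:R + 2 * (s + (a1 + a2)%:C + (e - 1) / 2).
    by rewrite /al /al' rmorphD/=; field.
  have E4 : al + 'i * - ('i * x j / 2) = a1%:C + (s + x j) / 2 + e / 4.
    by rewrite mulrN !mulrA complexiX2 /al; field.
  have := @continuous_Hahn_pFq (k j) (- ('i * x j / 2)) al al' al' al.
  rewrite E3 E4 => /(_ (h _ _ a1_0 a2_0) (h _ _ a1_0 a1_0)) P.
  rewrite E1 E2 -P.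
  move: (Cgamma _) (Cgamma _) (continuous_Hahn _ _ _ _ _ _) (_ / _) => ? ? ? ?; ring.
set K : R[i] := (tail k 0)%:R; set p := (n - tail k 0)%N.
have E1 : K + b1%:C + (K + b2%:C) = 2 * K + (b1 + b2)%:C by rewrite rmorphD/=; ring.
have h a a' : 0 < a -> 0 < a' -> poch (K + a%:C + a'%:C) p != 0.
  move=> a0 a'0; rewrite (_ : _ + _ = ((tail k 0)%:R + a + a')%:C).
    by apply: poch_real_neq0; rewrite ltr_wpDr// ?ltW// ltr_wpDl.
  by rewrite !rmorphD/= rmorph_nat.
have h2 : poch (2 * K + (b1 + b2)%:C) p != 0.
  rewrite (_ : _ + _ = ((tail k 0)%:R + (tail k 0)%:R + b1 + b2)%:C).
    by apply: poch_real_neq0; rewrite ltr_wpDr// ?ltW// ltr_wpDl// addr_ge0.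
  by rewrite !rmorphD/= rmorph_nat; ring.
have pE : p%:R = n%:R - K :> R[i] by rewrite /p natrB.
have := @continuous_Hahn_pFq p ('i * t / 2) (K + b1%:C) c2%:C (K + b2%:C) c1%:C.
rewrite E1 => /(_ h2 (h _ _ b1_0 c1_0)).
have -> : p%:R + (K + b1%:C) + c2%:C + (K + b2%:C) + c1%:C - 1 =
    n%:R + K + (b1 + b2)%:C + (c1 + c2)%:C - 1.
  by rewrite pE !rmorphD/=; ring.
have -> : K + b1%:C + 'i * ('i * t / 2) = K + b1%:C - t / 2.
  by rewrite !mulrA complexiX2; ring.
have -> : - p%:R = - n%:R + K by rewrite pE opprB addrC.
move=> <-; move: (continuous_Hahn _ _ _ _ _ _) (poch _ _) (poch _ _) (poch _ _) => ? ? ? ?.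
by rewrite !invfM; ring.
Qed.

End HahnForm.

(** * Continuity in the parameters *)

Section Continuation.
Context {R : realType} {T : Type} {F : set_system T} {FF : Filter F}.
Implicit Types (f : T -> R).

Lemma cvg_rgam f (a : R) : 0 < a -> f x @[x --> F] --> a -> rgam (f x) @[x --> F] --> rgam a.
Proof. by move=> a0 fa; apply: continuous_cvg fa; exact: continuous_rgam. Qed.

Lemma cvg_poch f (a : R) n : f x @[x --> F] --> a -> poch (f x) n @[x --> F] --> poch a n.
Proof.
move=> fa; elim: n => [|n IH].
  by rewrite poch0; under eq_cvg do rewrite poch0; exact: cvg_cst.
rewrite pochSr; under eq_cvg do rewrite pochSr.
by apply: cvgM => //; apply: cvgD => //; exact: cvg_cst.
Qed.

Lemma cvg_prod (I : finType) (f : I -> T -> R) (a : I -> R) :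
  (forall i, f i x @[x --> F] --> a i) ->
  \prod_i f i x @[x --> F] --> \prod_i a i.
Proof.
move=> fa; by apply: cvg_big => //; exact: mul_continuous.
Qed.

Lemma cvg_hahn_norm n (fa fb fc fd : T -> R) (a b c d : R) :
  0 < a -> 0 < b -> 0 < c -> 0 < d ->
  fa x @[x --> F] --> a -> fb x @[x --> F] --> b -> fc x @[x --> F] --> c ->
  fd x @[x --> F] --> d ->
  hahn_norm n (fa x) (fb x) (fc x) (fd x) @[x --> F] --> hahn_norm n a b c d.
Proof.
move=> a0 b0 c0 d0 ha hb hc hd.
have S0 : 0 < a + b + c + d by rewrite !addr_gt0.
rewrite /hahn_norm /barnes_value.
have hS : fa x + fb x + fc x + fd x @[x --> F] --> a + b + c + d.
  by do 3?[apply: cvgD => //].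
have hac : fa x + fc x @[x --> F] --> a + c by exact: cvgD.
have had : fa x + fd x @[x --> F] --> a + d by exact: cvgD.
have hbc : fb x + fc x @[x --> F] --> b + c by exact: cvgD.
have hbd : fb x + fd x @[x --> F] --> b + d by exact: cvgD.
apply: cvgM.
  apply: cvgM; first exact: cvg_cst.
  apply: cvgM; last first.
    by apply: cvgV; [rewrite gt_eqF// rgam_gt0|exact: cvg_rgam].
  apply: cvgM; first exact: cvg_cst.
  have g (f : T -> R) (u v : R) : 0 < u -> 0 < v -> f x @[x --> F] --> u + v ->
      rgam (f x) @[x --> F] --> rgam (u + v).
    by move=> u0 v0; apply: cvg_rgam; rewrite addr_gt0.
  by apply: cvgM; [apply: cvgM; [apply: cvgM|]|]; exact: g.
apply: cvgM.
  apply: cvgM; last exact: cvg_poch.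
  apply: cvgM; first exact: cvg_cst.
  by apply: cvg_poch; apply: cvgB; [apply: cvgD => //; exact: cvg_cst|exact: cvg_cst].
apply: cvgV; first by rewrite mulf_neq0// gt_eqF// poch_gt0// addr_gt0.
by apply: cvgM; exact: cvg_poch.
Qed.

Lemma cvg_diagonal_value (d n : nat) (k : 'I_d -> nat) (fa fb : T -> R) (a1 a2 b1 b2 c1 c2 : R) :
  0 < a1 -> 0 < a2 -> 0 < b1 -> 0 < b2 -> 0 < c1 -> 0 < c2 ->
  fa x @[x --> F] --> a1 -> fb x @[x --> F] --> b1 ->
  diagonal_value n k (fa x) a2 (fb x) b2 c1 c2 @[x --> F] -->
  diagonal_value n k a1 a2 b1 b2 c1 c2.
Proof.
move=> a1_0 a2_0 b1_0 b2_0 c1_0 c2_0 ha hb; rewrite /diagonal_value.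
apply: cvgM.
  apply: cvg_hahn_norm => //; rewrite ?ltr_wpDl//; try exact: cvg_cst.
  by apply: cvgD => //; exact: cvg_cst.
apply: cvg_prod => j; apply: cvg_hahn_norm; rewrite ?hahn_param_gt0//; try exact: cvg_cst.
  by rewrite /hahn_param; apply: cvgD; [apply: cvgD => //|]; exact: cvg_cst.
by rewrite /hahn_param; apply: cvgD; [apply: cvgD => //|]; exact: cvg_cst.
Qed.

End Continuation.

Section NearRegular.
Context {R : realType}.
Implicit Types (a b c : R).

(** A punctured neighbourhood of 0 avoids any given point, 0 included. *)
Lemma dnbhs_neq (y : R) : \forall e \near (0 : R)^', e != y.
Proof.
have [->|y0] := eqVneq y 0; first exact: nbhs_dnbhs_neq.
have y1 : 0 < `|y| by rewrite normr_gt0.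
apply: filterS (dnbhs0_lt y1) => e ey.
by apply: contraTneq ey => ->; rewrite ltxx.
Qed.

(** Along [e] each denominator is a product of nonconstant affine functions of [e]. *)
Lemma near_rhs_defined (d n : nat) (k : 'I_d -> nat) a1 a2 b1 b2 c1 c2 :
  \forall e \near (0 : R)^', rhs_defined n k (a1 + e) a2 (b1 + e) b2 c1 c2.
Proof.
have n1 : \forall e \near (0 : R)^', 2 * n%:R + (b1 + e + b2) + (c1 + c2) - 1 != 0.
  near=> e; rewrite (_ : _ - 1 = e - (1 - (2 * n%:R + (b1 + b2) + (c1 + c2)))); last by ring.
  by rewrite subr_eq0; near: e; exact: dnbhs_neq.
have n2 : \forall e \near (0 : R)^', forall j : 'I_d,
    poch (2 * (tail k j.+1)%:R + 2 * (a1 + e + a2) + (d - j.+1)%N%:R - 1) (k j) != 0.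
  apply: filter_forall => j.
  have : \forall e \near (0 : R)^', forall s : 'I_(k j),
      2 * (tail k j.+1)%:R + 2 * (a1 + e + a2) + (d - j.+1)%N%:R - 1 + s%:R != 0.
    apply: filter_forall => s; near=> e.
    rewrite (_ : _ + s%:R = 2 * (e - (1 - s%:R - (2 * (tail k j.+1)%:R + 2 * (a1 + a2) +
      (d - j.+1)%N%:R)) / 2)); last by field.
    by rewrite mulf_neq0 ?pnatr_eq0// subr_eq0; near: e; exact: dnbhs_neq.
  by apply: filterS => e H; rewrite /poch; apply/prodf_neq0 => s _.
apply: filterS2 n1 n2 => e e1 e2; rewrite /rhs_defined e1 /=.
by apply/forallP.
Unshelve. all: by end_near. Qed.

End NearRegular.

Theorem theorem3p5 (R : realType) (d : nat) (a1 a2 b1 b2 c1 c2 : R)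
    (k l : 'I_d -> nat) (n m : nat)
    (d_ge1 : (1 <= d)%N)
    (a1_gt0 : 0 < a1) (a2_gt0 : 0 < a2)
    (b1_gt0 : 0 < b1) (b2_gt0 : 0 < b2)
    (c1_gt0 : 0 < c1) (c2_gt0 : 0 < c2)
    (n_ge : (tail k 0 <= n)%N) (m_ge : (tail l 0 <= m)%N) :
  let F := integrand n k m l a1 a2 b1 b2 c1 c2 in
  let I := Cintegral (lebesgue_tuple d.+1) setT F in
  [/\ forall (t : R[i]) (x : 'I_d -> R[i]),
        Bfun n k a1 a2 b1 b2 c1 c2 t x = Bfun_Hahn n k a1 a2 b1 b2 c1 c2 t x,
      Cintegrable (lebesgue_tuple d.+1) setT F,
      rhs_defined n k a1 a2 b1 b2 c1 c2 ->
        I = (power_correction d * biorth_rhs n k m l a1 a2 b1 b2 c1 c2)%:C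
    & ~~ rhs_defined n k a1 a2 b1 b2 c1 c2 ->
        exists2 r : R,
          biorth_rhs n k m l (a1 + e) a2 (b1 + e) b2 c1 c2 @[e --> 0^'] --> r
        & I = (power_correction d * r)%:C].
Proof.
move=> F I.
have [iF IE] := Cintegral_integrand a1_gt0 a2_gt0 b1_gt0 b2_gt0 c1_gt0 c2_gt0 n_ge m_ge.
split.
- by move=> t x; exact: Bfun_HahnE.
- exact: iF.
- by move=> def; rewrite /I /F IE diagonal_valueE.
move=> _; set delta := (n == m)%:R * \prod_(j < d) (k j == l j)%:R in IE.
have pc0 : power_correction d != 0 :> R by rewrite invr_neq0// expf_neq0// pnatr_eq0.
exists (delta * diagonal_value n k a1 a2 b1 b2 c1 c2 / power_correction d); last first.
  by rewrite mulrC divfK.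
have shift (a : R) : a + e @[e --> 0^'] --> a.
  rewrite -[X in _ --> X]addr0; apply: cvgD; first exact: cvg_cst.
  exact: cvg_within.
have near_pos (a : R) : 0 < a -> \forall e \near 0^', 0 < a + e.
  move=> a0; have /cvgr_gt := shift a; exact.
(* The value of the integral is continuous in the parameters and agrees with the
closed form wherever the latter is defined. *)
have lim : delta * diagonal_value n k (a1 + e) a2 (b1 + e) b2 c1 c2 / power_correction d
    @[e --> 0^'] --> delta * diagonal_value n k a1 a2 b1 b2 c1 c2 / power_correction d.
  apply: cvgM; last exact: cvg_cst.
  apply: cvgM; first exact: cvg_cst.
  exact: cvg_diagonal_value.
apply: cvg_trans lim; apply: near_eq_cvg.
near=> e; rewrite -diagonal_valueE//; last 3 first.
- by near: e; exact: near_pos.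
- by near: e; exact: near_pos.
- by near: e; exact: near_rhs_defined.
by rewrite mulrAC divff ?mul1r.
Unshelve. all: by end_near. Qed.
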